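(* The $\mathbb{C}[[h]]$-module $\mathcal{L}_0(\mathfrak{sl}_2)\subset\mathcal{F}_0$ is a module for the double Yangian $\mathrm{DY}(\mathfrak{sl}_2)$ (with respect to the level 1 action of $\mathrm{DY}(\mathfrak{sl}_2)$ on $\mathcal{F}_0$ described in the context).
   Context: Double Yangian. Let $I$ be the identity and $P$ the permutation operator on $\mathbb{C}^2\otimes\mathbb{C}^2$, and $R(u)=\frac{1}{1+h/u}\left(I+\frac{h}{u}P\right)$. $\mathrm{DY}(\mathfrak{gl}_2)$ is the ($h$-adically completed) associative algebra over $\mathbb{C}[[h]]$ generated by a central element $C$ and $t_{ij}^{(r)}$, $i,j=1,2$, $r\in\mathbb{Z}$, subject to $R_{12}(u-v)T_{13}^{\pm}(u)T_{23}^{\pm}(v)=T_{23}^{\pm}(v)T_{13}^{\pm}(u)R_{12}(u-v)$ and $R_{12}(u-v-hC/2)T_{13}^{+}(u)T_{23}^{-}(v)=T_{23}^{-}(v)T_{13}^{+}(u)R_{12}(u-v+hC/2)$, where $T^{\pm}(u)=\sum_{i,j}e_{ij}\otimes t_{ij}^{\pm}(u)$, $t_{ij}^+(u)=\delta_{ij}-h\sum_{r\geq 0}t_{ij}^{(r)}u^{-r-1}$, $t_{ij}^-(u)=\delta_{ij}+h\sum_{r\geq 1}t_{ij}^{(-r)}u^{r-1}$. Set $k_1^{\pm}(u)=t_{11}^{\pm}(u)$, $k_2^{\pm}(u)=t_{22}^{\pm}(u)-t_{21}^{\pm}(u)t_{11}^{\pm}(u)^{-1}t_{12}^{\pm}(u)$,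 $X^+(u)=t_{11}^+(u-hC/4)^{-1}t_{12}^+(u-hC/4)-t_{11}^-(u+hC/4)^{-1}t_{12}^-(u+hC/4)$, $X^-(u)=t_{21}^+(u+hC/4)t_{11}^+(u+hC/4)^{-1}-t_{21}^-(u-hC/4)t_{11}^-(u-hC/4)^{-1}$, $X_{\pm\alpha}(u)=h^{-1}X^\pm(u)$. The double Yangian $\mathrm{DY}(\mathfrak{sl}_2)$ is the ($h$-adically completed) subalgebra generated by $C$ and all coefficients of $E(u)=X_\alpha(u+h/2)$, $F(u)=X_{-\alpha}(u+h/2)$, $H^{\pm}(u)=k_2^{\pm}(u+h/2)k_1^{\pm}(u+h/2)^{-1}$. Fock space. Let $\varepsilon_1,\varepsilon_2$ be the basis dual to $e_{11},e_{22}$, with form $(\varepsilon_j,\varepsilon_k)=\delta_{jk}$; $\alpha=\varepsilon_1-\varepsilon_2$, $Q=\mathbb{Z}\alpha$. Let $\widehat{\mathfrak{s}}$ be the Lie algebra generated by central $C$ and $a_j(r)$ ($j=1,2$, $r\in\mathbb{Z}\setminus\{0\}$) with $[a_j(r),a_k(s)]=r\delta_{jk}\delta_{r+s,0}C$, and $\widehat{\mathfrak{s}}^-$ the subalgebra generated by $a_j(r)$, $r<0$. Let $\mathcal{F}_0=U(\widehat{\mathfrak{s}}^-)[[h]]\otimes\mathbb{C}[Q][[h]]$ ($h$-adically completed), $\boldsymbol{1}=1\otimes1$. On $f\otimes e^\mu$: $C$ acts as $1$; $a_j(r)$ acts by $a_j(r)f\otimes e^\mu$ for $r<0$ and by $[a_j(r),f]\otimes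 e^\mu$ for $r>0$; $\partial_{\varepsilon_j}(f\otimes e^\mu)=(\varepsilon_j,\mu)f\otimes e^\mu$ ($\partial_\beta$ linear in $\beta$); $e^{\beta}(f\otimes e^\mu)=f\otimes e^{\beta+\mu}$. Put $E^-(u)=\exp\big(\sum_{r>0}\big(-\frac{a_1(-r)}{r}(u-\frac34h)^r+\frac{a_2(-r)}{r}(u+\frac h4)^r\big)\big)$, $E^+(u)=\exp\big(\sum_{r>0}\frac{a_1(r)-a_2(r)}{r}(u+\frac h4)^{-r}\big)$, $\mathcal{E}^-(u)=E^-(0)^{-1}E^-(u)$. Action. $\mathcal{F}_0$ is a $\mathrm{DY}(\mathfrak{gl}_2)$-module with $C$ acting as $1$ and $X_\alpha(u)=\mathcal{E}^-(u)E^+(u)e^\alpha u^{\partial_{\alpha/2}}(u+h)^{\partial_{\alpha/2}}$, $X_{-\alpha}(u)=\mathcal{E}^-(u+h/2)^{-1}E^+(u-h/2)^{-1}e^{-\alpha}(u-h/2)^{-\partial_{\alpha/2}}(u+h/2)^{-\partial_{\alpha/2}}$, $k_j^+(u)=\exp\big(-\sum_{r>0}\frac{a_j(r)}{r}((u+\frac h2)^{-r}-(u-\frac h2)^{-r})\big)\,c_j(u)^{\partial_{\alpha/2}}$ with $c_1(u)=\frac{u+h/4}{u+5h/4}$, $c_2(u)=\frac{u+h/4}{u-3h/4}$, $k_1^-(u)=\exp\big(\sum_{r>0}\frac{a_2(-r)}{r}((u+h)^r-u^r)\big)$, $k_2^-(u)=\exp\big(\sum_{r>0}\frac{a_1(-r)}{r}(u^r-(u-h)^r)\big)$.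 Expressions such as $(u+ah)^p$ are expanded in nonnegative powers of $h$. The submodule. Write $X_\alpha(u)=\sum_{r\in\mathbb{Z}}x(r)u^{-r-1}$. Let $B_{W_0}$ be the set of all $x(r_n)\cdots x(r_1)\boldsymbol{1}$ with $n\geq0$, $r_1\leq-1$ and $r_{j+1}\leq r_j-2$ for $j=1,\ldots,n-1$. Then $\mathcal{L}_0(\mathfrak{sl}_2)\subset\mathcal{F}_0$ is the $h$-adically completed $\mathbb{C}[[h]]$-span of $\{e^{k\alpha}b: k\in\mathbb{Z},\,b\in B_{W_0}\}$. *)

(* Defs.v *)
From HB Require Import structures.
From mathcomp Require Import all_boot all_order all_algebra.
From mathcomp Require Import all_classical.
From mathcomp Require Import reals.
From mathcomp Require Import finmap complex.
From mathcomp Require Import generic_quotient ring_quotient.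
From mathcomp.multinomials Require Import monalg.

Set Implicit Arguments.
Unset Strict Implicit.
Unset Printing Implicit Defensive.

Import GRing.Theory.
Local Open Scope classical_set_scope.
Local Open Scope ring_scope.

(* B[[h]]: the value at n is the coefficient of h^n.  When B is a vector space
   over a field K this is the h-adic completion of B (x) K[[h]]. *)
Definition pser (B : Type) := nat -> B.

HB.instance Definition _ (B : zmodType) :=
  GRing.Zmodule.copy (pser B) (nat -> B).

(* Cauchy product along a biadditive map. *)
Definition hconv (B D E : zmodType) (op : B -> D -> E)
    (f : pser B) (g : pser D) : pser E :=
  fun n => \sum_(i < n.+1) op (f i) (g (n - i)%N).

Definition hcst (B : zmodType) (b : B) : pser B :=
  fun n => if n == 0%N then b else 0.

Section PserRing.
Variable B : nzRingType.
Implicit Types f g k : pser B.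

Let mul f g : pser B := hconv *%R f g.
Let P m f : {poly B} := \poly_(i < m) f i.

Let mulP m n f g : (n < m)%N -> mul f g n = (P m f * P m g)`_n.
Proof.
move=> nm; rewrite coefM /mul /hconv; apply: eq_bigr => i _.
rewrite !coef_poly (leq_ltn_trans (leq_ord i) nm).
by rewrite (leq_ltn_trans (leq_subr _ _) nm).
Qed.

Let P_mul m n f g : (n < m)%N -> (P m (mul f g))`_n = (P m f * P m g)`_n.
Proof. by move=> nm; rewrite coef_poly nm; apply: mulP. Qed.

Fact pser_mulA : associative mul.
Proof.
move=> f g k; apply/funext => n; rewrite !(mulP _ _ (ltnSn n)).
transitivity ((P n.+1 f * (P n.+1 g * P n.+1 k))`_n).
  rewrite 2!coefM; apply: eq_bigr => i _.
  by rewrite P_mul // ltnS leq_subr.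
rewrite mulrA 2!coefM; apply: eq_bigr => i _.
by rewrite P_mul.
Qed.

Fact pser_mul1 : left_id (hcst 1) mul.
Proof.
move=> f; apply/funext => n; rewrite /mul /hconv big_ord_recl /hcst /= mul1r.
by rewrite subn0 big1 ?addr0 // => i _; rewrite mul0r.
Qed.

Fact pser_mulr1 : right_id (hcst 1) mul.
Proof.
move=> f; apply/funext => n; rewrite /mul /hconv big_ord_recr /hcst /= subnn.
rewrite mulr1 big1 ?add0r // => i _.
by rewrite subn_eq0 leqNgt ltn_ord /= mulr0.
Qed.

Fact pser_mulDl : left_distributive mul +%R.
Proof.
move=> f g k; apply/funext => n; rewrite /mul /hconv.
under eq_bigr do rewrite mulrDl.
by rewrite big_split.
Qed.

Fact pser_mulDr : right_distributive mul +%R.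
Proof.
move=> f g k; apply/funext => n; rewrite /mul /hconv.
under eq_bigr do rewrite mulrDr.
by rewrite big_split.
Qed.

Fact pser_oner_neq0 : hcst (1 : B) != 0.
Proof.
apply/eqP => /(congr1 (fun f : pser B => f 0%N)); rewrite /hcst /=.
by apply/eqP; exact: oner_neq0.
Qed.

HB.instance Definition _ := GRing.Zmodule_isNzRing.Build (pser B)
  pser_mulA pser_mul1 pser_mulr1 pser_mulDl pser_mulDr pser_oner_neq0.

Definition hvar : pser B := fun n => if n == 1%N then 1 else 0.

End PserRing.

Arguments hvar {B}.

Definition hscale (K : nzRingType) (V : lmodType K) (c : pser K) (v : pser V) :
  pser V := hconv *:%R c v.

(* Image in M of the h-adic completion of S, where hm is multiplication by h:
   the sums of convergent series  s_0 + h s_1 + h^2 s_2 + ...  with s_n in S. *)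
Definition hcompletion (M : zmodType) (hm : M -> M) (S : set M) : set M :=
  [set x | exists2 s : nat -> M, (forall n, S (s n)) &
    forall N, exists z, x = \sum_(n < N) iter n hm (s n) + iter N hm z].

(* A distribution over the group G of exponents: the value at m is the
   coefficient of u^m for G = int, and of u^m.1 v^m.2 for G = int * int. *)
Definition fdist (G B : Type) := G -> pser B.

(* Product of distributions along op.  It is used only when, for all m and n,
   the family summed over the group of exponents has finite support. *)
Definition dconv (G : zmodType) (B D E : zmodType) (op : B -> D -> E)
    (p : fdist G B) (q : fdist G D) : fdist G E :=
  fun m n => \sum_(i < n.+1)
    \sum_(l \in [set: G]) op (p l i) (q (m - l) (n - i)%N).

Definition dcst (G : zmodType) (B : zmodType) (b : B) : fdist G B :=
  fun m => if m == 0 then hcst b else 0.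

(* Generalized binomial coefficient "r choose n" for an integer r. *)
Definition binz (K : fieldType) (r : int) (n : nat) : K :=
  (\prod_(i < n) (r - i%:Z)%:~R) / (n`!)%:R.

(* p(u + c h), expanded in nonnegative powers of h; pow j x stands for c^j x *)
Definition dshift (K : fieldType) (B : lmodType K) (pow : nat -> B -> B)
    (p : fdist int B) : fdist int B :=
  fun m n => \sum_(j < n.+1)
    binz K (m + j%:Z) j *: pow j (p (m + j%:Z) (n - j)%N).

Definition dshiftK (K : fieldType) (B : lmodType K) (a : K) :=
  dshift (fun j (x : B) => a ^+ j *: x).

Section DoubleYangian.
Variable K : fieldType.

(* None is the central element C, and Some (i, j, r) is t_ij^(r). *)
Definition gen : Type := option ('I_2 * 'I_2 * int).
Definition freeAlg := {malg K[{fmonom gen}]}.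

Definition genA (g : gen) : freeAlg := << fmu g >>.
Definition tA (i j : 'I_2) (r : int) : freeAlg := genA (Some (i, j, r)).
Definition cA : freeAlg := genA None.

Definition cfree := pser freeAlg.

Definition dmul (G : zmodType) (p q : fdist G freeAlg) : fdist G freeAlg :=
  dconv *%R p q.

(* Inverse as a geometric series; used only when, at every order, only
   finitely many powers of 1 - p contribute. *)
Definition dinv (p : fdist int freeAlg) : fdist int freeAlg :=
  fun m n => \sum_(k \in [set: nat])
    iter k (dmul (dcst (1 : freeAlg) - p)) (dcst 1) m n.

Definition dshiftC (a : K) (p : fdist int freeAlg) : fdist int freeAlg :=
  dshift (fun j x => (a *: cA) ^+ j * x) p.

(* The sign of a current: true for +, false for -. *)
Definition tser (s : bool) (i j : 'I_2) : fdist int freeAlg :=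
  fun m n =>
    if n == 0%N then (if (m == 0) && (i == j) then 1 else 0)
    else if n == 1%N then
      if s then (if m < 0 then - tA i j (- m - 1) else 0)
      else (if 0 <= m then tA i j (- m - 1) else 0)
    else 0.

(* Entry at e_ij (x) e_kl of the coefficient of x^s in
   (1 + x)^-1 (I + x P), where x = h / u and P = \sum e_ij (x) e_ji. *)
Definition Rcoef (s : nat) (i j k l : 'I_2) : K :=
  (-1) ^+ s * ((i == j) && (k == l))%:R +
  (if s is s'.+1 then (-1) ^+ s' * ((i == l) && (k == j))%:R else 0).

(* Entry at e_ij (x) e_kl of R(u - v + a h C): the coefficient of h^n in
   (h / (u - v + a h C))^s is  binz (-s) (n - s) (a C)^(n - s) (u - v)^(-n),
   and (u - v)^(-n) is expanded in nonnegative powers of v. *)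
Definition Rser (a : K) (i j k l : 'I_2) : fdist (int * int)%type freeAlg :=
  fun m n =>
    if (0 <= m.2) && (m.1 == - n%:Z - m.2) then
      (binz K (- n%:Z) `|m.2|%N * (-1) ^+ `|m.2|%N) *:
      \sum_(s < n.+1) (Rcoef s i j k l * binz K (- s%:Z) (n - s)) *:
        (a *: cA) ^+ (n - s)
    else 0.

Definition in_u (p : fdist int freeAlg) : fdist (int * int)%type freeAlg :=
  fun m => if m.2 == 0 then p m.1 else 0.
Definition in_v (p : fdist int freeAlg) : fdist (int * int)%type freeAlg :=
  fun m => if m.1 == 0 then p m.2 else 0.

(* Entry at e_ij (x) e_kl of
   R(u - v + a h C) T13^s(u) T23^s'(v) - T23^s'(v) T13^s(u) R(u - v + b h C) *)
Definition RTT (s s' : bool) (a b : K) (i j k l : 'I_2) :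
    fdist (int * int)%type freeAlg :=
  (\sum_(x : 'I_2) \sum_(y : 'I_2)
     dmul (dmul (Rser a i x k y) (in_u (tser s x j))) (in_v (tser s' y l)))
  - (\sum_(x : 'I_2) \sum_(y : 'I_2)
     dmul (dmul (in_v (tser s' k y)) (in_u (tser s i x))) (Rser b x j y l)).

(* The defining relations, as elements of the completed free algebra which
   become zero in the double Yangian. *)
Variant DYrel : cfree -> Prop :=
| rel_central g : DYrel (hcst (cA * genA g - genA g * cA))
| rel_same s i j k l m : DYrel (RTT s s 0 0 i j k l m)
| rel_mixed i j k l m :
    DYrel (RTT true false (- (1 / 2)) (1 / 2) i j k l m).

Inductive DYideal : cfree -> Prop :=
| ideal_rel x : DYrel x -> DYideal x
| ideal_0 : DYideal 0
| ideal_sub x y : DYideal x -> DYideal y -> DYideal (x - y)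
| ideal_mull a x : DYideal x -> DYideal (a * x)
| ideal_mulr a x : DYideal x -> DYideal (x * a).

Definition DYclosed_ideal : {pred cfree} := fun x =>
  `[< forall N, exists2 y, DYideal y & forall n, (n < N)%N -> x n = y n >].

Fact DYclosed_ideal_zmod : zmod_closed DYclosed_ideal.
Proof.
split=> [|x y]; first by apply/asboolP => N; exists 0 => //; exact: ideal_0.
move=> /asboolP xJ /asboolP yJ; apply/asboolP => N.
have [x' x'I xx'] := xJ N; have [y' y'I yy'] := yJ N.
exists (x' - y') => [|n nN]; first exact: ideal_sub.
by rewrite -[LHS]/(x n - y n) xx' // yy'.
Qed.

HB.instance Definition _ :=
  GRing.isZmodClosed.Build cfree DYclosed_ideal DYclosed_ideal_zmod.

Fact DYclosed_ideal_mull a x : x \in DYclosed_ideal -> a * x \in DYclosed_ideal.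
Proof.
move=> /asboolP xJ; apply/asboolP => N; have [y yI xy] := xJ N.
exists (a * y) => [|n nN]; first exact: ideal_mull.
apply: eq_bigr => i _; rewrite xy //.
exact: leq_ltn_trans (leq_subr _ _) nN.
Qed.

Fact DYclosed_ideal_mulr a x : x \in DYclosed_ideal -> x * a \in DYclosed_ideal.
Proof.
move=> /asboolP xJ; apply/asboolP => N; have [y yI xy] := xJ N.
exists (y * a) => [|n nN]; first exact: ideal_mulr.
apply: eq_bigr => i _; rewrite xy //.
exact: leq_ltn_trans (leq_ord i) nN.
Qed.

(* The completed algebra with the given presentation: the quotient of the
   h-adically completed free algebra by the h-adic closure of the ideal. *)
Definition DYgl2 := Quotient.quot DYclosed_ideal.

HB.instance Definition _ := GRing.Zmodule.on DYgl2.

Definition toDY (x : cfree) : DYgl2 := (\pi_DYgl2 x)%qT.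

Definition DYone : DYgl2 := toDY 1.
Definition DYmul (x y : DYgl2) : DYgl2 := toDY (repr x * repr y).

Fact toDY_eq x y : (toDY x == toDY y) = (x - y \in DYclosed_ideal).
Proof. by rewrite Quotient.idealrBE. Qed.

Fact toDYB x y : toDY (x - y) = toDY x - toDY y.
Proof. by rewrite /toDY !piE. Qed.

Fact toDYD x y : toDY (x + y) = toDY x + toDY y.
Proof. by rewrite /toDY !piE. Qed.

Fact toDYM x y : toDY (x * y) = DYmul (toDY x) (toDY y).
Proof.
apply/eqP; rewrite toDY_eq.
set x' := repr _; set y' := repr _.
have xx' : x - x' \in DYclosed_ideal by rewrite -toDY_eq /toDY reprK.
have yy' : y - y' \in DYclosed_ideal by rewrite -toDY_eq /toDY reprK.
rewrite -[x * y](subrK (x' * y)) -mulrBl -addrA -mulrBr.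
by apply: rpredD; [exact: DYclosed_ideal_mulr | exact: DYclosed_ideal_mull].
Qed.

Let toDY_ind (Q : DYgl2 -> Prop) : (forall x, Q (toDY x)) -> forall x, Q x.
Proof. by move=> QP x; rewrite -[x]reprK; apply: QP. Qed.

Fact DYmulA : associative DYmul.
Proof.
elim/toDY_ind=> x; elim/toDY_ind=> y; elim/toDY_ind=> z.
by rewrite -!toDYM mulrA.
Qed.

Fact DYmul1 : left_id DYone DYmul.
Proof. by elim/toDY_ind=> x; rewrite -toDYM mul1r. Qed.

Fact DYmulr1 : right_id DYone DYmul.
Proof. by elim/toDY_ind=> x; rewrite -toDYM mulr1. Qed.

Fact DYmulDl : left_distributive DYmul +%R.
Proof.
elim/toDY_ind=> x; elim/toDY_ind=> y; elim/toDY_ind=> z.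
by rewrite -toDYD -!toDYM -toDYD mulrDl.
Qed.

Fact DYmulDr : right_distributive DYmul +%R.
Proof.
elim/toDY_ind=> x; elim/toDY_ind=> y; elim/toDY_ind=> z.
by rewrite -toDYD -!toDYM -toDYD mulrDr.
Qed.

HB.instance Definition _ := GRing.Zmodule_isPzRing.Build DYgl2
  DYmulA DYmul1 DYmulr1 DYmulDl DYmulDr.

Definition DYscal (c : pser K) : DYgl2 := toDY (fun n => (c n)%:A).

Notation i1 := (ord0 : 'I_2).
Notation i2 := (ord_max : 'I_2).

Definition k1 (s : bool) : fdist int freeAlg := tser s i1 i1.
Definition k2 (s : bool) : fdist int freeAlg :=
  tser s i2 i2 - dmul (tser s i2 i1) (dmul (dinv (tser s i1 i1)) (tser s i1 i2)).

Definition Xplus : fdist int freeAlg :=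
  let t s j := dshiftC (if s then - (1 / 4) else 1 / 4) (tser s i1 j) in
  dmul (dinv (t true i1)) (t true i2) - dmul (dinv (t false i1)) (t false i2).

Definition Xmin_us : fdist int freeAlg :=
  let t s i := dshiftC (if s then 1 / 4 else - (1 / 4)) (tser s i i1) in
  dmul (t true i2) (dinv (t true i1)) - dmul (t false i2) (dinv (t false i1)).

(* Division by h; the constant terms in h of Xplus and Xmin_us are zero. *)
Definition hdiv (p : fdist int freeAlg) : fdist int freeAlg :=
  fun m n => p m n.+1.

(* X_alpha is Xroot true, and X_(-alpha) is Xroot false. *)
Definition Xroot (s : bool) : fdist int freeAlg :=
  hdiv (if s then Xplus else Xmin_us).

Definition Ecur : fdist int freeAlg := dshiftK (1 / 2) (Xroot true).
Definition Fcur : fdist int freeAlg := dshiftK (1 / 2) (Xroot false).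
Definition Hcur (s : bool) : fdist int freeAlg :=
  dmul (dshiftK (1 / 2) (k2 s)) (dinv (dshiftK (1 / 2) (k1 s))).

Inductive DYsl2_alg : DYgl2 -> Prop :=
| sl2_scal c : DYsl2_alg (DYscal c)
| sl2_C : DYsl2_alg (toDY (hcst cA))
| sl2_E m : DYsl2_alg (toDY (Ecur m))
| sl2_F m : DYsl2_alg (toDY (Fcur m))
| sl2_H s m : DYsl2_alg (toDY (Hcur s m))
| sl2_add x y : DYsl2_alg x -> DYsl2_alg y -> DYsl2_alg (x + y)
| sl2_mul x y : DYsl2_alg x -> DYsl2_alg y -> DYsl2_alg (x * y).

(* Completing the K[[h]]-subalgebra DYsl2_alg inside DYgl2. *)
Definition DYsl2 : set DYgl2 :=
  hcompletion ( *%R (toDY hvar)) [set x | DYsl2_alg x].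

(* The subalgebra of s^ spanned by the a_j(r), r < 0, is abelian, so its
   enveloping algebra is the polynomial algebra in the a_j(r), and
   U (x) K[Q] has a basis of the  m (x) e^(k alpha)  with m a monomial.  The
   variable indexed by (j, n) is a_j(-n-1). *)
Definition fbasis : Type := ({cmonom ('I_2 * nat)} * int)%type.
Definition fock0 := {malg K[fbasis]}.
Definition fock := pser fock0.

Definition lext (f : fbasis -> fock0) (v : fock0) : fock0 :=
  \sum_(b <- msupp v) v@_b *: f b.

(* For r > 0, [a_j(r), -] is the derivation r d/da_j(-r) since C acts as 1. *)
Definition aop (j : 'I_2) (r : int) : fock0 -> fock0 :=
  match r with
  | Negz n => lext (fun b => << (mulcm b.1 (ucm (j, n)), b.2) >>)
  | Posz 0 => 0
  | Posz n.+1 => lext (fun b =>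
      (n.+1 * b.1 (j, n))%N%:R *: << (divcm b.1 (ucm (j, n)), b.2) >>)
  end.

Definition eop (k : int) : fock0 -> fock0 :=
  lext (fun b => << (b.1, b.2 + k) >>).

(* Distributions of operators; these are given by their values on fock0 and
   products and infinite sums are pointwise, being finite at each vector. *)
Definition odist := fdist int (fock0 -> fock0).

Definition omul (p q : odist) : odist := fun m n v =>
  dconv (fun (T : fock0 -> fock0) w => T w) p (fun m' n' => q m' n' v) m n.

Definition o1 : odist := dcst (id : fock0 -> fock0).

Definition opow (p : odist) (k : nat) : odist := iter k (omul p) o1.

Definition oexp (p : odist) : odist := fun m n v =>
  \sum_(k \in [set: nat]) (k`!%:R)^-1 *: opow p k m n v.

Definition oinv (p : odist) : odist := fun m n v =>
  \sum_(k \in [set: nat]) opow (o1 - p) k m n v.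

Definition oev0 (p : odist) : odist := fun m => if m == 0 then p 0 else 0.

Definition osh (a : K) (p : odist) : odist := dshiftK a p.

(* \sum_(r > 0) (a_j(-r) / r) u^r  and  \sum_(r > 0) (a_j(r) / r) u^(-r) *)
Definition acre (j : 'I_2) : odist := fun m n =>
  if (n == 0%N) && (0 < m) then (m%:~R)^-1 *: aop j (- m) else 0.
Definition aann (j : 'I_2) : odist := fun m n =>
  if (n == 0%N) && (m < 0) then ((- m)%:~R)^-1 *: aop j (- m) else 0.

(* u^(eps d) for d the operator \partial_(alpha/2), which is multiplication
   by k on  f (x) e^(k alpha)  because (alpha/2, k alpha) = k *)
Definition upow (eps : int) : odist := fun m n =>
  if n == 0%N then lext (fun b => if eps * b.2 == m then << b >> else 0) else 0.

Definition Eneg : odist :=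
  oexp (- osh (- (3 / 4)) (acre i1) + osh (1 / 4) (acre i2)).
Definition Epos : odist := oexp (osh (1 / 4) (aann i1 - aann i2)).
Definition Ecal : odist := omul (oinv (oev0 Eneg)) Eneg.

Definition XposF : odist :=
  omul Ecal (omul Epos (omul (dcst (eop 1))
    (omul (upow 1) (osh 1 (upow 1))))).

Definition XnegF : odist :=
  omul (oinv (osh (1 / 2) Ecal)) (omul (oinv (osh (- (1 / 2)) Epos))
    (omul (dcst (eop (- 1)))
      (omul (osh (- (1 / 2)) (upow (- 1))) (osh (1 / 2) (upow (- 1)))))).

Definition k1posF : odist :=
  omul (oexp (- (osh (1 / 2) (aann i1) - osh (- (1 / 2)) (aann i1))))
    (omul (osh (1 / 4) (upow 1)) (osh (5 / 4) (upow (- 1)))).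
Definition k2posF : odist :=
  omul (oexp (- (osh (1 / 2) (aann i2) - osh (- (1 / 2)) (aann i2))))
    (omul (osh (1 / 4) (upow 1)) (osh (- (3 / 4)) (upow (- 1)))).
Definition k1negF : odist := oexp (osh 1 (acre i2) - acre i2).
Definition k2negF : odist := oexp (acre i1 - osh (- 1) (acre i1)).

Definition oapp (T : pser (fock0 -> fock0)) (v : fock) : fock :=
  hconv (fun (S : fock0 -> fock0) w => S w) T v.

Record DYgl2_module := {
  DYact : DYgl2 -> fock -> fock;
  DYact_addl : forall x y v, DYact (x + y) v = DYact x v + DYact y v;
  DYact_addr : forall x v w, DYact x (v + w) = DYact x v + DYact x w;
  DYact_mul : forall x y v, DYact (x * y) v = DYact x (DYact y v);
  DYact_scal : forall c v, DYact (DYscal c) v = hscale c v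
}.

Record level_one (rho : DYgl2_module) : Prop := {
  lev1_C : forall v, DYact rho (toDY (hcst cA)) v = v;
  lev1_Xpos : forall m v, DYact rho (toDY (Xroot true m)) v = oapp (XposF m) v;
  lev1_Xneg : forall m v, DYact rho (toDY (Xroot false m)) v = oapp (XnegF m) v;
  lev1_k1pos : forall m v, DYact rho (toDY (k1 true m)) v = oapp (k1posF m) v;
  lev1_k2pos : forall m v, DYact rho (toDY (k2 true m)) v = oapp (k2posF m) v;
  lev1_k1neg : forall m v, DYact rho (toDY (k1 false m)) v = oapp (k1negF m) v;
  lev1_k2neg : forall m v, DYact rho (toDY (k2 false m)) v = oapp (k2negF m) v
}.

Definition vac : fock := hcst << (onecm _, 0) >>.

(* The coefficient x(r) of u^(-r-1) in X_alpha(u). *)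
Definition xop (r : int) : fock -> fock := oapp (XposF (- r - 1)).

(* For rs = [:: r_1; ...; r_n]:  r_1 <= -1  and  r_(j+1) <= r_j - 2 *)
Definition diff2 (rs : seq int) : bool :=
  if rs is r :: rs' then (r <= -1) && path (fun a b => b <= a - 2) r rs'
  else true.

Definition BW0 : set fock :=
  [set v | exists2 rs, diff2 rs & v = foldl (fun w r => xop r w) vac rs].

Definition eact (k : int) (v : fock) : fock := fun n => eop k (v n).

Definition hspan (S : set fock) : set fock :=
  [set v | exists n (c : 'I_n -> pser K) (w : 'I_n -> fock),
    (forall i, S (w i)) /\ v = \sum_i hscale (c i) (w i)].

Definition L0 : set fock :=
  hcompletion (hscale hvar)
    (hspan [set v | exists k, exists2 b, BW0 b & v = eact k b]).

Definition is_DYsl2_submodule (rho : DYgl2_module) (L : set fock) : Prop :=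
  [/\ L 0, forall v w, L v -> L w -> L (v + w),
      forall c v, L v -> L (hscale c v)
    & forall y v, DYsl2 y -> L v -> L (DYact rho y v)].

End DoubleYangian.

Arguments L0 : clear implicits.

(* Main.v *)
From HB Require Import structures.
From mathcomp Require Import all_boot all_order all_algebra.
From mathcomp Require Import all_classical.
From mathcomp Require Import reals complex.
From mathcomp Require Import finmap zify ring.
From mathcomp.multinomials Require Import monalg.

Require Import Defs.

Set Implicit Arguments.
Unset Strict Implicit.
Unset Printing Implicit Defensive.

Import Order.TTheory GRing.Theory Num.Theory.
Local Open Scope classical_set_scope.
Local Open Scope ring_scope.
(** The completed span of the vectors e^(k alpha) b is the common kernel of
    deformed annihilation operators, and every generator of DY(sl_2) commutes
    with these.

    For r > 0 put
      c_r = a_2(r) + \sum_(1 <= s <= r) 'C(r, s) h^(r - s) a_1(s),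
    and X_j(a) = \sum_(s > 0) (a_j(-s) / s) (u + a h)^s.  As
    [a_i(r), X_j(a)] = (u + a h)^r for i = j and 0 otherwise, the binomial
    theorem gives [c_r, X_2(a)] = (u + a h)^r and
    [c_r, X_1(a)] = (u + (a + 1) h)^r - h^r.  The exponent of E^-(u) is
    - X_1(- 3/4) + X_2(1/4), so its commutator with c_r is h^r, which does not
    depend on u and is cancelled by the factor E^-(0)^-1: both X_alpha and
    X_(-alpha) commute with c_r (cann_ecal, Xpos_modes, Xneg_modes).  So do the
    k_j^+, which involve no creation operator (kpos_modes), while
    [c_r, k_j^-(u)] = ((u + h)^r - u^r) k_j^-(u) with the same factor for j = 1
    and j = 2 (cann_k1, cann_k2), so that the quotients H^- commute with c_r as
    well (ad_quotient, capp_Hcur).  Hence the kernel is stable under DY(sl_2).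

    The span lies in the kernel, because the c_r kill the vacuum and commute with
    the x(r) and the e^(k alpha).  For the converse (L0E), the kernel contains v
    as soon as it contains h v, and by successive approximation
    (hcompletion_approx) it is enough to find, for v in the kernel, an element of
    the span equal to v modulo h.  Modulo h the operator c_r is
    a_1(r) + a_2(r), and the vectors killed by all of these are generated from
    the e^(k alpha) by the a_1(-r) - a_2(-r) (kernel_zspan), or equally by the
    coefficients H_m of E^-(u) at h = 0 (zcr_U).  So the classical statement
    remains that the vectors e^(k alpha) x(r_n) ... x(r_1) 1, at h = 0, span all
    products of the H_m applied to the e^(k alpha) (T_hword).  With the D_s the
    coefficients of E^+(u) at h = 0, a mode of X_alpha acts on such products as
    \sum_s H_(l + s) D_s, and D_s lowers the indices of a product; so
    x(r_n) ... x(r_1) 1 is the product H_(l_n) ... H_(l_1) e^(n alpha) plus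
    products with the same number of factors, the same total index, and a larger
    sum of squares of the indices (xstate_lead).  The difference condition on the
    r_j says exactly that l_1 <= ... <= l_n, and the sum of squares is bounded,
    whence the spanning by induction. *)


(** * Endomorphism algebras *)

Section EndoDef.
Variables (K : comNzRingType) (V : lmodType K).

(** The argument ntV makes the endomorphism ring nontrivial, as the power series
    rings over it require. *)
Record endo (ntV : exists v : V, v != 0) : Type :=
  Endo { endo_fun :> V -> V; endo_linP : linear endo_fun }.

Variable ntV : exists v : V, v != 0.
Notation E := (endo ntV).

HB.instance Definition _ := gen_eqMixin E.
HB.instance Definition _ := gen_choiceMixin E.
HB.instance Definition _ (e : E) :=
  GRing.isLinear.Build K V V *:%R (endo_fun e) (@endo_linP _ e).

Definition mkendo (f : V -> V) (lf : linear f) : E := Endo ntV lf.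

Lemma endoP (e e' : E) : (forall v, e v = e' v) -> e = e'.
Proof. case: e e' => [f fl] [g gl] /= /funext fg.
by case: _ / fg in gl *; congr Endo; apply: Prop_irrelevance. Qed.

Fact endo0_lin : linear (fun _ : V => 0 : V).
Proof. by move=> a x y; rewrite scaler0 addr0. Qed.
Fact endoN_lin (e : E) : linear (fun v => - e v).
Proof. by move=> a x y; rewrite linearP opprD scalerN. Qed.
Fact endoD_lin (e e' : E) : linear (fun v => e v + e' v).
Proof. by move=> a x y; rewrite !linearP scalerDr addrACA. Qed.
Fact endo1_lin : linear (fun v : V => v).
Proof. by []. Qed.
Fact endoM_lin (e e' : E) : linear (fun v => e (e' v)).
Proof. by move=> a x y; rewrite !linearP. Qed.
Fact endoZ_lin (a : K) (e : E) : linear (fun v => a *: e v).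
Proof. by move=> b x y; rewrite linearP scalerDr !scalerA mulrC. Qed.

Let add e e' := mkendo (endoD_lin e e').
Let mul e e' := mkendo (endoM_lin e e').
Let scale a e := mkendo (endoZ_lin a e).

Fact endo_addA : associative add.
Proof. by move=> e e' e''; apply: endoP => v; apply: addrA. Qed.
Fact endo_addC : commutative add.
Proof. by move=> e e'; apply: endoP => v; apply: addrC. Qed.
Fact endo_add0 : left_id (mkendo endo0_lin) add.
Proof. by move=> e; apply: endoP => v; apply: add0r. Qed.
Fact endo_addN : left_inverse (mkendo endo0_lin) (fun e => mkendo (endoN_lin e)) add.
Proof. by move=> e; apply: endoP => v; apply: addNr. Qed.

HB.instance Definition _ := GRing.isZmodule.Build E
  endo_addA endo_addC endo_add0 endo_addN.

Fact endo_mulA : associative mul.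
Proof. by move=> e e' e''; apply: endoP. Qed.
Fact endo_mul1 : left_id (mkendo endo1_lin) mul.
Proof. by move=> e; apply: endoP. Qed.
Fact endo_mulr1 : right_id (mkendo endo1_lin) mul.
Proof. by move=> e; apply: endoP. Qed.
Fact endo_mulDl : left_distributive mul +%R.
Proof. by move=> e e' e''; apply: endoP. Qed.
Fact endo_mulDr : right_distributive mul +%R.
Proof. by move=> e e' e''; apply: endoP => v; apply: (linearD e). Qed.
Fact endo_oner_neq0 : mkendo endo1_lin != 0.
Proof.
apply/eqP => /(congr1 (@endo_fun ntV)) e10; case: ntV => v /eqP; apply.
exact: (congr1 (fun f : V -> V => f v) e10).
Qed.

HB.instance Definition _ := GRing.Zmodule_isNzRing.Build E
  endo_mulA endo_mul1 endo_mulr1 endo_mulDl endo_mulDr endo_oner_neq0.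

Fact endo_scaleA a b e : scale a (scale b e) = scale (a * b) e.
Proof. by apply: endoP => v; apply: scalerA. Qed.
Fact endo_scale1 : left_id 1 scale.
Proof. by move=> e; apply: endoP => v; apply: scale1r. Qed.
Fact endo_scaleDr : right_distributive scale +%R.
Proof. by move=> a e e'; apply: endoP => v; apply: scalerDr. Qed.
Fact endo_scaleDl e : {morph scale^~ e : a b / a + b}.
Proof. by move=> a b; apply: endoP => v; apply: scalerDl. Qed.

HB.instance Definition _ := GRing.Zmodule_isLmodule.Build K E
  endo_scaleA endo_scale1 endo_scaleDr endo_scaleDl.

Fact endo_scaleAl (a : K) (e e' : E) : a *: (e * e') = a *: e * e'.
Proof. by apply: endoP. Qed.
HB.instance Definition _ := GRing.Lmodule_isLalgebra.Build K E endo_scaleAl.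

Fact endo_scaleAr (a : K) (e e' : E) : a *: (e * e') = e * (a *: e').
Proof. by apply: endoP => v; symmetry; apply: (linearZ_LR e). Qed.
HB.instance Definition _ := GRing.Lalgebra_isAlgebra.Build K E endo_scaleAr.

Lemma endo0E v : (0 : E) v = 0. Proof. by []. Qed.
Lemma endo1E v : (1 : E) v = v. Proof. by []. Qed.
Lemma endoDE (e e' : E) v : (e + e') v = e v + e' v. Proof. by []. Qed.
Lemma endoNE (e : E) v : (- e) v = - e v. Proof. by []. Qed.
Lemma endoME (e e' : E) v : (e * e') v = e (e' v). Proof. by []. Qed.
Lemma endoZE a (e : E) v : (a *: e) v = a *: e v. Proof. by []. Qed.

Lemma endo_sumE I (r : seq I) (P : pred I) (F : I -> E) v :
  (\sum_(i <- r | P i) F i) v = \sum_(i <- r | P i) F i v.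
Proof. by elim/big_rec2: _ => // i x y _ <-. Qed.

Lemma endoZr (e : E) a v : e (a *: v) = a *: e v.
Proof. exact: linearZ_LR. Qed.
Lemma endoDr (e : E) v w : e (v + w) = e v + e w.
Proof. exact: linearD. Qed.
Lemma endoNr (e : E) v : e (- v) = - e v.
Proof. exact: linearN. Qed.
Lemma endo0r (e : E) : e 0 = 0.
Proof. exact: linear0. Qed.
Lemma endo_sumr (e : E) I (r : seq I) (P : pred I) (F : I -> V) :
  e (\sum_(i <- r | P i) F i) = \sum_(i <- r | P i) e (F i).
Proof. exact: linear_sum. Qed.

End EndoDef.

(** * Power series in u and h *)

Section PserModule.
Variables (K : nzRingType) (V : lmodType K).
Implicit Types (a : K) (f : pser V).

Let scale a f : pser V := fun n => a *: f n.

Fact pser_scaleA a b f : scale a (scale b f) = scale (a * b) f.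
Proof. by apply/funext => n; apply: scalerA. Qed.
Fact pser_scale1 : left_id 1 scale.
Proof. by move=> f; apply/funext => n; apply: scale1r. Qed.
Fact pser_scaleDr : right_distributive scale +%R.
Proof. by move=> a f g; apply/funext => n; apply: scalerDr. Qed.
Fact pser_scaleDl f : {morph scale^~ f : a b / a + b}.
Proof. by move=> a b; apply/funext => n; apply: scalerDl. Qed.

HB.instance Definition _ := GRing.Zmodule_isLmodule.Build K (pser V)
  pser_scaleA pser_scale1 pser_scaleDr pser_scaleDl.

Lemma pserZE a f n : (a *: f) n = a *: f n. Proof. by []. Qed.

End PserModule.

Section PserZmodule.
Variable V : zmodType.
Implicit Types f g : pser V.

Lemma pserDE f g n : (f + g) n = f n + g n. Proof. by []. Qed.
Lemma pserNE f n : (- f) n = - f n. Proof. by []. Qed.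
Lemma pser0E n : (0 : pser V) n = 0. Proof. by []. Qed.
Lemma pserBE f g n : (f - g) n = f n - g n. Proof. by []. Qed.
Lemma pser_sumE I (r : seq I) (P : pred I) (F : I -> pser V) n :
  (\sum_(i <- r | P i) F i) n = \sum_(i <- r | P i) F i n.
Proof. by elim/big_rec2: _ => // i x y _ <-. Qed.

End PserZmodule.

Section PserAlg.
Variables (K : comNzRingType) (A : algType K).
Implicit Types (a : K) (f g : pser A).

Fact pser_scaleAl a f g : a *: (f * g) = a *: f * g.
Proof.
apply/funext => n; rewrite pserZE /GRing.mul /= /hconv scaler_sumr.
by apply: eq_bigr => i _; rewrite scalerAl.
Qed.
HB.instance Definition _ := GRing.Lmodule_isLalgebra.Build K (pser A) pser_scaleAl.

Fact pser_scaleAr a f g : a *: (f * g) = f * (a *: g).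
Proof.
apply/funext => n; rewrite pserZE /GRing.mul /= /hconv scaler_sumr.
by apply: eq_bigr => i _; rewrite scalerAr.
Qed.
HB.instance Definition _ := GRing.Lalgebra_isAlgebra.Build K (pser A) pser_scaleAr.

End PserAlg.

Section PserRingTheory.
Variable B : nzRingType.
Implicit Types (f g : pser B) (b : B).

Lemma pserME f g n : (f * g) n = \sum_(i < n.+1) f i * g (n - i)%N.
Proof. by []. Qed.

Lemma pser1E n : (1 : pser B) n = (n == 0%N)%:R.
Proof. by rewrite /GRing.one /= /hcst; case: eqP. Qed.

Lemma hcstE b n : hcst b n = if n == 0%N then b else 0. Proof. by []. Qed.

Lemma mul_hcstE b f n : (hcst b * f) n = b * f n.
Proof.
rewrite pserME big_ord_recl subn0 big1 ?addr0 // => i _.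
by rewrite hcstE mul0r.
Qed.

Lemma mulr_hcstE b f n : (f * hcst b) n = f n * b.
Proof.
rewrite pserME big_ord_recr /= subnn big1 ?add0r // => i _.
by rewrite hcstE subn_eq0 leqNgt ltn_ord mulr0.
Qed.

Lemma hcstM b b' : hcst (b * b') = hcst b * hcst b' :> pser B.
Proof.
by apply/funext => n; rewrite mul_hcstE !hcstE; case: eqP; rewrite ?mulr0.
Qed.

Lemma hcstD b b' : hcst (b + b') = hcst b + hcst b' :> pser B.
Proof.
by apply/funext => n; rewrite pserDE !hcstE; case: eqP; rewrite ?addr0.
Qed.

Lemma hcstN b : hcst (- b) = - hcst b :> pser B.
Proof.
by apply/funext => n; rewrite pserNE !hcstE; case: eqP; rewrite ?oppr0.
Qed.

Lemma hcst0 : hcst 0 = 0 :> pser B.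
Proof. by apply/funext => n; rewrite hcstE if_same. Qed.

Lemma hcstX b k : hcst (b ^+ k) = hcst b ^+ k :> pser B.
Proof. by elim: k => [|k IH] //; rewrite !exprS hcstM IH. Qed.

Lemma hcst_sum I (r : seq I) (P : pred I) (F : I -> B) :
  hcst (\sum_(i <- r | P i) F i) = \sum_(i <- r | P i) hcst (F i) :> pser B.
Proof. exact: (big_morph _ hcstD hcst0). Qed.

Lemma mul_hvarE f n : (hvar * f) n = if n is n'.+1 then f n' else 0.
Proof.
rewrite pserME; case: n => [|n]; first by rewrite big_ord1 /hvar mul0r.
rewrite 2!big_ord_recl /= /hvar mul0r add0r mul1r /bump /= !add1n subn1 /= big1.
  by rewrite addr0.
by move=> i _; rewrite mul0r.
Qed.

Lemma mulr_hvarE f n : (f * hvar) n = if n is n'.+1 then f n' else 0.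
Proof.
rewrite pserME; case: n => [|n]; first by rewrite big_ord1 /hvar mulr0.
rewrite 2!big_ord_recr /= subnn subSnn /hvar mulr0 addr0 mulr1 big1 ?add0r //.
move=> i _; rewrite ifN ?mulr0 //.
by rewrite subSn ?eqSS ?subn_eq0 -?ltnNge ?ltn_ord // ltnW // ltn_ord.
Qed.

Lemma hvar_comm f : GRing.comm hvar f.
Proof. by apply/funext => n; rewrite mul_hvarE mulr_hvarE. Qed.

Lemma comm_hcst b f : (forall n, GRing.comm b (f n)) <-> GRing.comm (hcst b) f.
Proof.
split=> [bf|/= bf n]; first by apply/funext => n; rewrite mul_hcstE mulr_hcstE bf.
by have := congr1 (fun g : pser B => g n) bf; rewrite mul_hcstE mulr_hcstE.
Qed.

End PserRingTheory.

Lemma hcstZ (K : nzRingType) (V : lmodType K) a (v : V) : hcst (a *: v) = a *: hcst v.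
Proof. by apply/funext => n; rewrite pserZE /hcst; case: eqP; rewrite ?scaler0. Qed.

(** Series in two variables: x m n is the coefficient of u^m h^n. *)
Notation bser A := (pser (pser A)).

Section Bser.
Variable A : nzRingType.
Implicit Types x y : bser A.

(** Congruence modulo terms of total order at least N in u and h. *)
Definition eqo N x y := forall m n, (m + n < N)%N -> x m n = y m n.

Lemma bserME x y m n :
  (x * y) m n = \sum_(i < m.+1) \sum_(j < n.+1) x i j * y (m - i)%N (n - j)%N.
Proof. by rewrite pserME pser_sumE. Qed.

Lemma eqoM N x x' y y' : eqo N x x' -> eqo N y y' -> eqo N (x * y) (x' * y').
Proof.
move=> xx' yy' m n mn; rewrite !bserME; apply: eq_bigr => i _; apply: eq_bigr => j _.
rewrite xx' ?yy' //.
  by apply: leq_ltn_trans mn; apply: leq_add; apply: leq_subr.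
by apply: leq_ltn_trans mn; apply: leq_add; rewrite -ltnS.
Qed.

Lemma eqoD N x x' y y' : eqo N x x' -> eqo N y y' -> eqo N (x + y) (x' + y').
Proof. by move=> xx' yy' m n mn; rewrite !pserDE xx' ?yy'. Qed.

Lemma eqoN N x x' : eqo N x x' -> eqo N (- x) (- x').
Proof. by move=> xx' m n mn; rewrite !pserNE xx'. Qed.

Lemma eqoP x y : (forall N, eqo N x y) -> x = y.
Proof.
by move=> xy; apply/funext => m; apply/funext => n; apply: (xy (m + n).+1).
Qed.

(** Each factor of a power of x contributes at least one to the order in u and h. *)
Lemma bserX_small x k m n : x 0%N 0%N = 0 -> (m + n < k)%N -> (x ^+ k) m n = 0.
Proof.
move=> x0; elim: k m n => [|k IH] m n //; rewrite ltnS => mn.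
rewrite exprS bserME big1 // => i _; rewrite big1 // => j _.
have [/eqP ij0|ij0] := boolP (i + j == 0 :> nat)%N.
  by move/eqP: ij0; rewrite addn_eq0 => /andP[/eqP-> /eqP->]; rewrite x0 mul0r.
rewrite IH ?mulr0 //; apply: leq_trans mn.
by have := ltn_ord i; have := ltn_ord j; lia.
Qed.

End Bser.

Section PartialSums.
Variables (K : numFieldType) (B : algType K).
Implicit Types (x y p : B) (c : nat -> K).

Definition bpart c p N : B := \sum_(k < N) c k *: p ^+ k.

Lemma bpart_exp p N (d : B -> B) : d 1 = 0 ->
  (forall x y, d (x + y) = d x + d y) -> (forall x y, d (x * y) = d x * y + x * d y) ->
  (forall a x, d (a *: x) = a *: d x) ->
  d p * p = p * d p ->
  d (bpart (fun k => (k`!%:R)^-1) p N.+1) = d p * bpart (fun k => (k`!%:R)^-1) p N.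
Proof.
move=> d1 dD dM dZ dp; have d0 : d 0 = 0 by apply: (addrI (d 0)); rewrite -dD !addr0.
have dX k : d (p ^+ k) = d p * (p ^+ k.-1) *+ k.
  elim: k => [|k IH]; first by rewrite expr0 mulr0n.
  rewrite exprSr dM IH /= mulrS addrC; congr (_ + _).
    case: k {IH} => [|k]; first by rewrite mulr0n mul0r.
    by rewrite mulrnAl -mulrA -exprSr.
  by symmetry; apply: commrX.
rewrite /bpart (big_morph d dD d0) big_ord_recl /= dZ expr0 d1 scaler0 add0r mulr_sumr.
apply: eq_bigr => i _; rewrite dZ dX /bump /= add1n -scalerAr -scaler_nat scalerA.
by rewrite factS natrM invfM mulrAC mulVf ?mul1r // pnatr_eq0.
Qed.

Lemma bpart_comm c p N x : GRing.comm x p -> GRing.comm x (bpart c p N).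
Proof.
by move=> xp; apply: commr_sum => k _; rewrite /GRing.comm -scalerAr -scalerAl commrX.
Qed.

End PartialSums.

Section BserSeries.
Variables (K : numFieldType) (A : algType K).
Implicit Types (x y p : bser A) (c : nat -> K).

(** The series c_0 + c_1 p + c_2 p^2 + ..., which converges when p 0 0 = 0. *)
Definition bsub c p : bser A :=
  fun m n => \sum_(k < (m + n).+1) c k *: (p ^+ k) m n.
Definition bexp p := bsub (fun k => (k`!%:R)^-1) p.
Definition binv x := bsub (fun=> 1) (1 - x).

Lemma bsub_part c p N : p 0%N 0%N = 0 -> eqo N (bsub c p) (bpart c p N).
Proof.
move=> p0 m n mn; rewrite /bpart !pser_sumE /bsub.
rewrite (big_ord_widen N (fun k => c k *: (p ^+ k) m n) mn) big_mkcond /=.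
apply: eq_bigr => k _; rewrite !pserZE ltnS; case: leqP => // mnk.
by rewrite bserX_small // scaler0.
Qed.

(** The exponential is congruent to its partial sums, on which d acts as on
    polynomials in p, and d preserves the congruences. This is used with d a
    commutator and with d = u d/du. *)
Lemma bexp_der p (d : bser A -> bser A) : p 0%N 0%N = 0 -> d 1 = 0 ->
  (forall x y, d (x + y) = d x + d y) -> (forall x y, d (x * y) = d x * y + x * d y) ->
  (forall a x, d (a *: x) = a *: d x) ->
  (forall N x y, eqo N x y -> eqo N (d x) (d y)) ->
  d p * p = p * d p -> d (bexp p) = d p * bexp p.
Proof.
move=> p0 d1 dD dM dZ dN dp; apply: eqoP => N m n mn.
have pE M : eqo M (bexp p) (bpart (fun k => (k`!%:R)^-1) p M) by exact: bsub_part.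
rewrite (dN _ _ _ (pE N.+1)) ?(leqW mn) // bpart_exp //.
by apply/esym; apply: eqoM mn => //; apply: pE.
Qed.

Lemma bsub_comm c p x : p 0%N 0%N = 0 -> GRing.comm x p -> GRing.comm x (bsub c p).
Proof.
move=> p0 xp; apply: eqoP => N m n mn.
have pE := bsub_part c (N := N) p0.
have xE : eqo N x x by [].
by rewrite (eqoM xE pE mn) bpart_comm // (eqoM pE xE mn).
Qed.

Lemma binv_comm x y : x 0%N 0%N = 1 -> GRing.comm y x -> GRing.comm y (binv x).
Proof.
move=> x0 yx; apply: bsub_comm; first by rewrite !pserBE x0 !pser1E subrr.
by apply: commrB => //; apply: commr1.
Qed.

Lemma mulbV x : x 0%N 0%N = 1 -> x * binv x = 1.
Proof.
move=> x0; apply: eqoP => N m n mn.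
have p0 : (1 - x) 0%N 0%N = 0 by rewrite !pserBE x0 !pser1E subrr.
have xE : eqo N x x by [].
rewrite (eqoM xE (bsub_part _ p0) mn) /bpart.
under eq_bigr do rewrite scale1r.
have -> : x * (\sum_(i < N) (1 - x) ^+ i) = 1 - (1 - x) ^+ N.
  by rewrite -[RHS]opprB subrX1 (addrC 1) addrK mulNr opprK.
by rewrite !pserBE bserX_small // subr0.
Qed.

Lemma mulVb x : x 0%N 0%N = 1 -> binv x * x = 1.
Proof. by move=> x0; rewrite -[LHS](binv_comm x0) ?mulbV //; apply: commr_refl. Qed.

End BserSeries.

(** * One-sided distributions *)

Section GeneralizedBinomials.
Variable K : numFieldType.

Lemma binz0 (r : int) : binz K r 0 = 1.
Proof. by rewrite /binz big_ord0 fact0 divr1. Qed.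

Lemma binzS (r : int) n : binz K (r + 1) n.+1 = binz K r n.+1 + binz K r n.
Proof.
have fn0 k : k`!%:R != 0 :> K by rewrite pnatr_eq0 -lt0n fact_gt0.
apply: (mulIf (fn0 n.+1)); rewrite mulrDl /binz !divfK //.
rewrite factS natrM (mulrC n.+1%:R) mulrA divfK // big_ord_recl big_ord_recr /=.
rewrite (eq_bigr (fun i : 'I_n => (r - i%:Z)%:~R : K)); last first.
  by move=> i _; rewrite /bump /= add1n; congr (_%:~R); lia.
rewrite subr0 mulrC -mulrDr; congr (_ * _).
have -> : n.+1%:R = (n.+1%:Z)%:~R :> K by [].
by rewrite -intrD; congr (_%:~R); lia.
Qed.

Lemma binz_nat (m n : nat) : binz K m%:Z n = 'C(m, n)%:R.
Proof.
elim: m n => [|m IH] [|n]; rewrite ?binz0 ?bin0 //.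
  by rewrite /binz big_ord_recl subrr mul0r mul0r bin0n.
by rewrite -[m.+1]addn1 PoszD binzS !IH addn1 binS natrD.
Qed.

End GeneralizedBinomials.

Section FiniteSupport.
Variable V : zmodType.

Lemma fsumT_seq (I : choiceType) (F : I -> V) (r : seq I) : uniq r ->
  (forall l, l \notin r -> F l = 0) -> \sum_(l \in [set: I]) F l = \sum_(l <- r) F l.
Proof.
move=> ur Fr; rewrite [RHS]fsbig_seq //; apply/esym; apply: fsbig_widen => // l /= [_ lr].
by apply: Fr; apply/negP.
Qed.

Lemma fsumT_nat (F : nat -> V) N : (forall k, (N <= k)%N -> F k = 0) ->
  \sum_(k \in [set: nat]) F k = \sum_(k < N) F k.
Proof.
move=> FN; rewrite (fsumT_seq (r := iota 0 N)) ?iota_uniq //.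
  by rewrite -[X in iota 0 X]subn0 big_mkord.
by move=> l; rewrite mem_iota /= add0n -leqNgt; apply: FN.
Qed.

(** The side of the exponents of a one-sided distribution: true stands for the
    powers of u^(-1), as the sign of a current does. *)
Definition sg (s : bool) (i : nat) : int := if s then - i%:Z else i%:Z.
Definition sided (s : bool) (m : int) : bool := if s then m <= 0 else 0 <= m.

Lemma sided_sg s i : sided s (sg s i).
Proof. by case: s => //=; rewrite oppr_le0. Qed.
Lemma absz_sg s i : `|sg s i|%N = i.
Proof. by case: s => //=; rewrite abszN. Qed.
Lemma sgK s m : sided s m -> sg s `|m|%N = m.
Proof. by case: s => /= m0; rewrite /sg; [rewrite lez0_abs|rewrite gez0_abs]; rewrite ?opprK. Qed.
Lemma sg_inj s : injective (sg s).
Proof. by move=> i j /(congr1 absz); rewrite !absz_sg. Qed.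

(** Exponents l and m - l on the same side leave only finitely many l. *)
Lemma fsumT_sided s (F : int -> V) m : (forall l, ~~ sided s l -> F l = 0) ->
    (forall l, ~~ sided s (m - l) -> F l = 0) ->
  \sum_(l \in [set: int]) F l =
  if sided s m then \sum_(i < `|m|.+1) F (sg s i) else 0.
Proof.
move=> F1 F2; pose r := [seq sg s i | i <- iota 0 `|m|.+1].
case: ifPn => sm; last first.
  rewrite fsbig1 // => l _; have [sl|/F1//] := boolP (sided s l).
  by apply: F2; apply: contra sm; case: s sl {F1 r} => /=; lia.
rewrite (fsumT_seq (r := r)); last 2 first.
- by rewrite map_inj_uniq ?iota_uniq //; apply: sg_inj.
- move=> l lr; have [sl|/F1//] := boolP (sided s l).
  apply: F2; apply: contra lr => sml; apply/mapP; exists `|l|%N.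
    rewrite mem_iota /= add0n ltnS; case: s {F1 r} sm sl sml => /=; lia.
  by rewrite sgK.
by rewrite /r big_map -(big_mkord predT (fun i => F (sg s i))) /index_iota subn0.
Qed.

End FiniteSupport.

Definition sdist (B : zmodType) s (x : pser (pser B)) : fdist int B :=
  fun m => if sided s m then x `|m|%N else 0.

Lemma sdist_sg (B : zmodType) s (x : pser (pser B)) i : sdist s x (sg s i) = x i.
Proof. by rewrite /sdist sided_sg absz_sg. Qed.

Lemma sdist_out (B : zmodType) s (x : pser (pser B)) m n :
  ~~ sided s m -> sdist s x m n = 0.
Proof. by rewrite /sdist => /negPf->. Qed.

(** On one-sided distributions the convolution over all exponents is the product of
    power series, and so algebra can be done in the ring of series. *)
Lemma dconv_sided (B D E : zmodType) (op : B -> D -> E) s (x : pser (pser B))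
    (y : pser (pser D)) m n : (forall d, op 0 d = 0) ->
    (forall i j, op (x i j) 0 = 0) ->
  dconv op (sdist s x) (sdist s y) m n = if sided s m then
    \sum_(j < n.+1) \sum_(i < `|m|.+1) op (x i j) (y (`|m| - i)%N (n - j)%N) else 0.
Proof.
move=> op0 opx; rewrite /dconv.
under eq_bigr => j _.
  rewrite (fsumT_sided (s := s) (m := m)); last 2 first.
  - by move=> l sl; rewrite sdist_out.
  - move=> l sl; rewrite (sdist_out _ _ sl) /sdist.
    by case: ifP => // _; apply: op0.
  over.
case: ifP => sm; last by rewrite big1.
apply: eq_bigr => j _; apply: eq_bigr => i _; rewrite sdist_sg.
have -> : m - sg s i = sg s (`|m| - i).
  by move: (sgK sm) (ltn_ord i); rewrite /sg; case: (s) => /=; lia.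
by rewrite sdist_sg.
Qed.

Section ShiftSided.
Variables (K : numFieldType) (B : lmodType K).

(** The substitution u -> u + a h on one-sided series; with s true the
    variable is u^(-1). *)
Definition bsh s (a : K) (x : pser (pser B)) : bser B := fun m n =>
  \sum_(j < n.+1) (binz K (sg s m + j%:Z) j * a ^+ j) *:
    (if s then if (j <= m)%N then x (m - j)%N (n - j)%N else 0
     else x (m + j)%N (n - j)%N).

(** Expanding in nonnegative powers of h preserves sidedness: a power of u lowers to
    a negative one only through a binomial coefficient that vanishes. *)
Lemma dshift_sided s a (x : pser (pser B)) :
  dshiftK a (sdist s x) = sdist s (bsh s a x).
Proof.
apply/funext => m; apply/funext => n; rewrite /dshiftK /dshift.
have [sm|sm] := boolP (sided s m).
  rewrite -(sgK sm) sdist_sg /bsh; apply: eq_bigr => j _; rewrite scalerA.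
  congr (_ *: _); case: (s) => /=; last by rewrite -(sdist_sg false).
  case: leqP => jm.
    by rewrite -(sdist_sg true); congr (sdist _ _ _ _); rewrite /sg; lia.
  by rewrite sdist_out //= -ltNge; move: jm; lia.
rewrite (sdist_out _ _ sm) big1 // => j _; case: s sm => /= sm.
  by rewrite sdist_out ?scaler0 //=; lia.
have [mj|mj] := boolP (sided false (m + j%:Z)); last by rewrite sdist_out ?scaler0.
have -> : m + j%:Z = (`|(m + j%:Z)%R|%N)%:Z by rewrite gez0_abs.
rewrite binz_nat bin_small ?scale0r //; move: mj => /=; lia.
Qed.

End ShiftSided.

Section FockEndomorphisms.
Variable K : numFieldType.

Lemma fock0_neq0 : exists v : fock0 K, v != 0.
Proof. by exists << (onecm _, 0) >>; rewrite monalgU_eq0 oner_neq0. Qed.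

End FockEndomorphisms.

Notation fend K := (endo (fock0_neq0 K)).

Section OperatorDistributions.
Variable K : numFieldType.
Notation E := (fend K).
Implicit Types (t : fdist int E) (x y p : bser E) (s : bool).

(** Distributions of operators are used through linear operators, which form a ring.
    *)
Definition oval t : odist K := fun m n => endo_fun (t m n).

Lemma oval_sdist s x : oval (sdist s x) = sdist s (fun i j => endo_fun (x i j)).
Proof. by apply/funext => m; apply/funext => n; rewrite /oval /sdist; case: ifP. Qed.

Lemma ovalD t t' : oval (t + t') = oval t + oval t'. Proof. by []. Qed.
Lemma ovalN t : oval (- t) = - oval t. Proof. by []. Qed.

Lemma sdistD s x y : sdist s (x + y) = sdist s x + sdist s y :> fdist int E.
Proof.
apply/funext => m; apply/funext => n; rewrite -[RHS]/(sdist s x m n + sdist s y m n).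
by rewrite /sdist; case: ifP => // _; rewrite addr0.
Qed.

Lemma sdistN s x : sdist s (- x) = - sdist s x :> fdist int E.
Proof.
apply/funext => m; apply/funext => n; rewrite -[RHS]/(- sdist s x m n).
by rewrite /sdist; case: ifP => // _; rewrite oppr0.
Qed.

Lemma fct_sumE (T : Type) (V : zmodType) I (r : seq I) (P : pred I) (F : I -> T -> V) v :
  (\sum_(i <- r | P i) F i) v = \sum_(i <- r | P i) F i v.
Proof. by elim/big_rec2: _ => // i x y _ <-. Qed.

Lemma oval_shift a t : osh a (oval t) = oval (dshiftK a t).
Proof.
apply/funext => m; apply/funext => n; apply/funext => v.
rewrite /osh /dshiftK /dshift fct_sumE /oval endo_sumE.
by apply: eq_bigr => j _; rewrite endoZE.
Qed.

Lemma omul_sided s x y :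
  omul (oval (sdist s x)) (oval (sdist s y)) = oval (sdist s (x * y)).
Proof.
apply/funext => m; apply/funext => n; apply/funext => v; rewrite /omul oval_sdist.
have -> : (fun m' n' => oval (sdist s y) m' n' v) = sdist s (fun i j => y i j v).
  by apply/funext => m'; apply/funext => n'; rewrite oval_sdist /sdist; case: ifP.
rewrite dconv_sided // => [|i j]; last exact: linear0.
rewrite /oval /sdist; case: ifP => // _; rewrite bserME exchange_big endo_sumE.
by apply: eq_bigr => i _; rewrite endo_sumE.
Qed.

Lemma o1_sided s : @o1 K = oval (sdist s (1 : bser E)).
Proof.
apply/funext => m; apply/funext => n; apply/funext => v.
rewrite /o1 /dcst /oval /sdist.
have -> i : (1 : bser E) i = (i == 0%N)%:R by apply: pser1E.
have [->|m0] := eqVneq m 0; last by rewrite absz_eq0 (negPf m0); case: ifP.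
by rewrite /sided lexx if_same eqxx mulr1n pser1E /hcst; case: eqP.
Qed.

Lemma opow_sided s x k : opow (oval (sdist s x)) k = oval (sdist s (x ^+ k)).
Proof.
elim: k => [|k IH]; first by rewrite expr0 -o1_sided.
by rewrite /opow iterS -/(opow _ _) IH omul_sided exprS.
Qed.

Lemma bsub_endoE p c m n v :
  (bsub c p m n : E) v = \sum_(k < (m + n).+1) c k *: ((p ^+ k) m n : E) v.
Proof.
exact: (endo_sumE _ _ (fun k : 'I_(m + n).+1 => c k *: ((p ^+ k) m n : E))).
Qed.

Lemma fsumT_bsub s p c m n v : p 0%N 0%N = 0 ->
  \sum_(k \in [set: nat]) c k *: (oval (sdist s (p ^+ k)) m n v)
  = oval (sdist s (bsub c p)) m n v.
Proof.
move=> p0; rewrite (fsumT_nat (N := (`|m| + n).+1)) => [|k mnk].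
  rewrite /oval /sdist; case: ifP => _; first by rewrite [RHS]bsub_endoE.
  by rewrite big1 // => k _; rewrite scaler0.
by rewrite /oval /sdist; case: ifP => _; rewrite ?bserX_small ?scaler0.
Qed.

(** The infinite sum is finite at each coefficient because the powers of p have
    growing order. *)
Lemma oexp_sided s p : p 0%N 0%N = 0 ->
  oexp (oval (sdist s p)) = oval (sdist s (bexp p)).
Proof.
move=> p0; apply/funext => m; apply/funext => n; apply/funext => v.
rewrite -[RHS](fsumT_bsub s (fun k => (k`!%:R)^-1) m n v p0).
by apply: eq_fsbigr => k _; rewrite opow_sided.
Qed.

Lemma oinv_sided s x : x 0%N 0%N = 1 ->
  oinv (oval (sdist s x)) = oval (sdist s (binv x)).
Proof.
move=> x0; apply/funext => m; apply/funext => n; apply/funext => v.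
have p0 : (1 - x) 0%N 0%N = 0 by rewrite !pserBE x0 !pser1E subrr.
rewrite -[RHS](fsumT_bsub s (fun=> 1) m n v p0) /oinv (o1_sided s) -ovalN -sdistN -ovalD -sdistD.
by apply: eq_fsbigr => k _; rewrite opow_sided scale1r.
Qed.

Lemma oev0_sided s x : oev0 (oval (sdist s x)) = oval (sdist s (hcst (x 0%N))).
Proof.
apply/funext => m; apply/funext => n; apply/funext => v.
rewrite /oev0 /oval /sdist /hcst.
have [->|m0] := eqVneq m 0; first by rewrite /sided lexx if_same.
by rewrite absz_eq0 (negPf m0); case: ifP.
Qed.

Lemma osh_sided s a x : osh a (oval (sdist s x)) = oval (sdist s (bsh s a x)).
Proof. by rewrite oval_shift dshift_sided. Qed.

End OperatorDistributions.

(** * The substitution u -> u + a h *)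

Section ModH.
Variable B : nzRingType.
Implicit Types f g : pser B.

Definition eqh N f g := forall n, (n < N)%N -> f n = g n.

Lemma eqhM N f f' g g' : eqh N f f' -> eqh N g g' -> eqh N (f * g) (f' * g').
Proof.
move=> ff gg n nN; rewrite !pserME; apply: eq_bigr => i _.
by rewrite ff ?gg //; have := ltn_ord i; lia.
Qed.

Lemma eqh_trans N f g k : eqh N f g -> eqh N g k -> eqh N f k.
Proof. by move=> fg gk n nN; rewrite fg ?gk. Qed.

Lemma eqh_sym N f g : eqh N f g -> eqh N g f.
Proof. by move=> fg n nN; rewrite fg. Qed.

Lemma eqhP f g : (forall N, eqh N f g) -> f = g.
Proof. by move=> fg; apply/funext => n; apply: (fg n.+1). Qed.

Lemma mul_hvarXE j f n : (hvar ^+ j * f) n = if (j <= n)%N then f (n - j)%N else 0.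
Proof.
elim: j n => [|j IH] n; first by rewrite expr0 mul1r subn0.
by rewrite exprS -mulrA mul_hvarE; case: n => [|n] //; rewrite IH subSS.
Qed.

Lemma hvarX_comm j f : GRing.comm (hvar ^+ j) f.
Proof. by apply/commr_sym/commrX/commr_sym/hvar_comm. Qed.

End ModH.

Section Shift.
Variables (K : numFieldType) (A : algType K).
Implicit Types (x y : bser A) (c : pser A) (a : K) (s : bool).

Definition bsh_arg s x (m j : nat) : pser A :=
  if s then if (j <= m)%N then x (m - j)%N else 0 else x (m + j)%N.

(** Modulo h^N the substitution is a finite sum of multiples of h^j; this reduces
    its compatibilities to those of scaling and multiplication by h. *)
Lemma bsh_mod s a x m N :
  eqh N (bsh s a x m)
    (\sum_(j < N) (binz K (sg s m + j%:Z) j * a ^+ j) *: (hvar ^+ j * bsh_arg s x m j)).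
Proof.
move=> n nN; rewrite pser_sumE /bsh.
rewrite (big_ord_widen N (fun j => (binz K (sg s m + j%:Z) j * a ^+ j) *:
    (if s then if (j <= m)%N then x (m - j)%N (n - j)%N else 0
     else x (m + j)%N (n - j)%N)) nN) big_mkcond /=.
apply: eq_bigr => j _; rewrite pserZE mul_hvarXE ltnS /bsh_arg.
by case: leqP => _; rewrite ?scaler0 //; case: s => //; case: leqP.
Qed.

Lemma bsh_mull s a c x : bsh s a (hcst c * x) = hcst c * bsh s a x.
Proof.
apply/funext => m; apply: eqhP => N; apply: eqh_trans (bsh_mod _ _ _ _ (N := N)) _.
rewrite mul_hcstE; apply: eqh_sym; apply: eqh_trans (eqhM _ (bsh_mod s a x m (N := N))) _.
  by [].
rewrite mulr_sumr => n _; congr (_ n); apply: eq_bigr => j _.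
have -> : bsh_arg s (hcst c * x) m j = c * bsh_arg s x m j.
  by rewrite /bsh_arg !mul_hcstE; case: s => //; case: leqP; rewrite ?mulr0.
by rewrite -scalerAr (mulrA c) -(hvarX_comm j c) -(mulrA _ c).
Qed.

Lemma bsh_mulr s a c x : bsh s a (x * hcst c) = bsh s a x * hcst c.
Proof.
apply/funext => m; apply: eqhP => N; apply: eqh_trans (bsh_mod _ _ _ _ (N := N)) _.
rewrite mulr_hcstE; apply: eqh_sym; apply: eqh_trans (eqhM (bsh_mod s a x m (N := N)) _) _.
  by [].
rewrite mulr_suml => n _; congr (_ n); apply: eq_bigr => j _.
have -> : bsh_arg s (x * hcst c) m j = bsh_arg s x m j * c.
  by rewrite /bsh_arg !mulr_hcstE; case: s => //; case: leqP; rewrite ?mul0r.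
by rewrite -scalerAl -(mulrA (hvar ^+ j)).
Qed.

Lemma bshD s a x y : bsh s a (x + y) = bsh s a x + bsh s a y.
Proof.
apply/funext => m; apply/funext => n; rewrite !pserDE /bsh -big_split /=.
apply: eq_bigr => j _; rewrite -scalerDr; congr (_ *: _).
by case: s => //; case: (_ <= m)%N; rewrite ?addr0.
Qed.

Lemma bshZ s a b x : bsh s a (b *: x) = b *: bsh s a x.
Proof.
apply/funext => m; apply/funext => n; rewrite !pserZE /bsh scaler_sumr.
apply: eq_bigr => j _; set k := (X in X *: _); rewrite [RHS]scalerA (mulrC b) -(scalerA k); congr (_ *: _).
by rewrite {}/k; case: s => //; case: (_ <= m)%N; rewrite ?scaler0.
Qed.

Lemma bshN s a x : bsh s a (- x) = - bsh s a x.
Proof. by rewrite -scaleN1r bshZ scaleN1r. Qed.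

Lemma bshB s a x y : bsh s a (x - y) = bsh s a x - bsh s a y.
Proof. by rewrite bshD bshN. Qed.

Lemma bsh_comm s a c x : GRing.comm (hcst c) x -> GRing.comm (hcst c) (bsh s a x).
Proof. by move=> cx; rewrite /GRing.comm -bsh_mull -bsh_mulr cx. Qed.

Lemma bsh00 s a x : bsh s a x 0%N 0%N = x 0%N 0%N.
Proof.
rewrite /bsh big_ord1 expr0 binz0 mulr1 scale1r.
by case: s.
Qed.

(** The variables u and h of the ring of series. *)
Definition bu (A : nzRingType) : bser A := hvar.
Definition bh (A : nzRingType) : bser A := hcst hvar.

Lemma bu_comm x : GRing.comm (bu A) x. Proof. exact: hvar_comm. Qed.
Lemma bh_comm x : GRing.comm (bh A) x.
Proof. by apply/comm_hcst => n; apply: hvar_comm. Qed.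

Lemma mul_buE x m : (bu A * x) m = if m is m'.+1 then x m' else 0.
Proof. exact: mul_hvarE. Qed.

Lemma mul_bhE x m n : (bh A * x) m n = if n is n'.+1 then x m n' else 0.
Proof. by rewrite mul_hcstE mul_hvarE. Qed.

Lemma bsh_plusE a x m n : bsh false a x m n =
  \sum_(j < n.+1) ('C(m + j, j)%:R * a ^+ j) *: x (m + j)%N (n - j)%N.
Proof. by apply: eq_bigr => j _; rewrite -binz_nat. Qed.

Lemma bsh_mulu a x : bsh false a (bu A * x) = (bu A + a *: bh A) * bsh false a x.
Proof.
apply/funext => m; apply/funext => n.
rewrite mulrDl -scalerAl !pserDE !pserZE mul_buE mul_bhE bsh_plusE.
rewrite big_ord_recl addn0 mul_buE expr0 mulr1 bin0 scale1r subn0.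
case: m => [|m].
  rewrite !pser0E !add0r; case: n => [|n]; first by rewrite big_ord0 scaler0.
  rewrite bsh_plusE scaler_sumr; apply: eq_bigr => j _.
  rewrite lift0 !add0n mul_buE.
  by rewrite !binn !mul1r scalerA -exprS subSS.
rewrite !bsh_plusE [X in _ = X + _]big_ord_recl expr0 bin0 mulr1 scale1r addn0 subn0.
rewrite -addrA; congr (_ + _).
under eq_bigr => j _.
  rewrite lift0 addnS mul_buE addSn -addnS binS natrD mulrDl scalerDl.
  over.
rewrite big_split /=; congr (_ + _).
case: n => [|n]; first by rewrite big_ord0 scaler0.
rewrite bsh_plusE scaler_sumr; apply: eq_bigr => j _.
by rewrite scalerA exprS mulrCA subSS addSnnS.
Qed.

Lemma bsh1 a : bsh false a (1 : bser A) = 1.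
Proof.
apply/funext => m; apply/funext => n; rewrite bsh_plusE big_ord_recl expr0 mulr1 bin0 scale1r.
rewrite addn0 subn0 big1 ?addr0 // => j _.
by rewrite lift0 addnS pser1E scaler0.
Qed.

(** The substitution u -> u + a h is multiplicative on polynomials in u and h. *)
Lemma bsh_mulX a b r x :
  bsh false a ((bu A + b *: bh A) ^+ r * x) = (bu A + (a + b) *: bh A) ^+ r * bsh false a x.
Proof.
elim: r x => [|r IH] x; first by rewrite !expr0 !mul1r.
rewrite !exprSr -!mulrA IH mulrDl bshD bsh_mulu -scalerAl bshZ bsh_mull.
by rewrite scalerAl -mulrDl -addrA -scalerDl.
Qed.

Lemma bshX a r : bsh false a (bu A ^+ r) = (bu A + a *: bh A) ^+ r.
Proof.
have := bsh_mulX a 0 r (1 : bser A); rewrite scale0r !addr0 bsh1 !mulr1.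
by [].
Qed.

End Shift.

(** * Heisenberg operators on the Fock space *)

Section CommutativeMonomials.
Variable I : choiceType.
Implicit Types m u w : cmonom I.

Lemma mulcmAC m u w : mulcm (mulcm m u) w = mulcm (mulcm m w) u.
Proof. by apply/eqP/cmP => x; rewrite !mulcmE addnAC. Qed.

Lemma divcmAC m u w : divcm (divcm m u) w = divcm (divcm m w) u.
Proof. by apply/eqP/cmP => x; rewrite !divcmE subnAC. Qed.

Lemma mulcmK m u : divcm (mulcm m u) u = m.
Proof. by apply/eqP/cmP => x; rewrite divcmE mulcmE addnK. Qed.

Lemma divcmK m u : (forall x, u x <= m x)%N -> mulcm (divcm m u) u = m.
Proof. by move=> um; apply/eqP/cmP => x; rewrite mulcmE divcmE subnK. Qed.

Lemma divcm_mulcm m u w : (forall x, w x <= m x)%N ->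
  divcm (mulcm m u) w = mulcm (divcm m w) u.
Proof. by move=> um; apply/eqP/cmP => x; rewrite mulcmE !divcmE mulcmE addnBAC. Qed.

Lemma ucm_le m i : m i != 0%N -> (forall x, ucm i x <= m x)%N.
Proof. by move=> mi x; rewrite ucmE; case: eqP => // <-; rewrite lt0n. Qed.

Lemma ucm_falling m i j :
  (m i * divcm m (ucm i) j = m j * divcm m (ucm j) i)%N.
Proof.
rewrite !divcmE !ucmE; have [->|ij] := eqVneq i j; first by [].
by rewrite !subn0 mulnC.
Qed.

Lemma mulcm_ucm m i j : mulcm m (ucm i) j = (m j + (i == j))%N.
Proof. by rewrite mulcmE ucmE. Qed.

End CommutativeMonomials.

Section LinearExtension.
Variable K : numFieldType.
Notation F := (fock0 K).
Implicit Types (v w : F) (b : fbasis).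

Lemma fock0E v : v = \sum_(b <- msupp v) v@_b *: << b >>.
Proof.
rewrite {1}[v]monalgE; apply: eq_bigr => b _; apply/malgP => k.
by rewrite [RHS]mcoeffZ [LHS]mcoeffU [in RHS]mcoeffU mulr_natr.
Qed.

Lemma lextEw (f : fbasis -> F) v (d : {fset fbasis}) :
  (msupp v `<=` d)%fset -> lext f v = \sum_(b <- d) v@_b *: f b.
Proof.
move=> vd; rewrite /lext (big_fset_incl _ vd) // => b _ bv.
by rewrite (mcoeff_outdom bv) scale0r.
Qed.

Lemma lext_lin (f : fbasis -> F) : linear (lext f).
Proof.
move=> a v w; pose d := (msupp v `|` msupp w)%fset.
rewrite (lextEw f (d := d)); last first.
  apply: fsubset_trans (msuppD_le _ _) _; apply: fsetSU; exact: msuppZ_le.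
rewrite (lextEw f (fsubsetUl _ _ : msupp v `<=` d)%fset).
rewrite (lextEw f (fsubsetUr _ _ : msupp w `<=` d)%fset).
rewrite scaler_sumr -big_split /=; apply: eq_bigr => b _.
by rewrite mcoeffD mcoeffZ scalerDl scalerA.
Qed.

Lemma lextU (f : fbasis -> F) b : lext f << b >> = f b.
Proof.
by rewrite (lextEw f (d := [fset b]%fset)) ?msuppU_le // big_seq_fset1 mcoeffUU scale1r.
Qed.

Definition lexte (f : fbasis -> F) : fend K := mkendo (fock0_neq0 K) (lext_lin f).

End LinearExtension.

(** Sealed basis vectors and operators, which unification does not unfold. *)
HB.lock Definition bas (K : numFieldType) (b : fbasis) : fock0 K := << b >>.

Section BasisVectors.
Variable K : numFieldType.
Notation F := (fock0 K).
Implicit Types (v : F) (b : fbasis).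

Lemma basE b : << b >> = bas K b. Proof. by rewrite bas.unlock. Qed.

Lemma lexteU (f : fbasis -> F) b : lexte f (bas K b) = f b.
Proof. by rewrite -basE; exact: lextU. Qed.

Lemma fend_basis (e e' : fend K) : (forall b, e (bas K b) = e' (bas K b)) -> e = e'.
Proof.
move=> ee'; apply: endoP => v; rewrite (fock0E v) !endo_sumr.
by apply: eq_bigr => b _; rewrite !endoZr basE ee'.
Qed.

End BasisVectors.

(** Creation a_j(-n-1), annihilation a_j(n+1), the shift e^(k alpha), and the
    operators diagonal in the charge. *)
HB.lock Definition cre (K : numFieldType) (j : 'I_2) (n : nat) : fend K :=
  lexte (fun b => << (mulcm b.1 (ucm (j, n)), b.2) >>).
HB.lock Definition ann (K : numFieldType) (j : 'I_2) (n : nat) : fend K :=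
  lexte (fun b => (n.+1 * b.1 (j, n))%N%:R *: << (divcm b.1 (ucm (j, n)), b.2) >>).
HB.lock Definition chg (K : numFieldType) (k : int) : fend K :=
  lexte (fun b => << (b.1, b.2 + k) >>).
HB.lock Definition dg (K : numFieldType) (f : int -> K) : fend K :=
  lexte (fun b => f b.2 *: << b >>).

Section Heisenberg.
Variable K : numFieldType.
Implicit Types (i j : 'I_2) (n m : nat) (k : int).
Notation cre := (cre K).
Notation ann := (ann K).
Notation chg := (chg K).

Lemma creU j n b : cre j n (bas K b) = bas K (mulcm b.1 (ucm (j, n)), b.2).
Proof. by rewrite cre.unlock lexteU basE. Qed.
Lemma annU j n b : ann j n (bas K b) =
  (n.+1 * b.1 (j, n))%N%:R *: bas K (divcm b.1 (ucm (j, n)), b.2).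
Proof. by rewrite ann.unlock lexteU basE. Qed.
Lemma chgU k b : chg k (bas K b) = bas K (b.1, b.2 + k).
Proof. by rewrite chg.unlock lexteU basE. Qed.
Lemma dgU f b : dg f (bas K b) = f b.2 *: bas K b.
Proof. by rewrite dg.unlock lexteU basE. Qed.

Lemma aop_cre j n : aop j (Negz n) = cre j n. Proof. by rewrite cre.unlock. Qed.
Lemma aop_ann j n : aop j n.+1 = ann j n. Proof. by rewrite ann.unlock. Qed.
Lemma eop_chg k : eop k = chg k. Proof. by rewrite chg.unlock. Qed.

Lemma creC i m j n : GRing.comm (cre i m) (cre j n).
Proof. by apply: fend_basis => b; rewrite !endoME !creU mulcmAC. Qed.

Lemma annC i m j n : GRing.comm (ann i m) (ann j n).
Proof.
apply: fend_basis => b; rewrite !endoME !annU !endoZr !annU !scalerA divcmAC.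
by rewrite -!natrM mulnACA (mulnACA m.+1) ucm_falling (mulnC m.+1).
Qed.

(** The operators a_j(n+1) and a_j(-n-1) satisfy the Heisenberg relations; with
    a_j(n+1) acting as a derivation only the multiplicity of the variable (j, n)
    matters. *)
Lemma ann_cre i m j n :
  ann i m * cre j n - cre j n * ann i m = (((i, m) == (j, n)) * m.+1)%N%:R%:A.
Proof.
apply: fend_basis => b; rewrite endoDE endoNE endoZE !endoME creU !annU endoZr creU endo1E.
rewrite [(_, _).1]/= [(_, _).2]/= mulcm_ucm eq_sym.
have [e|ne] := eqVneq (i, m) (j, n); last first.
  rewrite mul0n scale0r addn0; apply/eqP; rewrite subr_eq0; apply/eqP.
  have [b0|b0] := eqVneq (b.1 (i, m)) 0%N; first by rewrite b0 muln0 !scale0r.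
  by rewrite divcm_mulcm //; apply: ucm_le.
case: e => <- <-; rewrite mul1n addn1 mulcmK.
have [b0|b0] := eqVneq (b.1 (i, m)) 0%N.
  by rewrite b0 muln0 scale0r subr0 muln1 -surjective_pairing.
rewrite divcmK; last exact: ucm_le.
by rewrite -surjective_pairing -scalerBl mulnS natrD addrK.
Qed.

Lemma cre_chg j n k : GRing.comm (cre j n) (chg k).
Proof. by apply: fend_basis => b; rewrite !endoME creU chgU creU chgU. Qed.

Lemma ann_chg j n k : GRing.comm (ann j n) (chg k).
Proof. by apply: fend_basis => b; rewrite !endoME chgU !annU endoZr chgU. Qed.

Lemma ann_dg j n f : GRing.comm (ann j n) (dg f).
Proof.
by apply: fend_basis => b; rewrite !endoME dgU !annU !endoZr annU dgU !scalerA mulrC.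
Qed.

(** The highest weight vectors 1 (x) e^(k alpha). *)
Definition hwv k : fock0 K := bas K (onecm _, k).

Lemma ann_hwv j n k : ann j n (hwv k) = 0.
Proof. by rewrite annU onecmE muln0 scale0r. Qed.

Lemma chg_hwv k l : chg k (hwv l) = hwv (l + k).
Proof. by rewrite chgU. Qed.

Lemma dg_hwv f k : dg f (hwv k) = f k *: hwv k.
Proof. by rewrite dgU. Qed.

(** A monomial different from 1 is divisible by some variable, so that degree
    induction applies. *)
Lemma fock0_ind (P : fock0 K -> Prop) : (forall k, P (hwv k)) ->
  (forall a v w, P v -> P w -> P (a *: v + w)) ->
  (forall j n v, P v -> P (cre j n v)) -> forall v, P v.
Proof.
move=> Ph Pl Pc v.
have P0 : P 0 by rewrite -[0](addNr (hwv 0)) -scaleN1r; apply: Pl.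
have Pb b : P (bas K b).
  case: b => b k; have [d] := ubnP (mdeg b); elim: d => // d IH in b *.
  rewrite ltnS => bd; have [->|b1] := eqVneq b (onecm _); first exact: Ph.
  have [x bx] : exists x, b x != 0%N.
    apply: contra_neqP b1 => /forallNP b0; apply/eqP/cmP => x.
    by rewrite onecmE; apply/eqP/negPn/negP; apply: b0.
  case: x bx => j n /ucm_le/divcmK eb.
  rewrite -eb; have := Pc j n (bas K (divcm b (ucm (j, n)), k)).
  rewrite creU; apply; apply: IH; move: bd.
  by rewrite -{1}eb mdegM mdegU addn1.
rewrite (fock0E v); elim: (enum_fset _) => [|b r IH]; first by rewrite big_nil.
by rewrite big_cons basE; apply: Pl.
Qed.

End Heisenberg.

(** * Commutators with the deformed annihilation operators *)

Section Commutators.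
Variables (K : numFieldType) (B : algType K).
Implicit Types (c x y f : B).

Definition ad c x : B := c * x - x * c.

Lemma ad1 c : ad c 1 = 0. Proof. by rewrite /ad mulr1 mul1r subrr. Qed.
Lemma adD c x y : ad c (x + y) = ad c x + ad c y.
Proof. by rewrite /ad mulrDr mulrDl opprD addrACA. Qed.
Lemma adN c x : ad c (- x) = - ad c x.
Proof. by rewrite /ad mulrN mulNr -opprD. Qed.
Lemma adM c x y : ad c (x * y) = ad c x * y + x * ad c y.
Proof. by rewrite /ad mulrBl mulrBr !mulrA addrA subrK. Qed.
Lemma adZ c a x : ad c (a *: x) = a *: ad c x.
Proof. by rewrite /ad -scalerAr -scalerAl scalerBr. Qed.
Lemma ad_comm c x : GRing.comm c x -> ad c x = 0.
Proof. by move=> cx; rewrite /ad cx subrr. Qed.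
Lemma comm_ad c x : ad c x = 0 -> GRing.comm c x.
Proof. by move/eqP; rewrite subr_eq0 => /eqP. Qed.

Definition central f := forall x, GRing.comm f x.

Lemma centralD f g : central f -> central g -> central (f + g).
Proof. by move=> cf cg x; apply/commr_sym/commrD; apply/commr_sym. Qed.
Lemma centralN f : central f -> central (- f).
Proof. by move=> cf x; apply/commr_sym/commrN/commr_sym. Qed.
Lemma centralZ a f : central f -> central (a *: f).
Proof. by move=> cf x; rewrite /GRing.comm -scalerAl -scalerAr cf. Qed.
Lemma centralX f n : central f -> central (f ^+ n).
Proof. by move=> cf x; apply/commr_sym/commrX/commr_sym. Qed.

(** Apply the derivation [c, -] to e e^-1 = 1. *)
Lemma ad_inv c e e' f : e * e' = 1 -> e' * e = 1 -> central f ->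
  ad c e = f * e -> ad c e' = - (f * e').
Proof.
move=> ee' e'e cf ce; apply/eqP; rewrite -addr_eq0; apply/eqP.
rewrite -[ad c e' + _]mul1r -e'e -mulrA mulrDr.
have -> : e * (f * e') = ad c e * e' by rewrite mulrA -cf ce.
by rewrite addrC -adM ee' ad1 mulr0.
Qed.

Lemma ad_addl c d x : ad (c + d) x = ad c x + ad d x.
Proof. by rewrite /ad mulrDl mulrDr opprD addrACA. Qed.
Lemma ad_oppl c x : ad (- c) x = - ad c x.
Proof. by rewrite /ad mulNr mulrN -opprD. Qed.
Lemma ad_scalel c a x : ad (a *: c) x = a *: ad c x.
Proof. by rewrite /ad -scalerAr -scalerAl scalerBr. Qed.
Lemma ad_suml I (r : seq I) (P : pred I) (F : I -> B) x :
  ad (\sum_(i <- r | P i) F i) x = \sum_(i <- r | P i) ad (F i) x.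
Proof.
rewrite (big_morph (fun c => ad c x) (fun c d => ad_addl c d x) (id1 := 0)) //.
by rewrite /ad mulr0 mul0r subrr.
Qed.
Lemma ad_mull f c x : central f -> ad (f * c) x = f * ad c x.
Proof. by move=> cf; rewrite /ad mulrBr !mulrA -(cf x). Qed.

End Commutators.

Section BserDerivations.
Variables (K : numFieldType) (A : algType K).
Implicit Types (x y p f : bser A) (e : A).

Lemma eqo_ad N (d : bser A) x y : eqo N x y -> eqo N (ad d x) (ad d y).
Proof.
move=> xy; have dd : eqo N d d by [].
by apply: eqoD; [apply: eqoM|apply: eqoN; apply: eqoM].
Qed.

(** The exponent has a central commutator, hence commutes with it. *)
Lemma ad_bexp (d : bser A) p f : p 0%N 0%N = 0 -> central f -> ad d p = f ->
  ad d (bexp p) = f * bexp p.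
Proof.
move=> p0 cf dp; rewrite -dp; apply: bexp_der => //.
- exact: ad1.
- exact: adD.
- exact: adM.
- by move=> a x; apply: adZ.
- by move=> N x y; apply: eqo_ad.
- by rewrite dp cf.
Qed.

(** The Euler operator u d/du. *)
Definition euler x : bser A := fun m => m%:R *: x m.

Lemma eulerM x y : euler (x * y) = euler x * y + x * euler y.
Proof.
apply/funext => m; rewrite /euler pserDE !pserME scaler_sumr -big_split /=.
apply: eq_bigr => i _; rewrite -scalerAl -scalerAr -scalerDl -natrD subnKC //.
by rewrite -ltnS.
Qed.

Lemma euler_bexp p : p 0%N 0%N = 0 -> GRing.comm (euler p) p ->
  euler (bexp p) = euler p * bexp p.
Proof.
move=> p0 cp; apply: bexp_der => //.
- by apply/funext => m; rewrite /euler pser1E; case: m => [|m]; rewrite ?scale0r ?scaler0.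
- by move=> x y; apply/funext => m; rewrite /euler !pserDE scalerDr.
- exact: eulerM.
- by move=> a x; apply/funext => m; rewrite /euler !pserZE !scalerA mulrC.
- by move=> N x y xy m n mn; rewrite /euler !pserZE xy.
Qed.

Lemma bser_comm x y :
  (forall m n m' n', GRing.comm (x m n) (y m' n')) -> GRing.comm x y.
Proof.
move=> xy; apply/funext => m; apply/funext => n; rewrite !bserME.
rewrite (reindex_inj rev_ord_inj) /=; apply: eq_bigr => i _.
rewrite (reindex_inj rev_ord_inj) /=; apply: eq_bigr => j _.
rewrite !subSS !subKn; try by rewrite -ltnS.
exact: xy.
Qed.

Lemma hcst_hcst_comm e x : (forall m n, GRing.comm e (x m n)) <-> GRing.comm (hcst (hcst e)) x.
Proof.
rewrite -comm_hcst; split=> ex m; first by apply/comm_hcst => n; apply: ex.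
by move=> n; have /comm_hcst := ex m; apply.
Qed.

Lemma bexp00 p : bexp p 0%N 0%N = 1.
Proof. by rewrite /bexp /bsub big_ord1 expr0 fact0 invr1 scale1r !pser1E. Qed.

Lemma bsh_plus0 s a x m : bsh s a x m 0%N = x m 0%N.
Proof.
rewrite /bsh big_ord1 expr0 binz0 mulr1 scale1r subn0 addn0.
by case: s.
Qed.

End BserDerivations.

(** Commutators are computed in any algebra with central u and h, where N i r plays
    the role of a_i(r + 1) and X j a that of the shifted creation series. *)
Section AbstractCommutators.
Variables (K : numFieldType) (B : algType K) (u h : B).
Hypothesis ch : central h.
Variables (N : 'I_2 -> nat -> B) (X : 'I_2 -> K -> B).
Hypothesis adNX : forall i r j a,
  ad (N i r) (X j a) = (i == j)%:R *: (u + a *: h) ^+ r.+1.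
Notation i1 := (ord0 : 'I_2).
Notation i2 := (ord_max : 'I_2).

Lemma binomial_tail (x y : B) r : GRing.comm x y ->
  \sum_(s < r.+1) 'C(r.+1, s.+1)%:R *: (x ^+ (r - s) * y ^+ s.+1) =
  (x + y) ^+ r.+1 - x ^+ r.+1.
Proof.
move=> xy; rewrite exprDn_comm // [in RHS]big_ord_recl /= expr0 mulr1 bin0 mulr1n.
rewrite subn0 addrAC subrr add0r.
by apply: eq_bigr => s _; rewrite /bump add1n subSS scaler_nat.
Qed.

Definition acann r : B :=
  N i2 r + \sum_(s < r.+1) 'C(r.+1, s.+1)%:R *: (h ^+ (r - s) * N i1 s).

Lemma ad_acann r x : ad (acann r) x = ad (N i2 r) x +
  \sum_(s < r.+1) 'C(r.+1, s.+1)%:R *: (h ^+ (r - s) * ad (N i1 s) x).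
Proof.
rewrite ad_addl ad_suml; congr (_ + _); apply: eq_bigr => s _.
by rewrite ad_scalel ad_mull //; apply: centralX.
Qed.

(** The binomial coefficients in c_r sum the powers (u + a h)^s to (h + (u + a
    h))^r, up to the term s = 0. *)
Lemma ad_acann_X1 r a : ad (acann r) (X i1 a) = (u + (a + 1) *: h) ^+ r.+1 - h ^+ r.+1.
Proof.
rewrite ad_acann adNX /= scale0r add0r.
have /(binomial_tail r) : GRing.comm h (u + a *: h) by apply: ch.
have -> : u + (a + 1) *: h = h + (u + a *: h) by rewrite scalerDl scale1r addrA addrC.
by move=> <-; apply: eq_bigr => s _; rewrite adNX eqxx scale1r.
Qed.

Lemma ad_acann_X2 r a : ad (acann r) (X i2 a) = (u + a *: h) ^+ r.+1.
Proof.
rewrite ad_acann adNX eqxx scale1r big1 ?addr0 // => s _.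
by rewrite adNX /= scale0r mulr0 scaler0.
Qed.

(** The shifts - 3/4 and 1/4 are such that the powers of u cancel. *)
Lemma ad_acann_E r : ad (acann r) (- X i1 (- (3 / 4)) + X i2 (1 / 4)) = h ^+ r.+1.
Proof.
rewrite adD adN ad_acann_X1 ad_acann_X2 opprB.
have -> : - (3 / 4) + 1 = 1 / 4 :> K by field.
by rewrite subrK.
Qed.

Lemma ad_acann_k1 r : ad (acann r) (X i2 1 - X i2 0) =
  (u + 1 *: h) ^+ r.+1 - (u + 0 *: h) ^+ r.+1.
Proof. by rewrite adD adN !ad_acann_X2. Qed.

(** The commutators of X_1(0) and X_1(- 1) involve u + h and u; those of X_2(1) and
    X_2(0) do too. This is why k_1^- and k_2^- commute with c_r up to the same
    factor. *)
Lemma ad_acann_k2 r : ad (acann r) (X i1 0 - X i1 (- 1)) =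
  (u + 1 *: h) ^+ r.+1 - (u + 0 *: h) ^+ r.+1.
Proof. by rewrite adD adN !ad_acann_X1 add0r addNr opprB addrA subrK. Qed.

Lemma ad_diff_E r : ad (N i1 r - N i2 r) (- X i1 (- (3 / 4)) + X i2 (1 / 4)) =
  - (u + (- (3 / 4)) *: h) ^+ r.+1 - (u + (1 / 4) *: h) ^+ r.+1.
Proof.
rewrite ad_addl ad_oppl !adD !adN !adNX eqxx /= !scale0r !scale1r oppr0 addr0 add0r.
by [].
Qed.

Lemma ad_ratio (c f f0 e0 e0' e : B) : e0 * e0' = 1 -> e0' * e0 = 1 ->
  central f -> central f0 -> ad c e = f * e -> ad c e0 = f0 * e0 ->
  ad c (e0' * e) = (f - f0) * (e0' * e).
Proof.
move=> e0V eV0 cf cf0 ce ce0; rewrite adM ce (ad_inv e0V eV0 cf0 ce0).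
by rewrite mulrA -(cf e0') mulNr -!mulrA addrC -mulrBl.
Qed.

End AbstractCommutators.

Section CentralSeries.
Variables (K : numFieldType) (A : algType K).
Implicit Types (x y : bser A).
Notation u := (bu A).
Notation h := (bh A).

Lemma central_u : central u. Proof. exact: bu_comm. Qed.
Lemma central_h : central h. Proof. exact: bh_comm. Qed.
Lemma central_uh a r : central ((u + a *: h) ^+ r).
Proof. exact: (centralX r (centralD central_u (centralZ a central_h))). Qed.

Lemma central_coef0 x : central x -> central (hcst (x 0%N) : bser A).
Proof.
move=> cx y; apply/comm_hcst => n; have := congr1 (fun z : bser A => z 0%N) (cx (hcst (y n))).
by rewrite !pserME !big_ord1.
Qed.

Lemma hvarXE (B : nzRingType) r m : (hvar ^+ r : pser B) m = (m == r)%:R.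
Proof.
elim: r m => [|r IH] m; first by rewrite expr0 pser1E.
by rewrite exprS mul_hvarE; case: m => [|m]; rewrite ?IH.
Qed.

Lemma uh_pow0 a r m : ((u + a *: h) ^+ r) m 0%N = (m == r)%:R.
Proof.
elim: r m => [|r IH] m; first by rewrite expr0 pser1E; case: eqP => // _; rewrite pser1E.
rewrite exprS mulrDl -scalerAl !pserDE !pserZE mul_buE mul_bhE scaler0 addr0.
by case: m => [|m]; rewrite ?IH.
Qed.

End CentralSeries.

Section FreeField.
Variables (K : numFieldType) (A : algType K) (an cr : 'I_2 -> nat -> A).
Hypothesis an_cr : forall i m j n,
  ad (an i m) (cr j n) = (((i, m) == (j, n)) * m.+1)%N%:R%:A.
Implicit Types (x : bser A) (e : A) (i j : 'I_2).
Notation u := (bu A).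
Notation h := (bh A).
Notation i1 := (ord0 : 'I_2).
Notation i2 := (ord_max : 'I_2).

(** \sum_(r > 0) (x_r / r) u^r, where x_r is f (r - 1). *)
Definition opser (f : nat -> A) : bser A :=
  fun s n => if (n == 0%N) && (0 < s)%N then (s%:R)^-1 *: f s.-1 else 0.

Lemma opser_comm e f : (forall n, GRing.comm e (f n)) ->
  GRing.comm (hcst (hcst e)) (opser f).
Proof.
move=> ef; apply/hcst_hcst_comm => m n; rewrite /opser; case: ifP => _.
  by rewrite /GRing.comm -scalerAr -scalerAl ef.
by apply: commr0.
Qed.

Lemma euler_opser f m : euler (opser f) m 0%N = if (0 < m)%N then f m.-1 else 0.
Proof.
rewrite /euler pserZE /opser; case: m => [|m]; first by rewrite scaler0.
by rewrite scalerA mulfV ?scale1r // pnatr_eq0.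
Qed.

Lemma ad_hcst_hcst e x m n : ad (hcst (hcst e)) x m n = ad e (x m n).
Proof. by rewrite /ad !pserBE !mul_hcstE !mulr_hcstE. Qed.

Lemma ad_opser i r j :
  ad (hcst (hcst (an i r))) (opser (cr j)) = (i == j)%:R *: u ^+ r.+1.
Proof.
apply/funext => m; apply/funext => n.
rewrite ad_hcst_hcst.
have -> : (((i == j)%:R *: u ^+ r.+1) m n = (i == j)%:R *: ((m == r.+1) && (n == 0%N))%:R).
  rewrite !pserZE hvarXE; congr (_ *: _).
  by case: (m == r.+1) => //; exact: pser1E.
rewrite /opser; case: n => [|n]; last by rewrite andbF scaler0 /ad mulr0 mul0r subrr.
case: m => [|m]; first by rewrite /= scaler0 /ad mulr0 mul0r subrr.
rewrite andbT eqSS /= adZ an_cr xpair_eqE scalerA (eq_sym r).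
have [->|mr] := eqVneq m r; last by rewrite andbF mul0n mulr0 scale0r scaler0.
case: (i == j); last by rewrite mul0n mulr0 !scale0r.
by rewrite mul1n mulVf ?pnatr_eq0.
Qed.

Lemma bsh_ad s a (c : pser A) x : ad (hcst c) (bsh s a x) = bsh s a (ad (hcst c) x).
Proof. by rewrite /ad bshB bsh_mull bsh_mulr. Qed.

Definition shop j a : bser A := bsh false a (opser (cr j)).
Definition anb i r : bser A := hcst (hcst (an i r)).

Lemma ad_shop i r j a : ad (anb i r) (shop j a) = (i == j)%:R *: (u + a *: h) ^+ r.+1.
Proof. by rewrite bsh_ad ad_opser bshZ bshX. Qed.

(** The element a_2(r + 1) + \sum_(1 <= s <= r + 1) 'C(r + 1, s) h^(r + 1 - s) a_1(s),
    as an j r stands for a_j(r + 1). *)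
Definition cann (r : nat) : pser A := hcst (an i2 r) +
  \sum_(s < r.+1) 'C(r.+1, s.+1)%:R *: (hvar ^+ (r - s) * hcst (an i1 s)).

Lemma acannE r : acann h anb r = hcst (cann r).
Proof.
rewrite /cann hcstD hcst_sum; congr (_ + _); apply: eq_bigr => s _.
by rewrite hcstZ hcstM hcstX.
Qed.

Lemma cann_comm r e : (forall j n, GRing.comm e (an j n)) ->
  forall n, GRing.comm e (cann r n).
Proof.
move=> ea; apply/comm_hcst; apply: commrD.
  by apply/comm_hcst => n; rewrite hcstE; case: ifP => // _; apply: commr0.
apply: commr_sum => s _; rewrite /GRing.comm -scalerAr -scalerAl; congr (_ *: _).
apply: commrM; first exact/commr_sym/hvarX_comm.
by apply/comm_hcst => n; rewrite hcstE; case: ifP => // _; apply: commr0.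
Qed.

(** Exponents and exponentials of the creation parts of the currents. *)
Definition expoE : bser A := - shop i1 (- (3 / 4)) + shop i2 (1 / 4).
Definition eneg : bser A := bexp expoE.
Definition ecal : bser A := binv (hcst (eneg 0%N)) * eneg.
Definition expok1 : bser A := shop i2 1 - shop i2 0.
Definition expok2 : bser A := shop i1 0 - shop i1 (- 1).

Lemma shop00 j a : shop j a 0%N 0%N = 0.
Proof. by rewrite /shop bsh00. Qed.
Lemma expoE00 : expoE 0%N 0%N = 0.
Proof. by rewrite /expoE !pserDE !pserNE !shop00 oppr0 addr0. Qed.
Lemma expok100 : expok1 0%N 0%N = 0.
Proof. by rewrite /expok1 !pserBE !shop00 subrr. Qed.
Lemma expok200 : expok2 0%N 0%N = 0.
Proof. by rewrite /expok2 !pserBE !shop00 subrr. Qed.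

Lemma eneg0 : (hcst (eneg 0%N) : bser A) 0%N 0%N = 1.
Proof. exact: bexp00. Qed.

(** The normalization by the value at u = 0 removes the constant term of the factor
    f. *)
Lemma ad_ecal (c : pser A) f : central f -> ad (hcst c) expoE = f ->
  ad (hcst c) ecal = (f - hcst (f 0%N)) * ecal.
Proof.
move=> cf cE; have cEn : ad (hcst c) eneg = f * eneg by apply: (ad_bexp expoE00 cf cE).
apply: (ad_ratio (mulbV eneg0) (mulVb eneg0) cf (central_coef0 cf) cEn).
rewrite -hcstM; have := congr1 (fun x : bser A => x 0%N) cEn.
rewrite [X in _ = X -> _]pserME big_ord1 subnn => <-.
apply/funext => m; rewrite /ad pserBE mul_hcstE mulr_hcstE !hcstE.
by case: eqP => // _; rewrite ?pserBE ?mul_hcstE ?mulr_hcstE ?mulr0 ?mul0r ?subrr.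
Qed.

(** The factor h^r is constant in u, so the normalization removes it. *)
Lemma cann_ecal r : GRing.comm (hcst (cann r)) ecal.
Proof.
apply: comm_ad; rewrite (ad_ecal (f := h ^+ r.+1)).
- by rewrite -hcstX /= subrr mul0r.
- exact/centralX/central_h.
- by rewrite -acannE; exact: (@ad_acann_E K (bser A) u h (@central_h K A) anb shop ad_shop r).
Qed.

Let central_f r : central ((u + 1 *: h) ^+ r.+1 - (u + 0 *: h) ^+ r.+1).
Proof.
exact: (@centralD K (bser A) _ _ (central_uh 1 r.+1)
  (@centralN K (bser A) _ (central_uh 0 r.+1))).
Qed.

Lemma cann_k1 r : ad (hcst (cann r)) (bexp expok1) =
  ((u + 1 *: h) ^+ r.+1 - (u + 0 *: h) ^+ r.+1) * bexp expok1.
Proof.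
apply: (ad_bexp expok100 (central_f r)).
by rewrite -acannE; exact: (@ad_acann_k1 K (bser A) u h (@central_h K A) anb shop ad_shop r).
Qed.

Lemma cann_k2 r : ad (hcst (cann r)) (bexp expok2) =
  ((u + 1 *: h) ^+ r.+1 - (u + 0 *: h) ^+ r.+1) * bexp expok2.
Proof.
apply: (ad_bexp expok200 (central_f r)).
by rewrite -acannE; exact: (@ad_acann_k2 K (bser A) u h (@central_h K A) anb shop ad_shop r).
Qed.

End FreeField.

(** * The currents at h = 0 *)

Section GeneratedCoefficients.
Variables (K : numFieldType) (A : algType K) (g : 'I_2 -> nat -> A).
Hypothesis gC : forall i m j n, GRing.comm (g i m) (g j n).
Implicit Types (x y p : bser A).

(** A form, stable under infinite sums, of the condition that the coefficients of x
    are polynomials in the g j n. *)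
Definition gen_by x :=
  forall e, (forall j n, GRing.comm e (g j n)) -> GRing.comm (hcst (hcst e)) x.

Lemma gen_by_comm x y : gen_by x -> gen_by y -> GRing.comm x y.
Proof.
move=> gx gy; apply: bser_comm => m n m' n'.
have xg j k : GRing.comm (x m n) (g j k).
  apply: commr_sym; move: m n; apply/hcst_hcst_comm; apply: gx => i l; exact: gC.
by move: m' n'; apply/hcst_hcst_comm; apply: gy.
Qed.

Lemma gen_by_opser j : gen_by (opser (g j)).
Proof. by move=> e eg; apply: opser_comm. Qed.
Lemma gen_by_bsh s a x : gen_by x -> gen_by (bsh s a x).
Proof. by move=> gx e /gx; apply: bsh_comm. Qed.
Lemma gen_byD x y : gen_by x -> gen_by y -> gen_by (x + y).
Proof. by move=> gx gy e eg; apply: commrD; [apply: gx|apply: gy]. Qed.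
Lemma gen_byN x : gen_by x -> gen_by (- x).
Proof. by move=> gx e eg; apply/commrN/gx. Qed.
Lemma gen_byM x y : gen_by x -> gen_by y -> gen_by (x * y).
Proof. by move=> gx gy e eg; apply: commrM; [apply: gx|apply: gy]. Qed.
Lemma gen_by_exp p : p 0%N 0%N = 0 -> gen_by p -> gen_by (bexp p).
Proof. by move=> p0 gp e /gp; apply: bsub_comm. Qed.
Lemma gen_by_inv x : x 0%N 0%N = 1 -> gen_by x -> gen_by (binv x).
Proof. by move=> x0 gx e /gx; apply: binv_comm. Qed.
Lemma gen_by_coef0 x : gen_by x -> gen_by (hcst (x 0%N)).
Proof.
move=> gx e eg; apply/hcst_hcst_comm => m n; rewrite hcstE.
case: eqP => _; last exact: commr0.
by have /hcst_hcst_comm := gx e eg; apply.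
Qed.
Lemma gen_by_euler x : gen_by x -> gen_by (euler x).
Proof.
move=> gx e eg; apply/hcst_hcst_comm => m n; rewrite /euler pserZE.
rewrite /GRing.comm -scalerAr -scalerAl; congr (_ *: _).
by move: m n; apply/hcst_hcst_comm; apply: gx.
Qed.

End GeneratedCoefficients.

Lemma add_mul_left_comm (B : nzRingType) (a b c v e : B) : a = 0 -> b = c * e ->
  GRing.comm c v -> a * e + v * b = c * (v * e).
Proof. by move=> -> -> cv; rewrite mul0r add0r !mulrA cv. Qed.

Lemma der_inverse (B : nzRingType) (d : B -> B) (e e' : B) :
  (forall x y, d (x * y) = d x * y + x * d y) -> d 1 = 0 ->
  e * e' = 1 -> e' * e = 1 -> d e = 0 -> d e' = 0.
Proof.
move=> dM d1 ee' e'e de; rewrite -[d e']mul1r -e'e -mulrA.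
by have := dM e e'; rewrite ee' d1 de mul0r add0r => <-; rewrite mulr0.
Qed.

Section ClassicalLimit.
Variables (K : numFieldType) (A : algType K) (an cr : 'I_2 -> nat -> A).
Hypothesis crC : forall i m j n, GRing.comm (cr i m) (cr j n).
Hypothesis an_cr : forall i m j n,
  ad (an i m) (cr j n) = (((i, m) == (j, n)) * m.+1)%N%:R%:A.
Notation i1 := (ord0 : 'I_2).
Notation i2 := (ord_max : 'I_2).

Lemma gen_by_shop j a : gen_by cr (shop cr j a).
Proof. exact/gen_by_bsh/gen_by_opser. Qed.
Lemma gen_by_expoE : gen_by cr (expoE cr).
Proof. by apply: gen_byD; [apply: gen_byN|]; apply: gen_by_shop. Qed.
Lemma gen_by_eneg : gen_by cr (eneg cr).
Proof. exact: (gen_by_exp (expoE00 cr) gen_by_expoE). Qed.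
Lemma gen_by_e0inv : gen_by cr (binv (hcst (eneg cr 0%N))).
Proof. exact: (gen_by_inv (eneg0 cr) (gen_by_coef0 gen_by_eneg)). Qed.
Lemma gen_by_ecal : gen_by cr (ecal cr).
Proof. exact: (gen_byM gen_by_e0inv gen_by_eneg). Qed.

(** The normalizing factor does not depend on u, and the creation operators commute.
    *)
Lemma euler_ecal : euler (ecal cr) = euler (expoE cr) * (ecal cr).
Proof.
set e0 := (hcst (eneg cr 0%N) : bser A).
have e00 : e0 0%N 0%N = 1 by exact: eneg0.
have de0 : euler e0 = 0.
  by apply/funext => m; rewrite /euler /e0 hcstE; case: m => [|m]; rewrite ?scale0r ?scaler0.
have d1 : euler (1 : bser A) = 0.
  by apply/funext => m; rewrite /euler pser1E; case: m => [|m]; rewrite ?scale0r ?scaler0.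
have de0V : euler (binv e0) = 0.
  exact: (der_inverse (@eulerM K A) d1 (mulbV e00) (mulVb e00) de0).
have E1 : euler (ecal cr) = euler (binv e0) * eneg cr + binv e0 * euler (eneg cr).
  exact: eulerM.
have E2 : euler (eneg cr) = euler (expoE cr) * eneg cr.
  apply: (euler_bexp (expoE00 cr)).
  exact: (gen_by_comm crC (gen_by_euler gen_by_expoE) gen_by_expoE).
apply: (etrans E1); apply: (add_mul_left_comm de0V E2).
exact: (gen_by_comm crC (gen_by_euler gen_by_expoE) gen_by_e0inv).
Qed.

(** The coefficients H_m of the normalized series E^-(u) at h = 0. *)
Definition hcoef m : A := ecal cr m 0%N.

Lemma hcoef0 : hcoef 0 = 1.
Proof.
rewrite /hcoef /ecal bserME !big_ord1.
rewrite (_ : (0 - ord0)%N = 0%N) // (_ : eneg cr 0%N 0%N = 1); last exact: bexp00.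
by rewrite mulr1 /binv /bsub big_ord1 expr0 !pser1E scale1r.
Qed.

(** Compare coefficients in u H' = (u d/du of the exponent) H, where at h = 0 the
    exponent is \sum_s (a_2(-s) - a_1(-s)) u^s / s. Solved for its last term, this
    expresses a_1(-m) - a_2(-m) through the H_m. *)
Lemma hcoef_rec m :
  m%:R *: hcoef m = \sum_(i < m) (cr i2 i - cr i1 i) * hcoef (m - i.+1).
Proof.
have := congr1 (fun x : bser A => x m 0%N) euler_ecal.
rewrite /= {1}/euler pserZE -/(hcoef m) => ->.
rewrite bserME big_ord_recl big_ord1 /=.
have eE i : euler (expoE cr) i 0%N = if (0 < i)%N then cr i2 i.-1 - cr i1 i.-1 else 0.
  rewrite /euler pserZE /expoE !pserDE !pserNE /shop !bsh_plus0 scalerDr scalerN.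
  rewrite -2!pserZE -/(euler _ _ _) -/(euler _ _ _) !euler_opser.
  by case: i => [|i] /=; rewrite ?oppr0 ?addr0 // addrC.
by rewrite eE mul0r add0r; apply: eq_bigr => i _; rewrite big_ord1 eE /bump /= add1n.
Qed.

(** The operator a_1(r) - a_2(r) acts on the exponent at h = 0 by - 2 u^r. *)
Lemma an_hcoef r m : ad (an i1 r - an i2 r) (hcoef m) =
  if (r < m)%N then - 2%:R *: hcoef (m - r.+1) else 0.
Proof.
pose R := r.+1.
pose f : bser A := - (bu A + (- (3 / 4)) *: bh A) ^+ R - (bu A + (1 / 4) *: bh A) ^+ R.
have cf : central f.
  exact: (@centralD K (bser A) _ _ (@centralN K (bser A) _ (central_uh (- (3 / 4)) R))
    (@centralN K (bser A) _ (central_uh (1 / 4) R))).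
have fE i : f i 0%N = (- 2%:R * (i == R)%:R)%:A.
  transitivity (- (i == R)%:R - (i == R)%:R : A).
    by congr (- _ - _); apply: uh_pow0.
  by case: (i == R); rewrite ?mulr1 ?mulr0 ?scale0r ?subr0 ?oppr0 // scaleNr scaler_nat opprD.
have cE : ad (hcst (hcst (an i1 r - an i2 r))) (expoE cr) = f.
  have -> : hcst (hcst (an i1 r - an i2 r)) = anb an i1 r - anb an i2 r.
    by rewrite /anb !hcstD !hcstN.
  exact: (@ad_diff_E K (bser A) (bu A) (bh A) (anb an) (shop cr) (ad_shop an_cr) r).
have := congr1 (fun x : bser A => x m 0%N) (ad_ecal cf cE).
have gE i : (f - hcst (f 0%N) : bser A) i 0%N = (- 2%:R * (i == R)%:R)%:A.
  transitivity (f i 0%N - (hcst (f 0%N) : bser A) i 0%N); first by [].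
  rewrite hcstE fE; have [->|_] := eqVneq i 0%N; last by rewrite subr0.
  by rewrite fE mulr0 scale0r subr0.
rewrite /= ad_hcst_hcst -/(hcoef m) => ->; rewrite bserME.
under eq_bigr => i _ do rewrite big_ord1 gE subn0 -scalerAl mul1r.
case: ltnP => rm.
  have rm' : (R < m.+1)%N by rewrite ltnS.
  rewrite (bigD1 (Ordinal rm')) //= eqxx mulr1 big1 ?addr0 // => i ir.
  have /negPf-> : (i : nat) != R by apply: contraNneq ir => iR; apply/eqP/val_inj.
  by rewrite mulr0 scale0r.
rewrite big1 // => i _; rewrite (ltn_eqF (leq_trans (ltn_ord i) _)) //.
by rewrite mulr0 scale0r.
Qed.

End ClassicalLimit.

Section PserEuler.
Variables (K : numFieldType) (A : algType K).
Implicit Types (a x y : pser A).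

Definition peuler x : pser A := fun m => m%:R *: x m.

Lemma peulerM x y : peuler (x * y) = peuler x * y + x * peuler y.
Proof.
apply/funext => m; rewrite /peuler pserDE !pserME scaler_sumr -big_split /=.
apply: eq_bigr => i _; rewrite -scalerAl -scalerAr -scalerDl -natrD subnKC //.
by rewrite -ltnS.
Qed.

(** The recursion given by the equation determines y from its constant term. *)
Lemma ode_unique a y : a 0%N = 0 -> peuler y = a * y -> y 0%N = 0 -> y = 0.
Proof.
move=> a0 ey y0; apply/funext => m; have [n] := ubnP m; elim: n m => // n IH [|m] mn //.
have := congr1 (fun x : pser A => x m.+1) ey; rewrite /peuler.
rewrite pserME big_ord_recl a0 mul0r add0r big1 => [|i _]; last first.
  by rewrite IH ?mulr0 // lift0 subSS; have := ltn_ord i; lia.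
by move/eqP; rewrite scaler_eq0 pnatr_eq0 /= => /eqP.
Qed.

End PserEuler.

Section AnnihilationSeries.
Variables (K : numFieldType) (A : algType K) (an cr : 'I_2 -> nat -> A).
Hypothesis anC : forall i m j n, GRing.comm (an i m) (an j n).
Hypothesis an_cr : forall i m j n,
  ad (an i m) (cr j n) = (((i, m) == (j, n)) * m.+1)%N%:R%:A.
Notation i1 := (ord0 : 'I_2).
Notation i2 := (ord_max : 'I_2).

Definition expoP : bser A := bsh true (1 / 4) (opser (an i1) - opser (an i2)).
Definition epos : bser A := bexp expoP.

Lemma gen_by_expoP : gen_by an expoP.
Proof. by apply/gen_by_bsh/gen_byD; [|apply: gen_byN]; apply: gen_by_opser. Qed.

Lemma expoP00 : expoP 0%N 0%N = 0.
Proof. by rewrite /expoP bsh00 !pserBE subrr. Qed.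

Lemma gen_by_epos : gen_by an epos.
Proof. exact: (gen_by_exp expoP00 gen_by_expoP). Qed.

(** The coefficients D_s of the series E^+(u), in powers of u^(-1), at h = 0. *)
Definition dcoef s : A := epos s 0%N.

Lemma dcoef0 : dcoef 0 = 1. Proof. exact: bexp00. Qed.

Definition alpha_ser : pser A := fun m => if m is r.+1 then an i1 r - an i2 r else 0.

Lemma peuler_dcoef : peuler (dcoef : pser A) = alpha_ser * (dcoef : pser A).
Proof.
have eE : euler epos = euler expoP * epos.
  apply: (euler_bexp expoP00).
  exact: (gen_by_comm anC (gen_by_euler gen_by_expoP) gen_by_expoP).
apply/funext => m; have := congr1 (fun x : bser A => x m 0%N) eE.
rewrite /= {1}/euler pserZE -/(dcoef m) /peuler => ->.
rewrite bserME pserME; apply: eq_bigr => i _; rewrite big_ord1; congr (_ * _).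
transitivity (euler (opser (an i1)) i 0%N - euler (opser (an i2)) i 0%N).
  by rewrite /euler pserZE /expoP bsh_plus0 -scalerBr.
rewrite !euler_opser /alpha_ser; case: (i : nat) => [|k] //=.
exact: subr0.
Qed.

(** The coefficients of (1 - t)^2. *)
Definition c2 (t : nat) : K := nth 0 [:: 1; - 2%:R; 1] t.

Lemma c2_rec u : \sum_(i < u.+1) (if (i : nat) is r.+1 then - 2%:R * c2 (u - r.+1) else 0)
  = u%:R * c2 u.
Proof.
rewrite big_ord_recl add0r (eq_bigr (fun i : 'I_u => - 2%:R * c2 (u - i.+1))) //.
rewrite -mulr_sumr (reindex_inj rev_ord_inj) /=.
rewrite (eq_bigr (fun i : 'I_u => c2 i)); last first.
  by move=> i _; congr c2; have := ltn_ord i; lia.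
have S3 v : \sum_(i < v.+3) c2 i = 0.
  elim: v => [|v IH]; last by rewrite big_ord_recr /= IH add0r /c2 /= nth_nil.
  by rewrite !big_ord_recr big_ord0 /c2 /=; ring.
case: u => [|[|[|u]]]; last by rewrite S3 /c2 /= nth_nil !mulr0.
- by rewrite big_ord0 mulr0 mul0r.
- by rewrite big_ord1 /c2 /= mulr1 mul1r.
- by rewrite !big_ord_recr big_ord0 /c2 /=; ring.
Qed.

Variable n : nat.

Definition hshift (t : nat) : A := if (t <= n)%N then hcoef cr (n - t) else 0.
Definition hgen : pser A := fun t => c2 t *: hshift t.

Lemma ad_hshift r t : ad (an i1 r - an i2 r) (hshift t) = - 2%:R *: hshift (t + r.+1).
Proof.
rewrite /hshift; case: leqP => tn; last first.
  rewrite /ad mulr0 mul0r subrr leqNgt (leq_trans tn) ?scaler0 //; lia.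
rewrite (an_hcoef an_cr) subnDA; case: ltnP => rt.
  have -> : (t + r.+1 <= n)%N by lia.
  by [].
have -> : (t + r.+1 <= n)%N = false by apply/negbTE; lia.
by rewrite scaler0.
Qed.

(** The operators a_1(r) - a_2(r) send H_n to - 2 H_(n - r), and the logarithmic
    derivative t d/dt log (1 - t)^2 is - 2 \sum_(r > 0) t^r. *)
Lemma ad_hgen : ad alpha_ser hgen = peuler hgen.
Proof.
apply/funext => u; rewrite /ad pserBE [X in _ - X]pserME.
rewrite (reindex_inj rev_ord_inj) /= pserME -sumrB.
transitivity (\sum_(i < u.+1)
    (if (i : nat) is r.+1 then - 2%:R * c2 (u - r.+1) else 0) *: hshift u).
  apply: eq_bigr => i _; have iu : (i <= u)%N by rewrite -ltnS.
  rewrite subSS (subKn iu) -/(ad _ _) /hgen adZ.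
  case: i iu => [[|r] /= _] ru; first by rewrite /ad mul0r mulr0 subr0 scaler0 scale0r.
  by rewrite ad_hshift subnK // scalerA mulrC.
by rewrite -scaler_suml c2_rec -scalerA.
Qed.

(** The exchange relation of vertex operators: as series in the index s both sides
    solve the first order equation with coefficient alpha_ser and have the same
    constant term. *)
Lemma dcoef_hcoef s : dcoef s * hcoef cr n =
  \sum_(t < s.+1) c2 t *: (hshift t * dcoef (s - t)).
Proof.
pose D : pser A := dcoef; pose H : pser A := hcst (hcoef cr n).
have eq0 : D * H - hgen * D = 0.
  apply: (ode_unique (a := alpha_ser)) => //.
    have dH : peuler H = 0.
      by apply/funext => m; rewrite /peuler /H hcstE; case: m => [|m]; rewrite ?scale0r ?scaler0.
    have eB (x y : pser A) : peuler (x - y) = peuler x - peuler y.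
      by apply/funext => m; rewrite /peuler !pserBE scalerBr.
    rewrite eB !peulerM dH mulr0 addr0 peuler_dcoef -ad_hgen /ad mulrBl mulrBr !mulrA.
    by rewrite subrK.
  rewrite pserBE mulr_hcstE pserME big_ord1 /hgen /hshift /D dcoef0 mul1r mulr1.
  by rewrite subn0 /c2 scale1r subrr.
move/eqP: eq0; rewrite subr_eq0 => /eqP/(congr1 (fun x : pser A => x s)).
rewrite /= mulr_hcstE => ->; rewrite pserME.
by apply: eq_bigr => t _; rewrite /hgen -scalerAl.
Qed.

End AnnihilationSeries.

(** * The kernel of the operators a_1(r) + a_2(r) *)

Section VacuumVectors.
Variables (K : numFieldType) (V : lmodType K) (ntV : exists v : V, v != 0).
Notation E := (endo ntV).
Variables (an cr : 'I_2 -> nat -> E) (hw : int -> V).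
Hypothesis crC : forall i m j n, GRing.comm (cr i m) (cr j n).
Hypothesis an_cr : forall i m j n,
  ad (an i m) (cr j n) = (((i, m) == (j, n)) * m.+1)%N%:R%:A.
Hypothesis an_hw : forall j n k, an j n (hw k) = 0.
Notation i1 := (ord0 : 'I_2).
Notation i2 := (ord_max : 'I_2).
Implicit Types (v w : V).

Definition zcr n : E := cr i1 n - cr i2 n.
Definition zan n : E := an i1 n + an i2 n.

Inductive zspan : V -> Prop :=
| zspan_hw k : zspan (hw k)
| zspan_lin a v w : zspan v -> zspan w -> zspan (a *: v + w)
| zspan_z n v : zspan v -> zspan (zcr n v).

Lemma zspan0 : zspan 0.
Proof. by rewrite -[0](addNr (hw 0)) -scaleN1r; apply: zspan_lin; apply: zspan_hw. Qed.

Lemma zspanZ a v : zspan v -> zspan (a *: v).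
Proof. by move=> zv; rewrite -[_ *: _]addr0; apply: zspan_lin zv zspan0. Qed.

Lemma an_crE i m j n v :
  an i m (cr j n v) = cr j n (an i m v) + (((i, m) == (j, n)) * m.+1)%N%:R *: v.
Proof.
have /(congr1 (fun e : E => e v)) := an_cr i m j n.
by rewrite /ad endoDE endoNE !endoME endoZE endo1E => <-; rewrite addrC subrK.
Qed.

Lemma zan_zcr m n v : zan m (zcr n v) = zcr n (zan m v).
Proof.
rewrite /zan /zcr !endoDE !endoNE !endoDr !endoNr !an_crE !xpair_eqE /=.
rewrite !mul0n !scale0r !addr0; move: (_ *: v) => x.
rewrite (addrAC _ x) (opprD _ x) (addrC _ (- x)) !addrA (addrAC _ x) addrK.
by rewrite opprD addrA (addrAC _ (- _)).
Qed.

Lemma zan_y m n v :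
  zan m (cr i2 n v) = cr i2 n (zan m v) + ((m == n) * m.+1)%N%:R *: v.
Proof.
rewrite /zan !endoDE endoDr !an_crE !xpair_eqE /=.
by rewrite mul0n scale0r addr0 addrA.
Qed.

Lemma zan_zspan n v : zspan v -> zan n v = 0.
Proof.
elim=> [k|a w w' _ IH _ IH'|m w _ IH].
- by rewrite /zan endoDE !an_hw addr0.
- by rewrite endoDr endoZr IH IH' scaler0 addr0.
- by rewrite zan_zcr IH endo0r.
Qed.

(** The filtration by the number of factors a_2(-n); the bound d on n makes ycount a
    finite sum. *)
Inductive yspan (d : nat) : nat -> V -> Prop :=
| yspan_z k v : zspan v -> yspan d k v
| yspan_lin k a v w : yspan d k v -> yspan d k w -> yspan d k (a *: v + w)
| yspan_y k n v : (n < d)%N -> yspan d k v -> yspan d k.+1 (cr i2 n v).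

Lemma yspan0 d k : yspan d k 0. Proof. exact/yspan_z/zspan0. Qed.

Lemma yspanZ d k a v : yspan d k v -> yspan d k (a *: v).
Proof. by move=> yv; rewrite -[_ *: _]addr0; apply: yspan_lin yv (yspan0 d k). Qed.

Lemma yspan_mono d d' k k' v :
  (d <= d')%N -> (k <= k')%N -> yspan d k v -> yspan d' k' v.
Proof.
move=> dd + yv; elim: yv k' => {k v} [k v zv|k a v w _ IH _ IH'|k n v nd _ IH] k' kk.
- exact: yspan_z.
- by apply: yspan_lin; [apply: IH|apply: IH'].
- by case: k' kk => // k' kk; apply: yspan_y; [apply: leq_trans dd|apply: IH].
Qed.

Lemma yspan_zcr d k n v : yspan d k v -> yspan d k (zcr n v).
Proof.
elim=> {k v} [k v zv|k a v w _ IH _ IH'|k m v md _ IH].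
- exact/yspan_z/zspan_z.
- by rewrite endoDr endoZr; apply: yspan_lin.
- have -> : zcr n (cr i2 m v) = cr i2 m (zcr n v); last exact: yspan_y.
  rewrite -!endoME; congr (endo_fun _ _); apply/commr_sym/commrB; exact: crC.
Qed.

(** The Euler operator counting the factors a_2(-n). *)
Definition ycount d : E := \sum_(n < d) (n.+1%:R)^-1 *: (cr i2 n * zan n).

Lemma ycount_zspan d v : zspan v -> ycount d v = 0.
Proof.
move=> zv; rewrite /ycount endo_sumE big1 // => n _.
by rewrite endoZE endoME zan_zspan // endo0r scaler0.
Qed.

(** With the differences a_1(-n) - a_2(-n) and the a_2(-n) as coordinates, (n +
    1)^-1 (a_1(n + 1) + a_2(n + 1)) is the derivative in a_2(-n-1). *)
Lemma ycount_y d n v : (n < d)%N -> ycount d (cr i2 n v) = cr i2 n (ycount d v) + cr i2 n v.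
Proof.
move=> nd; rewrite /ycount !endo_sumE endo_sumr.
rewrite (eq_bigr (fun m : 'I_d => cr i2 n (((m.+1%:R)^-1 *: (cr i2 m * zan m)) v) +
   ((m : nat) == n)%:R *: cr i2 n v)); last first.
  move=> m _; rewrite !endoZE !endoME zan_y; move: (zan m v) => x.
  rewrite !endoDr !endoZr scalerDr; congr (_ + _).
    congr (_ *: _); exact: (congr1 (fun e : E => e x) (crC i2 m i2 n)).
  have [->|mn] := eqVneq (m : nat) n; last by rewrite /= mul0n !scale0r scaler0.
  by rewrite mul1n scalerA mulVf ?pnatr_eq0 // scale1r.
rewrite big_split /=; congr (_ + _).
rewrite (bigD1 (Ordinal nd)) //= eqxx scale1r big1 ?addr0 // => m mn.
have /negPf-> : (m : nat) != n by apply: contraNneq mn => e; apply/eqP/val_inj.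
by rewrite scale0r.
Qed.

(** Up to terms with fewer factors a_2(-n), the Euler operator multiplies by the
    number of factors. *)
Lemma ycount_yspan d k v : yspan d k v ->
  if k is k'.+1 then yspan d k' (ycount d v - k%:R *: v) else ycount d v = 0.
Proof.
elim=> {k v} [k v zv|k a v w yv IH yw IH'|k n v nd yv IH].
- rewrite ycount_zspan //; case: k => // k; rewrite sub0r -scaleNr.
  exact/yspan_z/zspanZ.
- case: k yv IH yw IH' => [|k] yv IH yw IH'; rewrite endoDr endoZr.
    by rewrite IH IH' scaler0 addr0.
  have -> : k.+1%:R *: (a *: v + w) = a *: (k.+1%:R *: v) + k.+1%:R *: w.
    by rewrite scalerDr !scalerA mulrC.
  by rewrite opprD addrACA -scalerBr; apply: yspan_lin.
- rewrite ycount_y // -[k.+1]addn1 natrD scalerDl scale1r opprD addrACA subrr addr0.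
  rewrite -endoZr -endoNr -endoDr; case: k yv IH => [|k] yv IH.
    by rewrite IH scale0r subrr endo0r; apply: yspan0.
  exact: yspan_y.
Qed.

Lemma yspan_kernel d k v : yspan d k v -> (forall n, zan n v = 0) -> zspan v.
Proof.
move=> + zv; have yv0 : ycount d v = 0.
  rewrite /ycount endo_sumE big1 // => n _.
  by rewrite endoZE endoME zv endo0r scaler0.
elim: k => [|k IH] yv.
  move: yv {yv0 zv}; move: {1 3}0%N (erefl 0%N) => k k0 yv; elim: yv k0 => {k v}.
  - by [].
  - by move=> k a v w _ IH _ IH' k0; apply: zspan_lin; [apply: IH|apply: IH'].
  - by [].
apply: IH; have /(yspanZ (- (k.+1%:R)^-1)) := ycount_yspan yv.
rewrite yv0 sub0r -scaleNr scalerA mulrN mulNr opprK mulVf ?scale1r //.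
by rewrite pnatr_eq0.
Qed.

Hypothesis V_ind : forall P : V -> Prop, (forall k, P (hw k)) ->
  (forall a v w, P v -> P w -> P (a *: v + w)) ->
  (forall j n v, P v -> P (cr j n v)) -> forall v, P v.

Lemma yspan_all v : exists d k, yspan d k v.
Proof.
elim/V_ind: v => [k|a v w [d [k yv]] [d' [k' yw]]|j n v [d [k yv]]].
- by exists 0%N, 0%N; apply/yspan_z/zspan_hw.
- exists (maxn d d'), (maxn k k'); apply: yspan_lin.
    by apply: yspan_mono yv; rewrite leq_maxl.
  by apply: yspan_mono yw; rewrite leq_maxr.
have y2 : yspan (maxn d n.+1) k.+1 (cr i2 n v).
  apply: yspan_y; first by rewrite leq_maxr.
  by apply: yspan_mono yv => //; rewrite leq_maxl.
exists (maxn d n.+1), k.+1; have [->|j2] := eqVneq j i2; first exact: y2.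
have -> : j = i1 by apply/val_inj; case: j j2 => [[|[|]]].
have -> : cr i1 n v = 1 *: zcr n v + cr i2 n v.
  by rewrite scale1r /zcr endoDE endoNE subrK.
apply: yspan_lin => //; apply: yspan_zcr.
by apply: yspan_mono yv => //; rewrite leq_maxl.
Qed.

(** The Euler operator ycount is a combination of the a_1(r) + a_2(r), hence kills
    v; on a vector with at most k > 0 factors a_2(-n) it acts as k modulo vectors
    with fewer factors, so k can be lowered to 0. *)
Lemma kernel_zspan v : (forall n, zan n v = 0) -> zspan v.
Proof. by have [d [k yv]] := yspan_all v; apply: yspan_kernel yv. Qed.

End VacuumVectors.

(** * Triangularity of the monomials in the modes *)

Section LinearSpan.
Variables (K : numFieldType) (V : lmodType K).
Implicit Types (S T : V -> Prop) (v w : V).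

Inductive lspan S : V -> Prop :=
| lspan0 : lspan S 0
| lspan_step a v w : S v -> lspan S w -> lspan S (a *: v + w).

Lemma lspan_gen S v : S v -> lspan S v.
Proof. by move=> Sv; rewrite -[v]addr0 -[v]scale1r; apply: lspan_step (lspan0 S). Qed.

Lemma lspanD S v w : lspan S v -> lspan S w -> lspan S (v + w).
Proof.
by elim=> [|a x y Sx _ IH] Sw; rewrite ?add0r // -addrA; apply: lspan_step (IH _).
Qed.

Lemma lspanZ S a v : lspan S v -> lspan S (a *: v).
Proof.
elim=> [|b x y Sx _ IH]; first by rewrite scaler0; apply: lspan0.
by rewrite scalerDr scalerA; apply: lspan_step.
Qed.

Lemma lspan_sum S I (r : seq I) (P : pred I) (F : I -> V) :
  (forall i, P i -> lspan S (F i)) -> lspan S (\sum_(i <- r | P i) F i).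
Proof. by move=> SF; apply: big_ind => //; [apply: lspan0|apply: lspanD]. Qed.

Lemma lspan_bind S T v : (forall x, S x -> lspan T x) -> lspan S v -> lspan T v.
Proof.
move=> ST; elim=> [|a x y /ST Tx _ Ty]; first exact: lspan0.
by apply: lspanD => //; apply: lspanZ.
Qed.

Lemma lspan_map ntV (e : @endo K V ntV) S T v :
  (forall x, S x -> lspan T (e x)) -> lspan S v -> lspan T (e v).
Proof.
move=> ST; elim=> [|a x y /ST Tx _ Ty]; first by rewrite endo0r; apply: lspan0.
by rewrite endoDr endoZr; apply: lspanD => //; apply: lspanZ.
Qed.

End LinearSpan.

Section DotProduct.
Implicit Types (s t : seq nat).

Fixpoint dot s t : nat :=
  match s, t with x :: s', y :: t' => (x * y + dot s' t')%N | _, _ => 0%N end.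

Lemma dot_self s : dot s s = sumn [seq (x * x)%N | x <- s].
Proof. by elim: s => //= x s ->. Qed.

Lemma dot_le_sum s : (dot s s <= sumn s ^ 2)%N.
Proof. by elim: s => //= x s IH; nia. Qed.

(** The sum of the squares of the differences is positive. *)
Lemma dot_cauchy s t : size s = size t -> s <> t ->
  (2 * dot s t < dot s s + dot t t)%N.
Proof.
elim: s t => [|x s IH] [|y t] //= [st] ne.
have [exy|nxy] := eqVneq x y.
  have /(IH _ st) : s <> t by move=> e; apply: ne; rewrite exy e.
  by rewrite exy; nia.
have : (2 * dot s t <= dot s s + dot t t)%N.
  by have [->|/eqP/(IH _ st)/ltnW//] := eqVneq s t; rewrite addnn -mul2n.
have : (2 * (x * y) < x * x + y * y)%N by move/eqP: nxy; nia.
by rewrite mulnDr; nia.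
Qed.

(** The decrease of the pairing from m to t is made up for by placing the removed
    mass on a, which bounds all entries of s. *)
Lemma dot_lower a s t m : all (fun x => x <= a)%N s -> all2 leq t m -> size s = size t ->
  (dot s m + a * sumn t <= dot s t + a * sumn m)%N.
Proof.
elim: s t m => [|x s IH] [|y t] [|z m] //=.
by case/andP=> xa sa /andP[yz tm] [st]; have := IH _ _ sa tm st; nia.
Qed.

End DotProduct.

Section Triangularity.
Variables (K : numFieldType) (V : lmodType K) (ntV : exists v : V, v != 0).
Notation E := (endo ntV).
Variables (H D : nat -> E) (c : nat -> K) (hw : int -> V).
Hypothesis HC : forall m n, GRing.comm (H m) (H n).
Hypothesis D0 : D 0 = 1.
Hypothesis D_hw : forall s k, D s.+1 (hw k) = 0.
Hypothesis DH : forall s n, D s * H n =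
  \sum_(t < s.+1) c t *: ((if (t <= n)%N then H (n - t) else 0) * D (s - t)).
Implicit Types (la mu nu : seq nat).

Definition hword mu : E := \prod_(m <- mu) H m.

Lemma hword_cons m mu v : hword (m :: mu) v = H m (hword mu v).
Proof. by rewrite /hword big_cons endoME. Qed.

Lemma hword_perm la mu : perm_eq la mu -> hword la = hword mu.
Proof.
move=> lm; apply: (catCA_perm_ind (P := fun s => hword la = hword s) _ lm) => //.
move=> s1 s2 s3 ->; rewrite /hword !big_cat /= !mulrA.
by congr (_ * _); apply: commr_prod => m _; apply/commr_sym/commr_prod => n _.
Qed.

(** Each D_s lowers the indices of a product by s in total, one index after the
    other. *)
Lemma D_hword s mu k :
  lspan (fun v => exists nu, [/\ v = hword nu (hw k), size nu = size mu,
      all2 leq nu mu & (sumn nu + s = sumn mu)%N]) (D s (hword mu (hw k))).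
Proof.
elim: mu s => [|m mu IH] s.
  rewrite /hword big_nil endo1E; case: s => [|s]; last by rewrite D_hw; apply: lspan0.
  rewrite D0 endo1E; apply: lspan_gen; exists [::]; split => //.
  by rewrite /hword big_nil endo1E.
rewrite hword_cons -endoME DH endo_sumE; apply: lspan_sum => t _.
rewrite endoZE endoME; apply: lspanZ; case: ifP => tm; last exact: lspan0.
apply: lspan_map (IH (s - t)%N) => _ [nu [-> sz le sm]]; apply: lspan_gen.
exists (m - t :: nu)%N; rewrite hword_cons /= sz le leq_subr; split => //.
by have := ltn_ord t; lia.
Qed.

(** Vertex operator modes, acting on charge k as \sum_s H_(l+s) D_s, where the
    mode l + 2 k counts the shift by the lattice part. *)
Variable X : nat -> E.
Hypothesis X_hword : forall l mu (k : nat), X (k.*2 + l) (hword mu (hw k)) =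
  \sum_(s < (sumn mu).+1) H (l + s) (D s (hword mu (hw k.+1))).

(** The term s = 0 is the leading product; in the others s + 1 is moved from the old
    indices to the new one. *)
Lemma X_lead l mu (k : nat) :
  lspan (fun v => exists s nu, [/\ v = hword (l + s.+1 :: nu)%N (hw k.+1),
      size nu = size mu, all2 leq nu mu & (sumn nu + s.+1 = sumn mu)%N])
    (X (k.*2 + l) (hword mu (hw k)) - hword (l :: mu) (hw k.+1)).
Proof.
rewrite X_hword big_ord_recl D0 endo1E addn0 hword_cons addrAC subrr add0r.
apply: lspan_sum => s _; apply: lspan_map (D_hword _ _ _) => _ [nu [-> sz le sm]].
apply: lspan_gen; exists s, nu; rewrite hword_cons; split => //.
Qed.

Fixpoint xstate la : V :=
  if la is l :: la' then X ((size la').*2 + l) (xstate la') else hw 0.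

(** Compare the vectors through their pairing with all decreasing sequences; with nu
    = la and the Cauchy inequality this gives dot la la < dot mu mu when mu <> la.
    *)
Definition dominates la mu := forall nu, sorted geq nu -> size nu = size la ->
  (dot nu la <= dot nu mu)%N.

(** Applying the mode with index l to the correction terms of the previous state
    puts l in front of them, and the corrections of the mode itself move mass to the
    front, where the decreasing sequences nu are largest. *)
Lemma xstate_lead la : sorted geq la ->
  lspan (fun v => exists mu, [/\ v = hword mu (hw (size la)), size mu = size la,
      sumn mu = sumn la, dominates la mu & mu <> la])
    (xstate la - hword la (hw (size la))).
Proof.
elim: la => [|l la IH] sl.
  by rewrite /hword big_nil endo1E subrr; apply: lspan0.
have {IH} := IH (path_sorted sl); set S := (X in lspan X) => IH /=.
set T := (X in lspan X _).
have stepT mu : size mu = size la -> sumn mu = sumn la -> dominates la mu ->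
    lspan T (X ((size la).*2 + l) (hword mu (hw (size la)))
             - hword (l :: mu) (hw (size la).+1)).
  move=> sz sm dom; apply: lspan_bind (X_lead l mu (size la)) => _ [s [nu [-> sz' le sm']]].
  apply: lspan_gen; exists (l + s.+1 :: nu)%N; split => //=.
  - by rewrite sz' sz.
  - by rewrite -sm -sm'; lia.
  - case=> // a ka sa [ska] /=.
    have sub_a : all (fun x => x <= a)%N ka.
      by move: sa; rewrite /= (path_sortedE (fun x y z xy yz => leq_trans yz xy)) => /andP[].
    have dn := dot_lower sub_a le (etrans ska (esym (etrans sz' sz))).
    have dm := dom _ (path_sorted sa) ska.
    by move: dn; rewrite -sm' !mulnDr; lia.
  - by case; lia.
have {IH} IHX : lspan T (X ((size la).*2 + l) (xstate la - hword la (hw (size la)))).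
  apply: lspan_map IH => _ [mu [-> sz sm dom ne]].
  rewrite -[X _ _](subrK (hword (l :: mu) (hw (size la).+1))); apply: lspanD; first exact: stepT.
  apply: lspan_gen; exists (l :: mu); split => //=; first by rewrite sz.
  - by rewrite sm.
  - case=> // a ka sa [ska] /=; rewrite leq_add2l; apply: dom => //; exact: path_sorted sa.
  - by case.
have -> : X ((size la).*2 + l) (xstate la) - hword (l :: la) (hw (size la).+1) =
    X ((size la).*2 + l) (xstate la - hword la (hw (size la))) +
    (X ((size la).*2 + l) (hword la (hw (size la))) - hword (l :: la) (hw (size la).+1)).
  by rewrite endoDr endoNr addrA subrK.
by apply: lspanD => //; apply: stepT.
Qed.

Variables (T : V -> Prop) (chg : int -> E).
Hypothesis T_lin : forall a v w, T v -> T w -> T (a *: v + w).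
Hypothesis chg_hw : forall k l, chg k (hw l) = hw (l + k).
Hypothesis chg_H : forall k m, GRing.comm (chg k) (H m).
Hypothesis T_xstate : forall k la, sorted geq la -> T (chg k (xstate la)).

Lemma chg_hword k l mu : chg k (hword mu (hw l)) = hword mu (hw (l + k)).
Proof.
have : GRing.comm (chg k) (hword mu).
  by rewrite /hword; apply: commr_prod => m _; apply: chg_H.
by move/(congr1 (fun e : E => e (hw l))); rewrite !endoME chg_hw.
Qed.

Lemma T_lspan S v : (forall x, S x -> T x) -> lspan S v -> T v.
Proof.
have T0 : T 0.
  have := T_lin (-1) (T_xstate 0 (isT : sorted geq [::])) (T_xstate 0 (isT : sorted geq [::])).
  by rewrite scaleN1r addNr.
by move=> ST; elim=> [//|a x y /ST Tx _ Ty]; apply: T_lin.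
Qed.

(** Sort the indices; by xstate_lead the product differs from a monomial in the
    modes by products with a larger sum of squares, which is at most the square of
    the total index. *)
Lemma T_hword mu k : T (hword mu (hw k)).
Proof.
(* The sum of the squares of the indices is at most the square of their sum. *)
have [n] := ubnP (sumn mu ^ 2 - dot mu mu)%N.
elim: n mu k => // n IH mu0 k; set la := sort geq mu0.
have slm : perm_eq la mu0 by rewrite perm_sort.
have sla : sorted geq la by apply: sort_sorted => x y; apply: leq_total.
rewrite -(hword_perm slm); have -> : (sumn mu0 ^ 2 - dot mu0 mu0 = sumn la ^ 2 - dot la la)%N.
  by rewrite !dot_self (perm_sumn slm) (perm_sumn (perm_map _ slm)).
move=> lan; set N : int := (size la)%:Z.
have TS : T (chg (k - N) (xstate la - hword la (hw N))).
  apply: (T_lspan _ (lspan_map _ (xstate_lead sla))) => [x|_ [mu [-> sz sm dom ne]]].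
    by apply.
  apply: lspan_gen; rewrite chg_hword addrC subrK; apply: IH.
  have dl := dot_cauchy (esym sz) (fun e => ne (esym e)); have dd := dom _ sla erefl.
  have := dot_le_sum mu; move: lan; rewrite sm; lia.
have := T_lin (-1) TS (T_xstate (k - N) sla).
rewrite endoDr endoNr chg_hword (addrC N) subrK scaleN1r opprB.
by rewrite subrK.
Qed.

End Triangularity.

(** * Products of two-sided distributions *)

Section Grading.
Variables (K : numFieldType) (V : lmodType K) (ntV : exists v : V, v != 0).
Notation E := (endo ntV).
Variables (an cr : 'I_2 -> nat -> E) (hw : int -> V).
Hypothesis an_cr : forall i m j n,
  ad (an i m) (cr j n) = (((i, m) == (j, n)) * m.+1)%N%:R%:A.
Hypothesis an_hw : forall j n k, an j n (hw k) = 0.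
Implicit Types (v w : V) (d t : int) (e : E) (x y p : bser E).

(** Vectors of degree at most d, when a_j(-n) has degree n. *)
Inductive fdeg : int -> V -> Prop :=
| fdeg0 d : fdeg d 0
| fdeg_hw d k : 0 <= d -> fdeg d (hw k)
| fdeg_lin d a v w : fdeg d v -> fdeg d w -> fdeg d (a *: v + w)
| fdeg_cr d j n v : fdeg (d - n.+1%:Z) v -> fdeg d (cr j n v).

Lemma fdeg_neg d v : fdeg d v -> d < 0 -> v = 0.
Proof.
elim=> {d v} // [d k d0|d a v w _ IH _ IH'|d j n v _ IH] dn.
- by move: d0; rewrite leNgt dn.
- by rewrite IH // IH' // scaler0 addr0.
- by rewrite IH ?endo0r //; lia.
Qed.

Lemma fdeg_mono d d' v : d <= d' -> fdeg d v -> fdeg d' v.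
Proof.
move=> + dv; elim: dv d' => {d v} [d|d k d0|d a v w _ IH _ IH'|d j n v _ IH] d' dd.
- exact: fdeg0.
- by apply: fdeg_hw; lia.
- by apply: fdeg_lin; [apply: IH|apply: IH'].
- by apply: fdeg_cr; apply: IH; lia.
Qed.

Lemma fdegZ d a v : fdeg d v -> fdeg d (a *: v).
Proof. by move=> dv; rewrite -[_ *: _]addr0; apply: fdeg_lin dv (fdeg0 d). Qed.

Lemma fdegD d v w : fdeg d v -> fdeg d w -> fdeg d (v + w).
Proof. by move=> dv; rewrite -[v]scale1r; apply: fdeg_lin. Qed.

Definition low t e := forall d v, fdeg d v -> fdeg (d - t) (e v).

(** Annihilation kills the highest weight vectors and commutes with creation up to a
    scalar that carries the full degree. *)
Lemma low_an j n : low n.+1 (an j n).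
Proof.
move=> d v; elim=> {d v} [d|d k d0|d a v w _ IH _ IH'|d i m v dv IH].
- by rewrite endo0r; apply: fdeg0.
- by rewrite an_hw; apply: fdeg0.
- by rewrite endoDr endoZr; apply: fdeg_lin.
rewrite an_crE //; apply: fdegD; first by apply: fdeg_cr; rewrite addrAC.
have [[_ ->]|_] := eqVneq (j, n) (i, m); first exact: fdegZ.
by rewrite mul0n scale0r; apply: fdeg0.
Qed.

Lemma low1 : low 0 1.
Proof. by move=> d v dv; rewrite endo1E subr0. Qed.

Lemma lowM t t' e e' : low t e -> low t' e' -> low (t + t') (e * e').
Proof. by move=> le le' d v /le'/le; rewrite endoME opprD addrA addrAC. Qed.

Lemma lowZ t a e : low t e -> low t (a *: e).
Proof. by move=> le d v /le dv; rewrite endoZE; apply: fdegZ. Qed.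

Lemma lowD t e e' : low t e -> low t e' -> low t (e + e').
Proof. by move=> le le' d v dv; rewrite endoDE; apply: fdegD; [apply: le|apply: le']. Qed.

Lemma low0 t : low t 0.
Proof. by move=> d v _; apply: fdeg0. Qed.

Lemma low_sum t I (r : seq I) (P : pred I) (F : I -> E) :
  (forall i, P i -> low t (F i)) -> low t (\sum_(i <- r | P i) F i).
Proof. by move=> lF; apply: big_ind => //; [apply: low0|move=> ? ?; apply: lowD]. Qed.

(** A pole u^(-s) at order h^n comes with a product of annihilation operators of
    degree at least s - n. *)
Definition lowering x := forall s n : nat, low (s%:Z - n%:Z) (x s n).

Lemma lowering1 : lowering 1.
Proof.
move=> s n; rewrite pser1E; case: eqP => [->|_]; last exact: low0.
rewrite [X in low _ X]pser1E; case: eqP => [->|_]; last exact: low0.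
by rewrite subrr; apply: low1.
Qed.

Lemma loweringM x y : lowering x -> lowering y -> lowering (x * y).
Proof.
move=> lx ly s n; rewrite bserME; apply: low_sum => i _; apply: low_sum => j _.
have := lowM (lx i j) (ly (s - i)%N (n - j)%N); congr low.
by have := ltn_ord i; have := ltn_ord j; lia.
Qed.

Lemma loweringD x y : lowering x -> lowering y -> lowering (x + y).
Proof. by move=> lx ly s n; apply: lowD. Qed.

Lemma loweringN x : lowering x -> lowering (- x).
Proof. by move=> lx s n; rewrite !pserNE -scaleN1r; apply: lowZ. Qed.

Lemma loweringX x k : lowering x -> lowering (x ^+ k).
Proof.
move=> lx; elim: k => [|k IH]; first by rewrite expr0; apply: lowering1.
by rewrite exprS; apply: loweringM.
Qed.

Lemma lowering_bsub (c : nat -> K) p : lowering p -> lowering (bsub c p).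
Proof.
move=> lp s n; rewrite /bsub; apply: low_sum => k _; apply: lowZ.
exact: loweringX.
Qed.

Lemma lowering_bsh a x : lowering x -> lowering (bsh true a x).
Proof.
move=> lx s n; rewrite /bsh; apply: low_sum => j _; apply: lowZ.
case: leqP => js; last exact: low0.
by have := lx (s - j)%N (n - j)%N; congr low; have := ltn_ord j; lia.
Qed.

Lemma lowering_opser j : lowering (opser (an j)).
Proof.
move=> s n; rewrite /opser; case: n s => [|n] [|s] /=; try exact: low0.
by rewrite subr0; apply: lowZ; apply: low_an.
Qed.

Hypothesis V_ind : forall P : V -> Prop, (forall k, P (hw k)) ->
  (forall a v w, P v -> P w -> P (a *: v + w)) ->
  (forall j n v, P v -> P (cr j n v)) -> forall v, P v.

Lemma fdeg_all v : exists d, fdeg d v.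
Proof.
elim/V_ind: v => [k|a v w [d dv] [d' dw]|j n v [d dv]].
- by exists 0; apply: fdeg_hw.
- exists (Num.max d d'); apply: fdeg_lin.
    by apply: fdeg_mono dv; rewrite le_max lexx.
  by apply: fdeg_mono dw; rewrite le_max lexx orbT.
- by exists (d + n.+1%:Z); apply: fdeg_cr; rewrite addrK.
Qed.

(** Every vector has a bounded degree, and a vector of negative degree is zero. *)
Lemma lowering_kill x n v : lowering x ->
  exists N : nat, forall s j, (N <= s)%N -> (j <= n)%N -> x s j v = 0.
Proof.
move=> lx; have [d dv] := fdeg_all v; exists (`|d| + n).+1%N => s j Ns jn.
by apply: (fdeg_neg (lx s j d v dv)); lia.
Qed.

End Grading.

Section TwoSidedProducts.
Variable K : numFieldType.
Notation E := (fend K).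
Implicit Types (p q t : fdist int E) (v : fock0 K) (c : pser E) (r : seq int).

(** A product of two-sided distributions is a finite sum only at each vector and
    order; r holds the exponents that contribute. *)
Definition covers p q m n v r := forall l, l \notin r -> forall i j,
  (i <= n)%N -> (j <= n)%N -> p l i (q (m - l) j v) = 0.

Definition locfin p q := forall m n v, exists r, covers p q m n v r.

Lemma covers_sub p q m n v r r' : {subset r <= r'} ->
  covers p q m n v r -> covers p q m n v r'.
Proof. by move=> rr cr l lr; apply: cr; apply: contra lr; apply: rr. Qed.

Lemma omul_covers p q m n v r : uniq r -> covers p q m n v r ->
  omul (oval p) (oval q) m n v = \sum_(l <- r) ((p l * q (m - l) : pser E) n : E) v.
Proof.
move=> ur cr; rewrite /omul /dconv.
under eq_bigr => i _.
  rewrite (fsumT_seq ur) => [|l lr]; first over.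
  by apply: cr => //; rewrite ?leq_subr // -ltnS.
rewrite exchange_big; apply: eq_bigr => l _ /=.
by rewrite pserME endo_sumE.
Qed.

Lemma omul_linear p q m n : locfin p q -> linear (omul (oval p) (oval q) m n).
Proof.
move=> pq a v w; have [r rv] := pq m n v; have [r' rw] := pq m n w.
pose r2 := undup (r ++ r'); have ur : uniq r2 by apply: undup_uniq.
have r2v : covers p q m n v r2.
  by apply: covers_sub rv => l lr; rewrite mem_undup mem_cat lr.
have r2w : covers p q m n w r2.
  by apply: covers_sub rw => l lr; rewrite mem_undup mem_cat lr orbT.
have r2vw : covers p q m n (a *: v + w) r2.
  move=> l lr i j il jl; rewrite !endoDr !endoZr (r2v _ lr) // (r2w _ lr) //.
  by rewrite scaler0 addr0.
rewrite !(omul_covers ur) // scaler_sumr -big_split /=.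
by apply: eq_bigr => l _; rewrite endoDr endoZr.
Qed.

(** Two vectors and their combination admit a common finite set of exponents, so the
    pointwise sums are linear. *)
Lemma omul_two_sided p q : locfin p q -> exists2 t, omul (oval p) (oval q) = oval t &
  forall m n v r, uniq r -> covers p q m n v r ->
    t m n v = \sum_(l <- r) ((p l * q (m - l) : pser E) n : E) v.
Proof.
move=> pq; exists (fun m n => mkendo (fock0_neq0 K) (omul_linear m n pq)) => //.
by move=> m n v r; apply: omul_covers.
Qed.

(** With one finite set of exponents for v and for all c_j v of order at most n, the
    claim is that of finite sums. *)
Lemma two_sided_comm p q t c : locfin p q ->
  (forall m n v r, uniq r -> covers p q m n v r ->
    t m n v = \sum_(l <- r) ((p l * q (m - l) : pser E) n : E) v) ->
  (forall l, GRing.comm c (p l)) -> (forall l, GRing.comm c (q l)) ->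
  forall m, GRing.comm c (t m).
Proof.
move=> pq tE cp cq m; apply/funext => n; apply: endoP => v.
have [r0 r0v] := pq m n v.
have aux N : exists r, forall j, (j <= N)%N -> covers p q m n (c j v) r.
  elim: N => [|k [r rk]].
    by have [r rv] := pq m n (c 0%N v); exists r => j; rewrite leqn0 => /eqP->.
  have [r' rv] := pq m n (c k.+1 v); exists (r ++ r') => j.
  rewrite leq_eqVlt => /orP[/eqP->|jk].
    by apply: covers_sub rv => l lr; rewrite mem_cat lr orbT.
  by apply: covers_sub (rk j jk) => l lr; rewrite mem_cat lr.
have {aux} [r1 r1v] := aux n.
pose r := undup (r0 ++ r1); have ur : uniq r by apply: undup_uniq.
have rv : covers p q m n v r.
  by apply: covers_sub r0v => l lr; rewrite mem_undup mem_cat lr.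
have rcv j : (j <= n)%N -> covers p q m n (c j v) r.
  by move=> /r1v; apply: covers_sub => l lr; rewrite mem_undup mem_cat lr orbT.
have cov_le w k : (k <= n)%N -> covers p q m n w r -> covers p q m k w r.
  move=> kn cw l lr i j ik jk.
  by apply: cw => //; [apply: leq_trans ik kn|apply: leq_trans jk kn].
transitivity (\sum_(l <- r) ((c * (p l * q (m - l))) n : E) v).
  rewrite pserME endo_sumE (eq_bigr (fun i : 'I_n.+1 =>
    \sum_(l <- r) c i (((p l * q (m - l) : pser E) (n - i)%N : E) v))).
    by rewrite exchange_big; apply: eq_bigr => l _; rewrite pserME endo_sumE.
  move=> i _; rewrite endoME (tE _ _ _ _ ur) ?endo_sumr //.
  by apply: cov_le rv; apply: leq_subr.
transitivity (\sum_(l <- r) (((p l * q (m - l)) * c) n : E) v).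
  apply: eq_bigr => l _; congr (endo_fun _ v).
  by congr (_ n); apply: (commrM (cp l) (cq (m - l))).
rewrite [X in _ = endo_fun X v]pserME [RHS]endo_sumE [RHS](eq_bigr (fun i : 'I_n.+1 =>
    \sum_(l <- r) ((p l * q (m - l) : pser E) i : E) (c (n - i)%N v))).
  by rewrite exchange_big; apply: eq_bigr => l _; rewrite pserME endo_sumE.
move=> i _; rewrite endoME (tE _ _ _ _ ur) //.
by apply: cov_le; [rewrite -ltnS|apply: rcv; apply: leq_subr].
Qed.

End TwoSidedProducts.

(** * Vertex operators *)

Lemma pser_comm (B : nzRingType) (f g : pser B) :
  (forall i j, GRing.comm (f i) (g j)) -> GRing.comm f g.
Proof.
move=> fg; apply/funext => n; rewrite !pserME (reindex_inj rev_ord_inj) /=.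
by apply: eq_bigr => i _; rewrite subSS subKn; [apply: fg|rewrite -ltnS].
Qed.

Section ChargeOperators.
Variable K : numFieldType.
Notation E := (fend K).
Implicit Types (f g : int -> K) (P : nat -> int -> K) (e : int) (a : K).

Lemma bas_ind (Q : fock0 K -> Prop) : (forall b, Q (bas K b)) ->
  (forall a v w, Q v -> Q w -> Q (a *: v + w)) -> forall v, Q v.
Proof.
move=> Qb Ql v; have b0 : fbasis by exact: (onecm _, 0).
have Q0 : Q 0 by rewrite -[0](addNr (bas K b0)) -scaleN1r; apply: Ql.
rewrite (fock0E v); elim: (enum_fset _) => [|b r IH]; first by rewrite big_nil.
by rewrite big_cons basE; apply: Ql.
Qed.

Lemma eq_dg f g : f =1 g -> dg f = dg g.
Proof. by move=> fg; congr dg; apply/funext. Qed.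

Lemma dg0 : dg (fun=> 0 : K) = 0.
Proof. by apply: fend_basis => b; rewrite dgU scale0r. Qed.

Lemma dgZ a f : a *: dg f = dg (fun k => a * f k).
Proof. by apply: fend_basis => b; rewrite endoZE !dgU scalerA. Qed.

Lemma dg_sum I (r : seq I) (F : I -> int -> K) :
  \sum_(i <- r) dg (F i) = dg (fun k => \sum_(i <- r) F i k).
Proof.
apply: fend_basis => b; rewrite endo_sumE dgU scaler_suml.
by apply: eq_bigr => i _; rewrite dgU.
Qed.

Lemma cre_dg j n f : GRing.comm (cre K j n) (dg f).
Proof. by apply: fend_basis => b; rewrite !endoME dgU creU endoZr creU dgU. Qed.

(** Distributions u^(e d) \sum_n P_n(d) (h / u)^n in the charge operator d. *)
Definition dgd e P : fdist int E :=
  fun m n => dg (fun k => if m + n%:Z == e * k then P n k else 0).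

Lemma dgdU e P m n b :
  dgd e P m n (bas K b) = (if m + n%:Z == e * b.2 then P n b.2 else 0) *: bas K b.
Proof. by rewrite /dgd dgU. Qed.

Definition finsup (q : fdist int E) := forall n v, exists r : seq int,
  forall m, m \notin r -> forall j, (j <= n)%N -> q m j v = 0.

Lemma finsup_dgd e P : finsup (dgd e P).
Proof.
move=> n; elim/bas_ind=> [b|a v w [r rv] [r' rw]].
  exists [seq e * b.2 - i%:Z | i <- iota 0 n.+1] => m mr j jn.
  rewrite /dgd dgU; case: eqP => [mj|]; last by rewrite scale0r.
  by case/mapP: mr; exists j; [rewrite mem_iota ltnS|rewrite -mj addrK].
exists (r ++ r') => m; rewrite mem_cat negb_or => /andP[mr mr'] j jn.
by rewrite endoDr endoZr rv // rw // scaler0 addr0.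
Qed.

Lemma finsup_locfin p q : finsup q -> locfin p q.
Proof.
move=> fq m n v; have [r rv] := fq n v; exists [seq m - l | l <- r] => l lr i j _ jn.
rewrite rv ?endo0r //; apply: contra lr => mlr; apply/mapP; exists (m - l) => //.
by rewrite opprB addrCA subrr addr0.
Qed.

Lemma upow_dgd e : upow e = oval (dgd e (fun n _ => (n == 0%N)%:R)).
Proof.
apply/funext => m; apply/funext => n; rewrite /upow /oval /dgd.
case: n => [|n] /=; last by rewrite (_ : dg _ = 0) // -dg0; apply: eq_dg => k; rewrite if_same.
rewrite dg.unlock; congr (lext _); apply/funext => b.
by rewrite addr0 eq_sym; case: eqP; rewrite ?scale1r ?scale0r.
Qed.

Lemma dshift_dgd a e P : dshiftK a (dgd e P) = dgd e (fun n k =>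
  \sum_(j < n.+1) binz K (e * k - n%:Z + j%:Z) j * (a ^+ j * P (n - j)%N k)).
Proof.
apply/funext => m; apply/funext => n; rewrite /dshiftK /dshift /dgd.
under eq_bigr => j _ do rewrite !dgZ.
rewrite dg_sum; apply: eq_dg => k; case: eqP => [mn|mn].
  apply: eq_bigr => j _; rewrite ifT; last by rewrite -mn; have := ltn_ord j; lia.
  by congr (binz K _ j * _); rewrite -mn; lia.
apply: big1 => j _; rewrite ifF ?mulr0 //; apply/negbTE/eqP => mj.
by apply: mn; rewrite -mj; have := ltn_ord j; lia.
Qed.

Lemma upow_shift_dgd a e : exists2 P, osh a (upow e) = oval (dgd e P) &
  forall k, P 0%N k = 1.
Proof.
exists (fun n k => \sum_(j < n.+1) binz K (e * k - n%:Z + j%:Z) j *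
    (a ^+ j * ((n - j)%N == 0%N)%:R)) => [|k].
  by rewrite upow_dgd oval_shift dshift_dgd.
by rewrite big_ord1 binz0 expr0 !mul1r.
Qed.

(** At a basis vector the charge fixes the exponents of both factors. *)
Lemma omul_dgd e e' P P' : omul (oval (dgd e P)) (oval (dgd e' P')) =
  oval (dgd (e + e') (fun n k => \sum_(i < n.+1) P i k * P' (n - i)%N k)).
Proof.
have [t -> tE] := omul_two_sided (finsup_locfin (dgd e P) (finsup_dgd e' P')).
congr oval; apply/funext => m; apply/funext => n; apply: fend_basis => b.
pose r := [seq e * b.2 - i%:Z | i <- iota 0 n.+1].
have ur : uniq r.
  by rewrite map_inj_uniq ?iota_uniq // => i j /addrI/oppr_inj[].
rewrite (tE _ _ _ r ur); last first.
  move=> l lr i j il jl; rewrite /dgd dgU endoZr dgU.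
  have [le|] := eqVneq (l + i%:Z) (e * b.2); last by rewrite scale0r scaler0.
  by case/mapP: lr; exists i; [rewrite mem_iota ltnS|rewrite -le addrK].
transitivity (\sum_(i < n.+1) (if m + n%:Z == (e + e') * b.2
    then P i b.2 * P' (n - i)%N b.2 else 0) *: bas K b); last first.
  rewrite [RHS]dgU -[LHS]scaler_suml.
  apply: (congr1 (fun c : K => c *: bas K b)); case: (_ == _) => //.
  by rewrite big1.
rewrite big_map -(big_mkord predT (fun i => (if m + n%:Z == (e + e') * b.2
    then P i b.2 * P' (n - i)%N b.2 else 0) *: bas K b)) /index_iota subn0.
apply: eq_big_seq => i; rewrite mem_iota /= add0n => ni.
rewrite pserME endo_sumE (bigD1 (Ordinal ni)) // [X in _ + X = _]big1 => [|j ji].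
  rewrite addr0 endoME dgdU endoZr dgdU [LHS]scalerA.
  apply: (congr1 (fun c : K => c *: bas K b)).
  rewrite subrK eqxx mulrC; case: eqP => me; case: eqP => me'; rewrite ?mulr0 //.
    by case: me'; have := ni; move: me; rewrite mulrDl /=; move: (e * _) (e' * _) => x y; lia.
  by case: me; have := ni; move: me'; rewrite mulrDl /=; move: (e * _) (e' * _) => x y; lia.
rewrite endoME dgdU endoZr dgdU [X in _ *: (X *: _)]ifF ?scale0r ?scaler0 //.
apply/negbTE; apply: contraNneq ji => je; apply/eqP/val_inj => /=.
by move: je; lia.
Qed.

Lemma omul_dcst (x : E) (q : fdist int E) :
  omul (dcst (endo_fun x)) (oval q) = oval (fun m n => x * q m n).
Proof.
apply/funext => m; apply/funext => n; apply/funext => v; rewrite /omul /dconv.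
under eq_bigr => i _.
  rewrite (fsumT_seq (r := [:: 0])) //; last first.
    by move=> l; rewrite inE /dcst => /negPf->.
  rewrite big_seq1 subr0 /dcst eqxx /hcst.
  over.
by rewrite big_ord_recl /= subn0 big1 ?addr0.
Qed.

Lemma finsup_mull (x : E) q : finsup q -> finsup (fun m n => x * q m n).
Proof.
move=> fq n v; have [r rv] := fq n v; exists r => m mr j jn.
by rewrite endoME rv // endo0r.
Qed.

Definition bounded_below (q : fdist int E) := forall n v, exists N : nat,
  forall m j, m < - N%:Z -> (j <= n)%N -> q m j v = 0.

Lemma locfin_creation (x : bser E) q : bounded_below q -> locfin (sdist false x) q.
Proof.
move=> fq m n v; have [N Nv] := fq n v.
exists [seq i%:Z | i <- iota 0 (`|m| + N).+1] => l lr i j il jn.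
have [l0|l0] := boolP (sided false l); last by rewrite sdist_out.
rewrite Nv ?endo0r // ltNge; apply: contra lr => mN; apply/mapP; exists `|l|%N.
  by rewrite mem_iota add0n /=; move: l0 mN => /=; lia.
by rewrite gez0_abs.
Qed.

Notation lowering := (lowering (ntV := fock0_neq0 K) (cre K) (hwv K)).

Let kill := lowering_kill (ntV := fock0_neq0 K) (@fock0_ind K).

Lemma lowering_kill_seq y n (W : seq (fock0 K)) : lowering y ->
  exists N : nat, forall w s j, w \in W -> (N <= s)%N -> (j <= n)%N -> y s j w = 0.
Proof.
move=> ly; elim: W => [|w W [N NW]]; first by exists 0%N.
have [N' Nw] := kill n w ly; exists (maxn N N') => w' s j.
rewrite inE geq_max => /orP[/eqP->|wW] /andP[Ns N's] jn; first exact: Nw.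
exact: NW.
Qed.

Lemma bounded_below_annihilation y (q t : fdist int E) : lowering y -> finsup q ->
  (forall m n v r, uniq r -> covers (sdist true y) q m n v r ->
    t m n v = \sum_(l <- r) ((sdist true y l * q (m - l) : pser E) n : E) v) ->
  bounded_below t.
Proof.
move=> ly fq tE n v; have [R Rv] := fq n v.
have [N NW] := lowering_kill_seq n [seq q l j v | l <- R, j <- iota 0 n.+1] ly.
have [B RB] : exists B : nat, forall l, l \in R -> (`|l| <= B)%N.
  elim: (R) => [|l R' [B RB]]; first by exists 0%N.
  exists (maxn `|l| B) => l'; rewrite inE leq_max => /orP[/eqP->|/RB->].
    by rewrite leqnn.
  by rewrite orbT.
(* N bounds the poles of y on the vectors q l j v, and B the exponents l. *)
exists (N + B)%N => m j mN jn; pose r := undup [seq m - l | l <- R].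
rewrite (tE _ _ _ r (undup_uniq _)) => [|l lr i i' ij i'j]; last first.
  rewrite Rv ?endo0r ?(leq_trans i'j) //; apply: contra lr => mlr; rewrite mem_undup.
  by apply/mapP; exists (m - l) => //; rewrite opprB addrCA subrr addr0.
apply: big1_seq => l; rewrite mem_undup => /andP[_ /mapP[l' lR ->]].
rewrite pserME endo_sumE; apply: big1 => i _; rewrite endoME opprB addrCA subrr addr0.
have [sm|sm] := boolP (sided true (m - l')); last by rewrite sdist_out.
rewrite /sdist sm; have ij : (i <= j)%N by rewrite -ltnS.
apply: NW; last exact: leq_trans ij jn.
  by apply: allpairs_f => //; rewrite mem_iota ltnS (leq_trans (leq_subr _ _)).
by move: mN (RB _ lR) sm; rewrite /=; lia.
Qed.

(** The lattice part has finitely many exponents at each vector and order,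
    annihilation leaves exponents bounded below, and creation then sums over
    finitely many. At h = 0 the lattice part has the single exponent e k0, and only
    N annihilation terms survive. *)
Lemma vertex_operator x y (k e : int) P : lowering y ->
  exists t, [/\ omul (oval (sdist false x)) (omul (oval (sdist true y))
      (omul (dcst (eop k)) (oval (dgd e P)))) = oval t,
    forall c : pser E, GRing.comm (hcst c) x -> GRing.comm (hcst c) y ->
      (forall n, GRing.comm (c n) (chg K k)) ->
      (forall n f, GRing.comm (c n) (dg f)) -> forall m, GRing.comm c (t m)
  & forall m v k0 N, (forall f, dg f v = f k0 *: v) ->
      (forall s, (N <= s)%N -> y s 0%N (chg K k v) = 0) -> 0 <= m - e * k0 -> P 0%N k0 = 1 ->
      t m 0%N v = \sum_(s < N) x (`|(m - e * k0)%R| + s)%N 0%N (y s 0%N (chg K k v))].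
Proof.
move=> ly; rewrite eop_chg omul_dcst; pose q1 : fdist int E := fun m n => chg K k * dgd e P m n.
rewrite -/q1.
have fq1 : finsup q1 by exact: finsup_mull (finsup_dgd e P).
have lf1 := finsup_locfin (sdist true y) fq1.
have [q2 -> q2E] := omul_two_sided lf1.
have lf2 := locfin_creation x (bounded_below_annihilation ly fq1 q2E).
have [t tq tE] := omul_two_sided lf2.
exists t; split=> // [c cx cy ck cd|m v k0 N vk Nv mk P1].
  have cq1 l : GRing.comm c (q1 l).
    apply: pser_comm => i j.
    by apply: commrM; [apply: ck|apply: cd].
  have csd s (z : bser E) l : GRing.comm (hcst c) z -> GRing.comm c (sdist s z l).
    by rewrite /sdist => /comm_hcst cz; case: ifP => _ //; apply: commr0.
  apply: (two_sided_comm lf2 tE) => l; first exact: csd.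
  by apply: (two_sided_comm lf1 q2E) => // l'; apply: csd.
have q1v l : q1 l 0%N v = if l == e * k0 then chg K k v else 0.
  rewrite /q1 endoME /dgd addr0 vk endoZr P1.
  by case: eqP => _; rewrite ?scale1r ?scale0r.
have q2v l : q2 l 0%N v = sdist true y (l - e * k0) 0%N (chg K k v).
  rewrite (q2E _ _ _ [:: l - e * k0]) //; last first.
    move=> l'; rewrite inE => l'l [|i] [|j] // _ _; rewrite q1v ifF ?endo0r //.
    by apply/negbTE; apply: contraNneq l'l => <-; rewrite opprB addrCA subrr addr0.
  by rewrite big_seq1 pserME big_ord1 endoME q1v opprB addrCA subrr addr0 eqxx.
pose M := `|(m - e * k0)%R|%N; pose r := [seq (M + s)%N%:Z | s <- iota 0 N].
rewrite (tE _ _ _ r); last 2 first.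
- by rewrite map_inj_uniq ?iota_uniq // => i j []; apply: addnI.
- move=> l lr [|i] [|j] // _ _; rewrite q2v.
  have [l0|l0] := boolP (sided false l); last by rewrite sdist_out.
  have [ml|ml] := boolP (sided true (m - l - e * k0)); last first.
    by rewrite (sdist_out _ _ ml) endo0r.
  rewrite /sdist ml Nv ?endo0r // leqNgt; apply: contra lr => lN; apply/mapP.
  exists `|(m - l - e * k0)%R|%N; first by rewrite mem_iota.
  by move: l0 ml mk; rewrite /M /=; lia.
rewrite big_map -(big_mkord predT (fun s => x (M + s)%N 0%N (y s 0%N (chg K k v)))).
rewrite /index_iota subn0; apply: eq_bigr => s _.
rewrite pserME big_ord1 endoME q2v /sdist /=.
have -> : m - (M + s)%N%:Z - e * k0 = - s%:Z by rewrite /M; lia.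
by rewrite oppr_le0 /= abszN.
Qed.

Lemma annihilation_charge y e P : 
  exists2 t, omul (oval (sdist true y)) (oval (dgd e P)) = oval t &
    forall c : pser E, GRing.comm (hcst c) y ->
      (forall n f, GRing.comm (c n) (dg f)) -> forall m, GRing.comm c (t m).
Proof.
have lf := finsup_locfin (sdist true y) (finsup_dgd e P).
have [t tq tE] := omul_two_sided lf; exists t => // c cy cd m.
apply: (two_sided_comm lf tE) => l.
  by rewrite /sdist; case: ifP => _; [have /comm_hcst := cy; apply|apply: commr0].
by apply: pser_comm => i j; apply: cd.
Qed.

End ChargeOperators.

Section Currents.
Variable K : numFieldType.
Notation E := (fend K).
Notation an := (ann K).
Notation cr := (cre K).

Lemma acre_oval j : @acre K j = oval (sdist false (opser (cr j))).
Proof.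
apply/funext => m; apply/funext => n; rewrite /acre /oval.
have [m0|m0] := ltP 0 m; last first.
  rewrite andbF; apply/funext => v; have [sm|sm] := boolP (sided false m).
    by have -> : m = sg false 0; [move: m0 sm => /=; rewrite /sg; lia|rewrite sdist_sg /opser andbF].
  by rewrite sdist_out.
have [k ->] : exists k : nat, m = sg false k.+1 by exists `|m|.-1%N; rewrite /sg; lia.
rewrite sdist_sg /opser !andbT; case: (n == 0%N); last by [].
apply/funext => v; rewrite endoZE -aop_cre; congr (_ *: aop _ _ _).
Qed.

Lemma aann_oval j : @aann K j = oval (sdist true (opser (an j))).
Proof.
apply/funext => m; apply/funext => n; rewrite /aann /oval.
have [m0|m0] := ltP m 0; last first.
  rewrite andbF; apply/funext => v; have [sm|sm] := boolP (sided true m).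
    by have -> : m = sg true 0; [move: m0 sm => /=; rewrite /sg; lia|rewrite sdist_sg /opser andbF].
  by rewrite sdist_out.
have [k ->] : exists k : nat, m = sg true k.+1 by exists `|m|.-1%N; rewrite /sg; lia.
rewrite sdist_sg /opser !andbT opprK; case: (n == 0%N); last by [].
apply/funext => v; rewrite endoZE -aop_ann; congr (_ *: aop _ _ _).
Qed.

Lemma osh_acre a j : osh a (@acre K j) = oval (sdist false (shop cr j a)).
Proof. by rewrite acre_oval osh_sided. Qed.

Lemma bsh0 (A : algType K) (x : bser A) : bsh false 0 x = x.
Proof.
apply/funext => m; apply/funext => n; rewrite bsh_plusE big_ord_recl expr0 bin0 mulr1.
rewrite scale1r addn0 subn0 big1 ?addr0 // => j _.
by rewrite expr0n mulr0 scale0r.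
Qed.

Lemma acre_shop j : @acre K j = oval (sdist false (shop cr j 0)).
Proof. by rewrite acre_oval /shop bsh0. Qed.

Lemma Eneg_oval : @Eneg K = oval (sdist false (eneg cr)).
Proof.
rewrite /Eneg !osh_acre -ovalN -sdistN -ovalD -sdistD oexp_sided //.
exact: expoE00.
Qed.

Lemma Ecal_oval : @Ecal K = oval (sdist false (ecal cr)).
Proof.
rewrite /Ecal Eneg_oval oev0_sided oinv_sided ?omul_sided //.
exact: eneg0.
Qed.

Lemma Epos_oval : @Epos K = oval (sdist true (epos an)).
Proof.
rewrite /Epos !aann_oval -ovalN -sdistN -ovalD -sdistD osh_sided oexp_sided //.
exact: expoP00.
Qed.

Lemma k1neg_oval : @k1negF K = oval (sdist false (bexp (expok1 cr))).
Proof.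
rewrite /k1negF osh_acre acre_shop -ovalN -sdistN -ovalD -sdistD oexp_sided //.
exact: expok100.
Qed.

Lemma k2neg_oval : @k2negF K = oval (sdist false (bexp (expok2 cr))).
Proof.
rewrite /k2negF osh_acre acre_shop -ovalN -sdistN -ovalD -sdistD oexp_sided //.
exact: expok200.
Qed.

Lemma cann_gen_by r (y : bser E) : gen_by an y -> GRing.comm (hcst (cann an r)) y.
Proof.
move=> gy; apply/comm_hcst => m; apply: pser_comm => i j.
apply/commr_sym/cann_comm => k l; apply/commr_sym.
by move: m j; apply/hcst_hcst_comm; apply: gy => k' l'; apply: annC.
Qed.

Lemma cann_chg r n k : GRing.comm (cann an r n) (chg K k).
Proof. by apply/commr_sym/cann_comm => j m; apply/commr_sym/ann_chg. Qed.

Lemma cann_dg r n f : GRing.comm (cann an r n) (dg f).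
Proof. by apply/commr_sym/cann_comm => j m; apply/commr_sym/ann_dg. Qed.

Lemma lowering_expoP : lowering (cre K) (hwv K) (expoP an).
Proof.
apply/lowering_bsh/loweringD; last apply: loweringN.
all: by apply: lowering_opser; [apply: ann_cre|apply: ann_hwv].
Qed.

Lemma lowering_epos : lowering (cre K) (hwv K) (epos an).
Proof. exact/lowering_bsub/lowering_expoP. Qed.

Lemma upow2_dgd (a b : K) e e' : exists2 P,
  omul (osh a (upow e)) (osh b (upow e')) = oval (dgd (e + e') P) & forall k, P 0%N k = 1.
Proof.
have [P -> P1] := upow_shift_dgd a e; have [P' -> P1'] := upow_shift_dgd b e'.
rewrite omul_dgd; eexists; first by reflexivity.
by move=> k; rewrite [LHS]big_ord1 P1 P1' mulr1.
Qed.

(** All three factors of the vertex operator commute with c_r; the lattice part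
    because c_r preserves the charge. *)
Lemma Xpos_modes : exists t : fdist int E, [/\ @XposF K = oval t,
  forall r m, GRing.comm (cann an r) (t m)
& forall m v (k0 : int) N, (forall f, dg f v = f k0 *: v) ->
    (forall s, (N <= s)%N -> dcoef an s (chg K 1 v) = 0) -> 0 <= m - 2 * k0 ->
    t m 0%N v =
    \sum_(s < N) hcoef cr (`|(m - 2 * k0)%R| + s)%N (dcoef an s (chg K 1 v))].
Proof.
have [P PE P1] : exists2 P : nat -> int -> K, omul (upow 1) (osh 1 (upow 1)) = oval (dgd 2 P) &
    forall k, P 0%N k = 1.
  have [P -> P1] := upow_shift_dgd (1 : K) 1.
  rewrite upow_dgd omul_dgd; eexists; first by reflexivity.
  by move=> k; rewrite [LHS]big_ord1 eqxx mul1r P1.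
have [t [tE tc t0]] := vertex_operator (ecal cr) 1 2 P lowering_epos.
exists t; split.
- by rewrite /XposF Ecal_oval Epos_oval PE.
- move=> r m; apply: tc; first exact: (cann_ecal (@ann_cre K)).
  + exact/cann_gen_by/gen_by_epos.
  + by move=> n; apply: cann_chg.
  + by move=> n f; apply: cann_dg.
- by move=> m v k0 N vk Nv mk; apply: t0.
Qed.

Lemma Xneg_modes : exists2 t : fdist int E, @XnegF K = oval t &
  forall r m, GRing.comm (cann an r) (t m).
Proof.
pose x := binv (bsh false (1 / 2) (ecal cr)).
pose y := binv (bsh true (- (1 / 2)) (epos an)).
have ly : lowering (cre K) (hwv K) y.
  apply: lowering_bsub; apply: loweringD; first exact: lowering1.
  by apply/loweringN/lowering_bsh/lowering_epos.
have [P PE _] := upow2_dgd (- (1 / 2)) (1 / 2) (- 1) (- 1).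
have [t [tE tc _]] := vertex_operator x (- 1) (- 1 + - 1) P ly.
have ecal00 : bsh false (1 / 2) (ecal cr) 0%N 0%N = 1.
  by rewrite bsh00; apply: hcoef0.
have epos00 : bsh true (- (1 / 2)) (epos an) 0%N 0%N = 1.
  by rewrite bsh00; apply: dcoef0.
exists t.
  by rewrite /XnegF Ecal_oval Epos_oval !osh_sided !oinv_sided // PE.
move=> r m; apply: tc.
- by apply: (binv_comm ecal00); apply: bsh_comm; exact: (cann_ecal (@ann_cre K)).
- by apply: (binv_comm epos00); apply: bsh_comm; exact/cann_gen_by/gen_by_epos.
- by move=> n; apply: cann_chg.
- by move=> n f; apply: cann_dg.
Qed.

(** No creation operator occurs, and annihilation operators commute. *)
Lemma kpos_modes j b : exists2 t : fdist int E,
  omul (oexp (- (osh (1 / 2) (@aann K j) - osh (- (1 / 2)) (@aann K j))))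
    (omul (osh (1 / 4) (upow 1)) (osh b (upow (- 1)))) = oval t &
  forall r m, GRing.comm (cann an r) (t m).
Proof.
pose p : bser E := - (bsh true (1 / 2) (opser (an j)) - bsh true (- (1 / 2)) (opser (an j))).
have p0 : p 0%N 0%N = 0 by rewrite /p pserNE pserBE pserNE pserBE !bsh00 subrr oppr0.
have gp : gen_by an p.
  by apply/gen_byN/gen_byD; [|apply: gen_byN]; apply/gen_by_bsh/gen_by_opser.
have [P PE _] := upow2_dgd (1 / 4) b 1 (- 1).
have [t tE tc] := annihilation_charge (bexp p) (1 + - 1) P.
exists t.
  by rewrite aann_oval !osh_sided -!(ovalN, sdistN, ovalD, sdistD) oexp_sided // PE.
move=> r m; apply: tc; last by move=> n f; apply: cann_dg.
by apply/cann_gen_by/gen_by_exp.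
Qed.

End Currents.

(** * Scalar multiplication by power series *)

Section Convolution.
Variables (B1 B2 B3 B12 B23 B : zmodType).
Variables (op1 : B1 -> B23 -> B) (op2 : B2 -> B3 -> B23).
Variables (op3 : B12 -> B3 -> B) (op4 : B1 -> B2 -> B12).

(** Both sides sum over i + j + k = n. *)
Lemma hconv_assoc f g k :
  (forall a I (r : seq I) F, op1 a (\sum_(i <- r) F i) = \sum_(i <- r) op1 a (F i)) ->
  (forall c I (r : seq I) F, op3 (\sum_(i <- r) F i) c = \sum_(i <- r) op3 (F i) c) ->
  (forall a b c, op1 a (op2 b c) = op3 (op4 a b) c) ->
  hconv op1 f (hconv op2 g k) = hconv op3 (hconv op4 f g) k.
Proof.
move=> op1S op3S opA; apply/funext => n; rewrite /hconv.
under eq_bigr do rewrite op1S.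
under [RHS]eq_bigr do rewrite op3S.
pose G i m := op3 (op4 (f i) (g (m - i)%N)) (k (n - m)%N).
have GE (i : nat) : (i <= n)%N ->
    \sum_(m < n.+1 | (i <= m)%N) G i m = \sum_(0 <= j < (n - i).+1) G i (j + i)%N.
  move=> le_in; rewrite -(big_geq_mkord _ _ predT (G i)) -(subSn le_in).
  by rewrite -{1}(add0n i) big_addn.
transitivity (\sum_(i < n.+1) \sum_(m < n.+1 | (i <= m)%N) G i m).
  apply: eq_bigr => i _; rewrite GE; last by rewrite -ltnS.
  by rewrite big_mkord; apply: eq_bigr => j _; rewrite /G addnK (addnC j) subnDA -opA.
rewrite (exchange_big_dep predT) //=; apply: eq_bigr => m _.
rewrite /G (big_ord_widen_cond n.+1 predT
  (fun i => op3 (op4 (f i) (g (m - i)%N)) (k (n - m)%N)) (ltn_ord m)).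
by apply: eq_bigl => i; rewrite ltnS.
Qed.

End Convolution.

Section ScalarSeries.
Variables (K : fieldType) (V : lmodType K).
Implicit Types (c d : pser K) (v w : pser V) (a : K).

Lemma hscaleE c v n : hscale c v n = \sum_(i < n.+1) c i *: v (n - i)%N.
Proof. by []. Qed.

Lemma hscaleA c d v : hscale c (hscale d v) = hscale (c * d) v.
Proof.
apply: hconv_assoc => [a I r F|x I r F|a b x].
- exact: scaler_sumr.
- exact: scaler_suml.
- exact: scalerA.
Qed.

Lemma hscaleDr c v w : hscale c (v + w) = hscale c v + hscale c w.
Proof.
apply/funext => n; rewrite pserDE !hscaleE -big_split /=.
by apply: eq_bigr => i _; rewrite scalerDr.
Qed.

Lemma hscaler0 c : hscale c (0 : pser V) = 0.
Proof. by apply/funext => n; rewrite hscaleE big1 // => i _; rewrite scaler0. Qed.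

Lemma hscale_sumr c I (r : seq I) (F : I -> pser V) :
  hscale c (\sum_(i <- r) F i) = \sum_(i <- r) hscale c (F i).
Proof. exact: (big_morph _ (hscaleDr c) (hscaler0 c)). Qed.

Lemma hscale_cst a v : hscale (hcst a) v = a *: v.
Proof.
apply/funext => n; rewrite hscaleE big_ord_recl subn0 big1 ?addr0 // => i _.
by rewrite hcstE scale0r.
Qed.

Lemma hscale1 v : hscale 1 v = v.
Proof. by rewrite hscale_cst scale1r. Qed.

Lemma hscale_hvar v n : hscale hvar v n = if n is n'.+1 then v n' else 0.
Proof.
rewrite hscaleE; case: n => [|n]; first by rewrite big_ord1 /hvar scale0r.
rewrite !big_ord_recl /= /hvar scale0r add0r scale1r /bump /= subSS subn0 big1 ?addr0 //.
by move=> i _; rewrite scale0r.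
Qed.

Lemma hscale_hvarX N v n :
  iter N (hscale hvar) v n = if (N <= n)%N then v (n - N)%N else 0.
Proof.
elim: N n => [|N IH] n; first by rewrite subn0.
by rewrite iterS hscale_hvar; case: n => [|n] //; rewrite IH subSS.
Qed.

Lemma iter_hvarE N v : iter N (hscale hvar) v = hscale (hvar ^+ N) v.
Proof.
elim: N => [|N IH]; first by rewrite expr0 hscale1.
by rewrite iterS IH hscaleA exprS.
Qed.

Definition hcomb (S : pser V -> Prop) v := exists n (c : 'I_n -> pser K) (w : 'I_n -> pser V),
  (forall i, S (w i)) /\ v = \sum_i hscale (c i) (w i).

Lemma hcombD S v w : hcomb S v -> hcomb S w -> hcomb S (v + w).
Proof.
move=> [n [c [x [Sx ->]]]] [m [d [y [Sy ->]]]].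
exists (n + m)%N, (fun i : 'I_(n + m) => match fintype.split i with inl i => c i | inr i => d i end).
exists (fun i : 'I_(n + m) => match fintype.split i with inl i => x i | inr i => y i end); split.
  by move=> i; case: fintype.split.
rewrite [RHS]big_split_ord; congr (_ + _); apply: eq_bigr => i _.
  by rewrite (unsplitK (inl i : 'I_n + 'I_m)).
by rewrite (unsplitK (inr i : 'I_n + 'I_m)).
Qed.

Lemma hcombZ S c v : hcomb S v -> hcomb S (hscale c v).
Proof.
move=> [n [d [x [Sx ->]]]]; exists n, (fun i => c * d i), x; split=> //.
by rewrite hscale_sumr; apply: eq_bigr => i _; rewrite hscaleA.
Qed.

Lemma hcomb_gen S v : S v -> hcomb S v.
Proof.
move=> Sv; exists 1%N, (fun=> 1), (fun=> v); split=> //.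
by rewrite big_ord1 hscale1.
Qed.

End ScalarSeries.

Lemma hspanE (K : fieldType) (S : set (fock K)) : hspan S = hcomb S.
Proof. by []. Qed.

(** * The classical spanning statement *)

Section ClassicalSpan.
Variable K : numFieldType.
Notation E := (fend K).
Notation an := (ann K).
Notation cr := (cre K).
Notation hw := (hwv K).
Notation H := (hcoef cr).
Notation D := (dcoef an).
Notation i1 := (ord0 : 'I_2).
Notation i2 := (ord_max : 'I_2).

Lemma hcoef_comm (e : E) m : (forall j n, GRing.comm e (cr j n)) -> GRing.comm e (H m).
Proof. by move=> /(gen_by_ecal (K := K))/hcst_hcst_comm; apply. Qed.

Lemma hcoefC m n : GRing.comm (H m) (H n).
Proof.
apply: hcoef_comm => j k; apply/commr_sym/hcoef_comm => i l; exact: creC.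
Qed.

(** By the differential equation of E^+(u), only annihilation operators contribute.
    *)
Lemma dcoef_hwv s k : D s.+1 (hw k) = 0.
Proof.
have [n] := ubnP s; elim: n s => // n IH s sn.
have e : (s.+1%:R *: D s.+1) (hw k) = \sum_(i < s.+2) (alpha_ser an i * D (s.+1 - i)%N) (hw k).
  have := congr1 (fun x : pser E => x s.+1) (peuler_dcoef (@annC K)).
  rewrite pserME => e; rewrite -endo_sumE; exact: (congr1 (fun x : E => x (hw k)) e).
move: e; rewrite endoZE big1 => [/eqP|[[|i] is2] _].
- by rewrite scaler_eq0 => /orP[|/eqP->]; first by rewrite pnatr_eq0.
- by rewrite endoME endo0E.
rewrite endoME [nat_of_ord _]/= subSS; case e : (s - i)%N => [|d].
  by rewrite dcoef0 endo1E endoDE endoNE !ann_hwv subrr.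
rewrite IH ?endo0r //; lia.
Qed.

Lemma dcoef_hcoefE s n : D s * H n =
  \sum_(t < s.+1) c2 K t *: ((if (t <= n)%N then H (n - t)%N else 0) * D (s - t)%N).
Proof. exact: (dcoef_hcoef (@annC K) (@ann_cre K)). Qed.

(* t stands for the modes of X_alpha, of which only the values at h = 0 matter. *)
Variable t : fdist int E.
Hypothesis tX : forall m v (k0 : int) N, (forall f, dg f v = f k0 *: v) ->
    (forall s, (N <= s)%N -> D s (chg K 1 v) = 0) -> 0 <= m - 2 * k0 ->
    t m 0%N v = \sum_(s < N) H (`|(m - 2 * k0)%R| + s)%N (D s (chg K 1 v)).

Let X (m : nat) : E := t m 0%N.

Lemma dg_hword f mu (k : int) : dg f (hword H mu (hw k)) = f k *: hword H mu (hw k).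
Proof.
have : GRing.comm (dg f) (hword H mu).
  apply: commr_prod => m _; apply: hcoef_comm => j n; exact/commr_sym/cre_dg.
by move/(congr1 (fun e : E => e (hw k))); rewrite !endoME dg_hwv endoZr.
Qed.

Lemma chg_hcoef k m : GRing.comm (chg K k) (H m).
Proof. by apply: hcoef_comm => j n; exact/commr_sym/cre_chg. Qed.

(** The lattice part shifts the mode by 2 k on vectors of charge k. *)
Lemma X_hword l mu (k : nat) : X (k.*2 + l) (hword H mu (hw k)) =
  \sum_(s < (sumn mu).+1) H (l + s) (D s (hword H mu (hw k.+1))).
Proof.
have e1 : chg K 1 (hword H mu (hw k)) = hword H mu (hw k.+1).
  rewrite (chg_hword (@chg_hwv K) chg_hcoef).
  apply: (congr1 (fun x => hword H mu (hw x))); lia.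
rewrite /X (tX (k0 := k) (N := (sumn mu).+1)).
- rewrite e1; have -> : `|((k.*2 + l)%N%:Z - 2 * k%:Z)%R|%N = l by lia.
  by [].
- by move=> f; apply: dg_hword.
- move=> s sN; rewrite e1.
  have := D_hword (dcoef0 an) dcoef_hwv dcoef_hcoefE s mu k.+1.
  elim=> // a v w [nu [_ _ _ sm]] _ _; move: sN sm; lia.
- lia.
Qed.

Variable T : fock0 K -> Prop.
Hypothesis T_lin : forall a v w, T v -> T w -> T (a *: v + w).
Hypothesis T_xstate : forall k la, sorted geq la -> T (chg K k (xstate hw X la)).

Lemma T_hword_modes mu k : T (hword H mu (hw k)).
Proof.
exact: (T_hword hcoefC (dcoef0 an) dcoef_hwv
  dcoef_hcoefE X_hword T_lin (@chg_hwv K) chg_hcoef T_xstate).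
Qed.

Let U := lspan (fun v : fock0 K => exists mu k, v = hword H mu (hw k)).

(** Solve hcoef_rec for its last term and use induction on m. *)
Lemma zcr_U m v : U v -> U (zcr cr m v).
Proof.
have HU n w : U w -> U (H n w).
  apply: lspan_map => _ [mu [k ->]]; apply: lspan_gen.
  by exists (n :: mu), k; rewrite hword_cons.
have [n] := ubnP m; elim: n m v => // n IH m v mn Uv.
have e : (m.+1%:R *: H m.+1) v =
    \sum_(i < m.+1) ((cr i2 i - cr i1 i) * H (m.+1 - i.+1)%N) v.
  rewrite -endo_sumE; congr (endo_fun _ v); exact: (hcoef_rec (@creC K) m.+1).
have -> : zcr cr m v = \sum_(i < m) - zcr cr i (H (m - i)%N v) - m.+1%:R *: H m.+1 v.
  move: e; rewrite endoZE big_ord_recr [nat_of_ord _]/= subnn hcoef0 mulr1 => ->.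
  rewrite endoDE endoNE opprD opprB addrA [zcr cr m v]endoDE endoNE addrA.
  rewrite (_ : \sum_(i < m) _ = \sum_(i < m) ((cr i2 i - cr i1 i) * H (m.+1 - i.+1)%N) v).
    by rewrite subrr add0r.
  apply: eq_bigr => i _; rewrite subSS endoME -endoNE /zcr opprB.
  by [].
apply: lspanD.
  apply: lspan_sum => i _; rewrite -scaleN1r; apply: lspanZ; apply: IH.
    by apply: leq_trans (ltn_ord i) _.
  exact: HU.
by rewrite -scaleNr; apply/lspanZ/HU.
Qed.

Lemma zspan_T v : zspan cr hw v -> T v.
Proof.
move=> zv; have Uv : U v.
  elim: zv => [k|a w w' _ Uw _ Uw'|n w _ Uw].
  - by apply: lspan_gen; exists [::], k; rewrite /hword big_nil endo1E.
  - by apply: lspanD => //; apply: lspanZ.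
  - exact: zcr_U.
have T0 : T 0.
  have := T_lin (-1) (T_hword_modes [::] 0) (T_hword_modes [::] 0).
  by rewrite scaleN1r addNr.
elim: Uv => [//|a w w' [mu [k ->]] _ Tw]; apply: T_lin => //.
exact: T_hword_modes.
Qed.

(** It is enough to reach the products of the H_m applied to highest weight vectors:
    they span the zspan of the differences a_1(-r) - a_2(-r). *)
Lemma kernel_T v : (forall n, zan an n v = 0) -> T v.
Proof.
move=> zv; apply: zspan_T.
exact: (kernel_zspan (@creC K) (@ann_cre K) (@ann_hwv K) (@fock0_ind K) zv).
Qed.

End ClassicalSpan.

(** * The submodule as a common kernel *)

Section SeriesOperators.
Variable K : numFieldType.
Notation E := (fend K).
Implicit Types (x y : pser E) (v w : fock K) (c : pser K).

Definition eapp x v : fock K := hconv (fun (e : E) (w : fock0 K) => e w) x v.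

Lemma eappE x v n : eapp x v n = \sum_(i < n.+1) x i (v (n - i)%N).
Proof. by []. Qed.

Lemma oapp_oval t (m : int) v : oapp (oval t m) v = eapp (t m) v.
Proof. by []. Qed.

Lemma eappM x y v : eapp (x * y) v = eapp x (eapp y v).
Proof.
apply/esym/hconv_assoc => [e I r F|w I r F|a b w].
- exact: endo_sumr.
- exact: endo_sumE.
- by rewrite endoME.
Qed.

Lemma eappDl x y v : eapp (x + y) v = eapp x v + eapp y v.
Proof.
apply/funext => n; rewrite pserDE !eappE -big_split; apply: eq_bigr => i _.
exact: endoDE.
Qed.

Lemma eappDr x v w : eapp x (v + w) = eapp x v + eapp x w.
Proof.
apply/funext => n; rewrite pserDE !eappE -big_split; apply: eq_bigr => i _.
by rewrite pserDE endoDr.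
Qed.

Lemma eappNr x v : eapp x (- v) = - eapp x v.
Proof.
apply/funext => n; rewrite pserNE !eappE -sumrN; apply: eq_bigr => i _.
by rewrite pserNE endoNr.
Qed.

Lemma eapp0r x : eapp x 0 = 0.
Proof. by apply/funext => n; rewrite eappE big1 // => i _; rewrite endo0r. Qed.

Lemma eapp0l v : eapp 0 v = 0.
Proof. by apply/funext => n; rewrite eappE big1 // => i _; rewrite endo0E. Qed.

Lemma eapp_hcst (e : E) v n : eapp (hcst e) v n = e (v n).
Proof.
rewrite eappE big_ord_recl subn0 big1 => [|i _]; first by rewrite addr0.
by rewrite hcstE endo0E.
Qed.

Definition scal_series c : pser E := fun n => (c n)%:A.

Lemma eapp_scal c v : eapp (scal_series c) v = hscale c v.
Proof. by apply/funext => n; apply: eq_bigr => i _; rewrite endoZE endo1E. Qed.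

Lemma scal_comm c x : GRing.comm x (scal_series c).
Proof.
apply: pser_comm => m n; rewrite /GRing.comm /scal_series -scalerAr -scalerAl.
by rewrite mulr1 mul1r.
Qed.

Lemma eapp_hscale x c v : eapp x (hscale c v) = hscale c (eapp x v).
Proof. by rewrite -!eapp_scal -!eappM scal_comm. Qed.

End SeriesOperators.

Section Division.
Variables (K : fieldType) (V : lmodType K).
Implicit Types (v w : pser V).

Lemma hscale_hvar_inj : injective (hscale (hvar : pser K) : pser V -> pser V).
Proof.
move=> v w vw; apply/funext => n.
by have := congr1 (fun f : pser V => f n.+1) vw; rewrite !hscale_hvar.
Qed.

Lemma hscale_hdiv v : v 0%N = 0 -> hscale hvar (fun n => v n.+1) = v.
Proof. by move=> v0; apply/funext => n; rewrite hscale_hvar; case: n. Qed.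

(** Iterate the hypothesis: the remainders, which are chosen in M, are divided by
    growing powers of h. *)
Lemma hcompletion_approx (S M : pser V -> Prop) :
  (forall v, M v -> exists s v', [/\ S s, M v' & v = s + hscale hvar v']) ->
  forall v, M v -> hcompletion (hscale hvar) S v.
Proof.
move=> step v Mv; pose T := {v | M v}.
have /choice [f fP] : forall x : T, exists p : pser V * T,
    S p.1 /\ sval x = p.1 + hscale hvar (sval p.2).
  move=> [w Mw]; have [s [v' [Ss Mv' e]]] := step w Mw.
  by exists (s, exist _ v' Mv').
pose X n : T := iter n (fun x => (f x).2) (exist _ v Mv).
exists (fun n => (f (X n)).1) => [n|N]; first by have [] := fP (X n).
exists (sval (X N)); elim: N => [|N IH]; first by rewrite big_ord0 add0r.
rewrite big_ord_recr {1}IH -addrA; congr (_ + _).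
have [_ {1}->] := fP (X N).
by rewrite !iter_hvarE hscaleDr hscaleA -exprSr.
Qed.

End Division.

Section Annihilated.
Variable K : numFieldType.
Notation an := (ann K).
Implicit Types (v w : fock K) (c : pser K).

Definition annihilated v := forall r, eapp (cann an r) v = 0.

Lemma annihilated0 : annihilated 0. Proof. by move=> r; apply: eapp0r. Qed.

Lemma annihilatedD v w : annihilated v -> annihilated w -> annihilated (v + w).
Proof. by move=> Mv Mw r; rewrite eappDr Mv Mw addr0. Qed.

Lemma annihilatedN v : annihilated v -> annihilated (- v).
Proof. by move=> Mv r; rewrite eappNr Mv oppr0. Qed.

Lemma annihilated_hscale c v : annihilated v -> annihilated (hscale c v).
Proof. by move=> Mv r; rewrite eapp_hscale Mv hscaler0. Qed.

Lemma annihilated_eapp x v : (forall r, GRing.comm (cann an r) x) ->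
  annihilated v -> annihilated (eapp x v).
Proof. by move=> xc Mv r; rewrite -eappM xc eappM Mv eapp0r. Qed.

Lemma annihilated_div v : annihilated (hscale hvar v) -> annihilated v.
Proof.
move=> Mv r; apply: hscale_hvar_inj.
by rewrite hscaler0 -eapp_hscale Mv.
Qed.

(** At h = 0 only the term s = r of c_r survives. *)
Lemma cann0 r : cann an r 0%N = zan an r.
Proof.
rewrite /cann pserDE hcstE addrC pser_sumE big_ord_recr /= subnn expr0 mul1r binn scale1r.
rewrite hcstE /= big1 ?add0r // => s _.
rewrite pserZE; have -> : (r - s)%N = (r - s.+1).+1 by have := ltn_ord s; lia.
by rewrite exprS -mulrA mul_hvarE scaler0.
Qed.

Lemma annihilated_lead v : annihilated v -> forall r, zan an r (v 0%N) = 0.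
Proof.
move=> Mv r; have := congr1 (fun w : fock K => w 0%N) (Mv r).
by rewrite eappE big_ord1 cann0.
Qed.

Lemma cann_kill r n (w : fock0 K) : (forall j m, an j m w = 0) -> cann an r n w = 0.
Proof.
move=> aw; rewrite /cann pserDE pser_sumE endoDE endo_sumE hcstE.
rewrite big1 ?addr0; first by case: ifP => _; rewrite ?endo0E.
by move=> s _; rewrite pserZE mulr_hcstE endoZE endoME aw endo0r scaler0.
Qed.

Lemma annihilated_hcst (w : fock0 K) : (forall j m, an j m w = 0) -> annihilated (hcst w).
Proof.
move=> aw r; apply/funext => n; rewrite eappE big1 // => i _.
by rewrite /hcst; case: ifP => _; [apply: cann_kill|apply: endo0r].
Qed.

(** A convergent series is a finite sum modulo each power of h, and c_r commutes
    with h. *)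
Lemma annihilated_completion (S : fock K -> Prop) v : (forall w, S w -> annihilated w) ->
  hcompletion (hscale hvar) S v -> annihilated v.
Proof.
move=> SM [s Ss sv] r; apply/funext => n; have [z ->] := sv n.+1.
rewrite eappDr (_ : eapp _ (\sum_(i < n.+1) _) = 0).
  by rewrite add0r iter_hvarE eapp_hscale -iter_hvarE hscale_hvarX ltnn.
have M : annihilated (\sum_(i < n.+1) iter i (hscale hvar) (s i)); last exact: M.
apply: (big_ind annihilated); [exact: annihilated0|exact: annihilatedD|move=> i _].
by rewrite iter_hvarE; apply/annihilated_hscale/SM.
Qed.

End Annihilated.

Section BasisOfSubmodule.
Variable K : numFieldType.
Notation E := (fend K).
Notation an := (ann K).
Implicit Types (v w : fock K) (la : seq nat) (rs : seq int).

Lemma diff2_rcons rs r s : diff2 (rcons rs r) -> s <= r - 2 -> diff2 (rcons (rcons rs r) s).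
Proof.
case: rs => [|x rs] /=; first by rewrite andbT => -> ->.
by rewrite !rcons_path last_rcons => /andP[-> ->] /= ->.
Qed.

(** The modes x(r_n) ... x(r_1) of the state indexed by a weakly decreasing
    sequence, listed from the largest part: the i-th part l, counted from the smallest,
    gives r = - 2 (i - 1) - l - 1. *)
Fixpoint modes la : seq int :=
  if la is l :: la' then rcons (modes la') (- ((size la').*2 + l)%N%:Z - 1) else [::].

(** The shift by 2 (i - 1) turns a decrease by at least 2 into a weak monotonicity
    of the parts. *)
Lemma diff2_modes la : sorted geq la -> diff2 (modes la).
Proof.
case: la => // l la; elim: la l => [|l' la IH] l; first by rewrite /= andbT; lia.
move=> /= /andP[ll' sla]; apply: diff2_rcons; first exact: IH.
by rewrite doubleS; lia.
Qed.

Lemma eact_eapp k v : eact k v = eapp (hcst (chg K k)) v.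
Proof. by apply/funext => n; rewrite eapp_hcst /eact eop_chg. Qed.

Definition lattice_basis : set (fock K) :=
  [set v | exists k, exists2 b, BW0 b & v = eact k b].

Lemma vacE : @vac K = hcst (hwv K 0).
Proof. by rewrite /hwv -basE. Qed.

Lemma annihilated_vac : annihilated (@vac K).
Proof. by rewrite vacE; apply: annihilated_hcst => j m; apply: ann_hwv. Qed.

Section WithModes.
Variable t : fdist int E.
Hypothesis tE : @XposF K = oval t.
Hypothesis tc : forall r m, GRing.comm (cann an r) (t m).
Hypothesis tX : forall m (v : fock0 K) (k0 : int) N, (forall f : int -> K, dg f v = f k0 *: v) ->
    (forall s, (N <= s)%N -> dcoef an s (chg K 1 v) = 0) -> 0 <= m - 2 * k0 ->
    t m 0%N v =
    \sum_(s < N) hcoef (cre K) (`|(m - 2 * k0)%R| + s)%N (dcoef an s (chg K 1 v)).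

Lemma xop_eapp r v : xop r v = eapp (t (- r - 1)) v.
Proof. by rewrite /xop tE. Qed.

Lemma annihilated_lattice_basis v : lattice_basis v -> annihilated v.
Proof.
move=> [k [_ [rs _ ->] ->]]; rewrite eact_eapp.
apply: annihilated_eapp => [r|].
  apply/commr_sym/comm_hcst => n; apply/commr_sym; exact: cann_chg.
have: annihilated (@vac K) := annihilated_vac.
elim: rs (@vac K) => //= r rs IH w Mw; apply: IH; rewrite xop_eapp.
by apply: annihilated_eapp => // s; apply: tc.
Qed.

Lemma annihilated_hspan v : hspan lattice_basis v -> annihilated v.
Proof.
move=> [n [c [w [Sw ->]]]].
apply: (big_ind (@annihilated K)); [exact: annihilated0|exact: annihilatedD|move=> i _].
by apply/annihilated_hscale/annihilated_lattice_basis.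
Qed.

Lemma foldl_modes la :
  foldl (fun w r => xop r w) (@vac K) (modes la) 0%N = xstate (hwv K) (fun m => t m%:Z 0%N) la.
Proof.
elim: la => [|l la IH]; first by rewrite vacE.
rewrite [modes _]/= foldl_rcons xop_eapp eappE big_ord1 subnn IH opprB opprK.
by rewrite (addrC 1) addrK.
Qed.

Lemma xstate_lattice k la : sorted geq la ->
  exists2 s, hspan lattice_basis s & s 0%N = chg K k (xstate (hwv K) (fun m => t m%:Z 0%N) la).
Proof.
move=> sla; set b := foldl (fun w r => xop r w) (@vac K) (modes la).
exists (eact k b); last by rewrite eact_eapp eapp_hcst /b foldl_modes.
rewrite hspanE; apply: hcomb_gen; exists k, b => //.
by exists (modes la) => //; apply: diff2_modes.
Qed.

(** The leading coefficient of v is reached by the classical spanning statement, and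
    the difference, which stays in the kernel, is divisible by h. *)
Lemma annihilated_approx v : annihilated v -> exists s v',
  [/\ hspan lattice_basis s, annihilated v' & v = s + hscale hvar v'].
Proof.
move=> Mv.
have [s Ss s0] : exists2 s, hspan lattice_basis s & s 0%N = v 0%N.
  pose T (w : fock0 K) := exists2 s : fock K, hspan lattice_basis s & s 0%N = w.
  have T_lin a (w w' : fock0 K) : T w -> T w' -> T (a *: w + w').
    move=> [s Ss <-] [s' Ss' <-]; exists (hscale (hcst a) s + s').
      by rewrite hspanE; apply: hcombD => //; apply: hcombZ.
    by rewrite pserDE hscale_cst.
  exact: (kernel_T tX T_lin xstate_lattice (annihilated_lead Mv)).
have d0 : (v - s) 0%N = 0 by rewrite pserBE s0 subrr.
exists s, (fun n => (v - s) n.+1); split => //; last first.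
  by rewrite (hscale_hdiv d0) addrC subrK.
apply: annihilated_div; rewrite (hscale_hdiv d0).
by apply: annihilatedD => //; apply/annihilatedN/annihilated_hspan.
Qed.

Lemma annihilated_L0 v : L0 K v <-> annihilated v.
Proof.
split; first by apply: annihilated_completion; apply: annihilated_hspan.
exact: (hcompletion_approx annihilated_approx).
Qed.

End WithModes.

Lemma L0E v : L0 K v <-> annihilated v.
Proof. by have [t [tE tc tX]] := Xpos_modes K; apply: (annihilated_L0 tE tc tX). Qed.

End BasisOfSubmodule.

(** The scalars are central in the algebra of a noncommutative monoid too. *)
Section MonoidAlgebra.
Variables (K : comNzRingType) (M : monomType).
Implicit Types (g k : {malg K[M]}).

Fact malg_scaleAr (a : K) g k : a *: (g * k) = g * (a *: k).
Proof.
have -> : a *: k = a%:MP * k by rewrite mul_malgC.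
rewrite mulrA; have -> : g * a%:MP = a *: g; last by rewrite scalerAl.
rewrite malgM_def malgZ_def fgmulgU /fgscale.
by apply: eq_bigr => m _; rewrite mulm1 mulrC.
Qed.

End MonoidAlgebra.

HB.instance Definition _ (K : fieldType) := GRing.Lalgebra.copy (freeAlg K) {malg K[{fmonom gen}]}.
HB.instance Definition _ (K : fieldType) :=
  GRing.Lalgebra_isAlgebra.Build K (freeAlg K) (@malg_scaleAr K _).


Section OneSidedFree.
Variable K : numFieldType.
Notation A := (freeAlg K).
Implicit Types (x y : bser A) (s : bool).

Lemma dmul_sided s x y : dmul (sdist s x) (sdist s y) = sdist s (x * y).
Proof.
apply/funext => m; apply/funext => n; rewrite /dmul dconv_sided.
- rewrite /sdist; case: ifP => // _; rewrite bserME exchange_big.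
  by apply: eq_bigr => i _; apply: eq_bigr.
- exact: mul0r.
- by move=> i j; apply: mulr0.
Qed.

Lemma sdistB s x y : sdist s (x - y) = sdist s x - sdist s y :> fdist int A.
Proof.
apply/funext => m; apply/funext => n; rewrite -[RHS]/(sdist s x m n - sdist s y m n).
by rewrite /sdist; case: ifP => // _; rewrite subr0.
Qed.

Lemma dcst1_sided s : dcst (1 : A) = sdist s (1 : bser A).
Proof.
apply/funext => m; apply/funext => n; rewrite /dcst /sdist.
have -> i : (1 : bser A) i = (i == 0%N)%:R by apply: pser1E.
have [->|m0] := eqVneq m 0; last by rewrite absz_eq0 (negPf m0); case: ifP.
by rewrite /sided lexx if_same eqxx mulr1n pser1E /hcst; case: eqP.
Qed.

Lemma dinv_sided s x : x 0%N 0%N = 1 -> dinv (sdist s x) = sdist s (binv x).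
Proof.
move=> x0; have p0 : (1 - x) 0%N 0%N = 0 by rewrite !pserBE x0 !pser1E subrr.
have pw k : iter k (dmul (dcst (1 : A) - sdist s x)) (dcst 1) = sdist s ((1 - x) ^+ k).
  elim: k => [|k IH]; first by rewrite expr0 -dcst1_sided.
  by rewrite iterS IH (dcst1_sided s) -sdistB dmul_sided exprS.
apply/funext => m; apply/funext => n; rewrite /dinv.
rewrite (fsumT_nat (N := (`|m| + n).+1)) => [|k mnk]; last first.
  by rewrite pw /sdist; case: ifP => _; rewrite ?bserX_small.
rewrite /sdist; case: ifP => sm; last first.
  by rewrite big1 // => k _; rewrite pw /sdist sm.
by rewrite [RHS]/binv /bsub; apply: eq_bigr => k _; rewrite pw /sdist sm scale1r.
Qed.

Definition tbser s i j : bser A := fun m => tser K s i j (sg s m).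

Lemma tser_sided s i j : tser K s i j = sdist s (tbser s i j).
Proof.
apply/funext => m; apply/funext => n; rewrite /sdist.
case: ifPn => sm; first by rewrite /tbser sgK.
have m0 : (m == 0) = false by apply/negP => /eqP m0; move: sm; rewrite m0 /sided lexx if_same.
rewrite /tser m0; case: (n == 0%N); first by [].
case: (n == 1%N); last by [].
by case: s sm => /= sm; case: ifP => //; move: sm; lia.
Qed.

Lemma tbser0 s i j : tbser s i j 0%N 0%N = (i == j)%:R.
Proof.
rewrite /tbser /tser; have -> : sg s 0 = 0 by case: (s).
by rewrite eqxx; case: (i == j).
Qed.

Notation i1 := (ord0 : 'I_2).
Notation i2 := (ord_max : 'I_2).

Definition k1b s : bser A := tbser s i1 i1.
Definition k2b s : bser A :=
  tbser s i2 i2 - tbser s i2 i1 * (binv (tbser s i1 i1) * tbser s i1 i2).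

Lemma k1_sided s : k1 K s = sdist s (k1b s). Proof. exact: tser_sided. Qed.

Lemma k2_sided s : k2 K s = sdist s (k2b s).
Proof.
have t11 : tbser s i1 i1 0%N 0%N = 1 by rewrite tbser0.
by rewrite /k2 !tser_sided dinv_sided // !dmul_sided -sdistB.
Qed.

Definition k1h s : bser A := bsh s (1 / 2) (k1b s).
Definition k2h s : bser A := bsh s (1 / 2) (k2b s).

Lemma k1h0 s : k1h s 0%N 0%N = 1.
Proof. by rewrite /k1h bsh00 /k1b tbser0. Qed.

(** All factors of H^s live on the same side, so the current is computed in the ring
    of one-sided series. *)
Lemma Hcur_sided s : Hcur K s = sdist s (k2h s * binv (k1h s)).
Proof.
rewrite /Hcur k1_sided k2_sided !dshift_sided -dmul_sided; congr dmul.
exact: (dinv_sided s (k1h0 s)).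
Qed.

End OneSidedFree.

(** * The level one action *)

Section QuotientCommutator.
Variables (K : numFieldType) (B : algType K).

(** The factor f acquired by a is cancelled by the factor - f acquired by the
    inverse of b. *)
Lemma ad_quotient (c a b b' f : B) : b * b' = 1 -> b' * b = 1 ->
  GRing.comm f a -> GRing.comm f b' -> ad c a = f * a -> ad c b = f * b ->
  ad c (a * b') = 0.
Proof.
move=> bb' b'b fa fb' ca cb; rewrite adM ca.
have cb' : ad c b' = - (f * b').
  rewrite -[LHS]mul1r -b'b -mulrA; have : b * ad c b' = - (ad c b * b').
    by apply/eqP; rewrite -addr_eq0 addrC -adM bb' ad1.
  by move=> ->; rewrite cb -(mulrA f) bb' mulr1 mulrN -fb'.
by rewrite cb' mulrN (mulrA a f) -fa -(mulrA f) subrr.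
Qed.

End QuotientCommutator.

Section SeriesEndomorphisms.
Variable K : numFieldType.
Notation E := (fend K).

Lemma fock_neq0 : exists v : pser (fock0 K), v != 0.
Proof.
have [v v0] := fock0_neq0 K; exists (fun=> v); apply: contraNneq v0 => e.
by rewrite -[v]/((fun=> v : fock0 K) 0%N) e.
Qed.

Notation F := (endo fock_neq0).
Implicit Types (x y : pser E) (v w : fock K).

Fact seapp_lin x : linear (eapp x : pser (fock0 K) -> pser (fock0 K)).
Proof. by move=> a v w; rewrite eappDr -!hscale_cst eapp_hscale. Qed.
Definition seapp x : F := mkendo fock_neq0 (seapp_lin x).

Lemma seappE x v : seapp x v = eapp x v. Proof. by []. Qed.

Lemma seappM x y : seapp (x * y) = seapp x * seapp y.
Proof. by apply: endoP => v; rewrite endoME !seappE eappM. Qed.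

Lemma seappD x y : seapp (x + y) = seapp x + seapp y.
Proof. by apply: endoP => v; rewrite endoDE !seappE eappDl. Qed.

Lemma seapp0 : seapp 0 = 0.
Proof. by apply: endoP => v; rewrite endo0E seappE eapp0l. Qed.

Lemma seapp1 : seapp 1 = 1.
Proof. by apply: endoP => v; apply/funext => n; rewrite endo1E seappE eapp_hcst endo1E. Qed.

Lemma seappN x : seapp (- x) = - seapp x.
Proof. by apply/eqP; rewrite -addr_eq0 -seappD addNr seapp0. Qed.

Lemma seappZ a x : seapp (a *: x) = a *: seapp x.
Proof.
apply: endoP => v; rewrite endoZE !seappE; apply/funext => n.
by rewrite pserZE !eappE scaler_sumr; apply: eq_bigr => i _; rewrite pserZE endoZE.
Qed.

Lemma seapp_sum I (r : seq I) (P : pred I) (f : I -> pser E) :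
  seapp (\sum_(i <- r | P i) f i) = \sum_(i <- r | P i) seapp (f i).
Proof. exact: (big_morph _ seappD seapp0). Qed.

Lemma seapp_hvar v : seapp hvar v = hscale hvar v.
Proof.
rewrite seappE -eapp_scal; congr (eapp _ v); apply/funext => n.
by rewrite /scal_series /hvar; case: eqP; rewrite ?scale1r ?scale0r.
Qed.

Definition eqv N (e e' : F) := forall v n, (n < N)%N -> e v n = e' v n.

Lemma eqvP e e' : (forall N, eqv N e e') -> e = e'.
Proof. by move=> ee; apply: endoP => v; apply/funext => n; apply: (ee n.+1). Qed.

(** A power series of operators does not lower the order in h. *)
Lemma eqv_ad N x e e' : eqv N e e' -> eqv N (ad (seapp x) e) (ad (seapp x) e').
Proof.
move=> ee v n nN; rewrite /ad !endoDE !endoNE !endoME !pserDE !pserNE !seappE.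
congr (_ - _); last exact: ee.
rewrite !eappE; apply: eq_bigr => i _; congr (x i _); apply: ee.
exact: leq_ltn_trans (leq_subr _ _) nN.
Qed.

End SeriesEndomorphisms.

Section ShiftModulo.
Variables (K : numFieldType) (B : algType K).

Lemma dshift_mod N a (p : fdist int B) m : eqh N (dshiftK a p m)
  (\sum_(j < N) (binz K (m + j%:Z) j * a ^+ j) *: (hvar ^+ j * p (m + j%:Z))).
Proof.
move=> n nN; rewrite /dshiftK /dshift [RHS]pser_sumE.
rewrite (big_ord_widen N (fun j => binz K (m + j%:Z) j *:
  (a ^+ j *: p (m + j%:Z) (n - j)%N)) nN) big_mkcond /=.
apply: eq_bigr => j _; rewrite pserZE mul_hvarXE ltnS.
by case: leqP => _; rewrite ?scaler0 ?scalerA.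
Qed.

End ShiftModulo.

Lemma ad_scale_mul (K : numFieldType) (B : algType K) (c h x : B) (k : K) :
  GRing.comm c h -> ad c (k *: (h * x)) = k *: (h * ad c x).
Proof. by move=> ch; rewrite adZ adM (ad_comm ch) mul0r add0r. Qed.

Section LevelOneAction.
Variables (K : numFieldType) (rho : DYgl2_module K).
Notation A := (freeAlg K).
Notation E := (fend K).
Notation F := (endo (fock_neq0 K)).
Implicit Types (x y : pser A) (v w : fock K) (c : pser K).

Definition const_series c : pser A := fun n => (c n)%:A.

Lemma const_series_comm c x : GRing.comm (const_series c) x.
Proof.
apply: pser_comm => m n; rewrite /GRing.comm /const_series -scalerAr -scalerAl.
by rewrite mulr1 mul1r.
Qed.

Lemma toDY_mul x y : toDY (x * y) = (toDY x * toDY y)%R.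
Proof. exact: toDYM. Qed.

(** The scalar series are central in the completed free algebra. *)
Lemma DYact_hscale x c v :
  DYact rho (toDY x) (hscale c v) = hscale c (DYact rho (toDY x) v).
Proof.
have e : (toDY x * DYscal c = DYscal c * toDY x)%R.
  apply: etrans (esym (toDY_mul x (const_series c))) _.
  apply: etrans (toDY_mul (const_series c) x); apply: (congr1 (@toDY K)).
  exact/esym/const_series_comm.
by rewrite -!(DYact_scal rho) -!DYact_mul e.
Qed.

Fact act_lin x : linear (DYact rho (toDY x) : pser (fock0 K) -> pser (fock0 K)).
Proof. by move=> a v w; rewrite DYact_addr -!hscale_cst DYact_hscale. Qed.
Definition act x : F := mkendo (fock_neq0 K) (act_lin x).

Lemma actE x v : act x v = DYact rho (toDY x) v. Proof. by []. Qed.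

Lemma actM x y : act (x * y) = act x * act y.
Proof. by apply: endoP => v; rewrite endoME !actE toDYM DYact_mul. Qed.

Lemma actD x y : act (x + y) = act x + act y.
Proof. by apply: endoP => v; rewrite endoDE !actE toDYD DYact_addl. Qed.

Lemma act0 : act 0 = 0.
Proof. by apply: (addrI (act 0)); rewrite -actD !addr0. Qed.

Lemma actN x : act (- x) = - act x.
Proof. by apply/eqP; rewrite -addr_eq0 -actD addNr act0. Qed.

Lemma act_const c v : act (const_series c) v = hscale c v.
Proof. exact: DYact_scal. Qed.

Lemma actZ a x : act (a *: x) = a *: act x.
Proof.
have -> : a *: x = const_series (hcst a) * x.
  have -> : const_series (hcst a) = hcst a%:A.
    by apply/funext => n; rewrite /const_series !hcstE; case: eqP; rewrite ?scale0r.
  by apply/funext => n; rewrite mul_hcstE pserZE -scalerAl mul1r.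
by rewrite actM; apply: endoP => v; rewrite endoME endoZE act_const hscale_cst.
Qed.

Lemma act_sum I (r : seq I) (P : pred I) (f : I -> pser A) :
  act (\sum_(i <- r | P i) f i) = \sum_(i <- r | P i) act (f i).
Proof. exact: (big_morph _ actD act0). Qed.

Lemma act1 : act 1 = 1.
Proof.
apply: endoP => v; rewrite endo1E -[RHS]hscale1 -act_const; congr (act _ v).
by apply/funext => n; rewrite /const_series !pser1E; case: eqP; rewrite ?scale1r ?scale0r.
Qed.

Lemma act_hvar : act hvar = seapp hvar.
Proof.
apply: endoP => v; rewrite seapp_hvar -act_const; congr (act _ v).
by apply/funext => n; rewrite /const_series /hvar; case: eqP; rewrite ?scale1r ?scale0r.
Qed.

(** The difference is a multiple of h^N in the completed free algebra, and h acts as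
    h. *)
Lemma act_eqh N x y : eqh N x y -> eqv N (act x) (act y).
Proof.
move=> xy v n nN; pose z : pser A := fun m => (x - y) (m + N)%N.
have -> : x = hvar ^+ N * z + y.
  apply/funext => m; rewrite pserDE mul_hvarXE; case: leqP => Nm.
    by rewrite /z subnK // pserBE subrK.
  by rewrite xy // add0r.
rewrite actD endoDE pserDE actM endoME; suff -> w : act (hvar ^+ N) w n = 0 by rewrite add0r.
have -> : act (hvar ^+ N) w = iter N (hscale hvar) w.
  elim: N {nN z xy} => [|N IH]; first by rewrite expr0 act1 endo1E.
  by rewrite exprS actM endoME IH act_hvar seapp_hvar.
by rewrite hscale_hvarX leqNgt nN.
Qed.

(** Modulo each power of h the substitution u -> u + a h is a finite combination of
    multiples of powers of h, and z commutes with h. *)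
Lemma ad_shift (z : pser E) a (p q : fdist int A) :
  (forall m, ad (seapp z) (act (p m)) = act (q m)) ->
  forall m, ad (seapp z) (act (dshiftK a p m)) = act (dshiftK a q m).
Proof.
move=> pq m; apply: eqvP => N v n nN.
rewrite (eqv_ad z (act_eqh (dshift_mod a p m)) v nN) (act_eqh (dshift_mod a q m) v nN).
apply: (congr1 (fun e : F => e v n)).
have adS : ad (seapp z) (act (\sum_(j < N) (binz K (m + j%:Z) j * a ^+ j) *:
    (hvar ^+ j * p (m + j%:Z)))) = \sum_(j < N) ad (seapp z) (act
    ((binz K (m + j%:Z) j * a ^+ j) *: (hvar ^+ j * p (m + j%:Z)))).
  rewrite act_sum; apply: (big_morph (ad (seapp z)) (adD _)); exact: ad_comm (commr0 _).
apply: etrans adS _; rewrite act_sum; apply: eq_bigr => j _.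
have hz : GRing.comm (seapp z) (act (hvar ^+ j)).
  elim: (j : nat) => [|i IH]; first by rewrite expr0 act1; apply: commr1.
  rewrite exprS actM; apply: commrM => //; rewrite act_hvar /GRing.comm -!seappM.
  by rewrite hvar_comm.
set k := _ * _.
have e (r : fdist int A) : act (k *: (hvar ^+ j * r (m + j%:Z))) =
    k *: (act (hvar ^+ j) * act (r (m + j%:Z))).
  by apply: etrans (actZ _ _) _; apply: congr1; apply: actM.
apply: etrans (congr1 (ad _) (e p)) _; apply: etrans (ad_scale_mul _ _ hz) _.
apply: etrans _ (esym (e q)).
by apply: (congr1 (fun y : F => k *: (act (hvar ^+ j) * y))); apply: pq.
Qed.

End LevelOneAction.

Section CentralFactor.
Variables (K : numFieldType) (B : algType K).

Definition uh_factor (a b : K) r : bser B :=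
  (bu B + a *: bh B) ^+ r - (bu B + b *: bh B) ^+ r.

Lemma uh_factor_central a b r : central (uh_factor a b r).
Proof.
exact: (@centralD K (bser B) _ _ (central_uh a r)
  (@centralN K (bser B) _ (central_uh b r))).
Qed.

Lemma bsh_uh_factor a r (x : bser B) :
  bsh false a (uh_factor 1 0 r * x) = uh_factor (a + 1) (a + 0) r * bsh false a x.
Proof.
apply: etrans (congr1 (bsh false a) (mulrBl x _ _)) _; apply: etrans (bshB _ _ _ _) _.
apply: etrans _ (esym (mulrBl _ _ _)).
exact: (f_equal2 (fun y z : bser B => y - z) (bsh_mulX _ _ _ _) (bsh_mulX _ _ _ _)).
Qed.

Lemma bsh_zero s a : bsh s a (0 : bser B) = 0.
Proof.
apply/funext => m; apply/funext => n; rewrite /bsh big1 // => j _.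
by case: s; [case: ifP => _|]; rewrite scaler0.
Qed.

End CentralFactor.
Arguments uh_factor {K} B a b r.

Section CurrentsPreserve.
Variables (K : numFieldType) (rho : DYgl2_module K) (lev : level_one rho).
Notation A := (freeAlg K).
Notation E := (fend K).
Notation F := (endo (fock_neq0 K)).
Notation an := (ann K).
Notation act := (act rho).
Notation i1 := (ord0 : 'I_2).
Notation i2 := (ord_max : 'I_2).

Definition capp r : F := seapp (cann an r).

Lemma seapp_ad (x y : pser E) : seapp (ad x y) = ad (seapp x) (seapp y).
Proof. by rewrite /ad seappD seappN !seappM. Qed.

(** A dictionary between the free algebra and operators on the Fock space, through
    which the factors (u + h)^r - u^r are moved from the latter to the former. *)
Definition same_action (x : bser A) (y : bser E) := forall m, act (x m) = seapp (y m).

Lemma same_actionM x x' y y' :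
  same_action x y -> same_action x' y' -> same_action (x * x') (y * y').
Proof.
move=> xy xy' m; apply: etrans (congr1 act (pserME x x' m)) _.
apply: etrans (act_sum _ _ _ _) _; apply: etrans _ (congr1 (@seapp K) (esym (pserME y y' m))).
apply: etrans _ (esym (seapp_sum _ _ _)); apply: eq_bigr => i _.
apply: etrans (actM _ _ _) _; apply: etrans _ (esym (seappM _ _)).
by rewrite xy xy'.
Qed.

Lemma same_actionD x x' y y' :
  same_action x y -> same_action x' y' -> same_action (x + x') (y + y').
Proof.
move=> xy xy' m; apply: etrans (actD _ _ _) _; apply: etrans _ (esym (seappD _ _)).
by rewrite xy xy'.
Qed.

Lemma same_actionN x y : same_action x y -> same_action (- x) (- y).
Proof.
move=> xy m; apply: etrans (actN _ _) _; apply: etrans _ (esym (seappN _)).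
by rewrite xy.
Qed.

Lemma same_actionZ a x y : same_action x y -> same_action (a *: x) (a *: y).
Proof.
move=> xy m; apply: etrans (actZ _ _ _) _; apply: etrans _ (esym (seappZ _ _)).
by rewrite xy.
Qed.

Lemma same_action1 : same_action 1 1.
Proof.
move=> m; apply: etrans (congr1 act (pser1E _ m)) _.
apply: etrans _ (congr1 (@seapp K) (esym (pser1E _ m))).
by case: (m == 0%N); rewrite ?act1 ?seapp1 ?act0 ?seapp0.
Qed.

Lemma same_actionX n x y : same_action x y -> same_action (x ^+ n) (y ^+ n).
Proof.
move=> xy; elim: n => [|n IH]; first by rewrite !expr0; exact: same_action1.
by rewrite !exprS; exact: same_actionM.
Qed.

Lemma same_action_bu : same_action (bu A) (bu E).
Proof.
move=> m; rewrite /bu /hvar.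
by case: (m == 1%N); rewrite ?act1 ?seapp1 ?act0 ?seapp0.
Qed.

Lemma same_action_bh : same_action (bh A) (bh E).
Proof.
move=> m; rewrite /bh /hcst.
by case: (m == 0%N); rewrite ?act_hvar ?act0 ?seapp0.
Qed.

Lemma same_action_uh a b r : same_action (uh_factor A a b r) (uh_factor E a b r).
Proof.
apply: same_actionD; last apply: same_actionN.
all: apply: same_actionX; apply: same_actionD; first exact: same_action_bu.
all: by apply: same_actionZ; apply: same_action_bh.
Qed.

(** The factor by which k_j^s(u + a h) commutes with the r-th annihilation
    operator; it does not depend on j. *)
Definition factor s a r : bser A := if s then 0 else uh_factor A (a + 1) (a + 0) r.+1.

Lemma factor_central s a r : central (factor s a r).
Proof.
rewrite /factor; case: s; last exact: uh_factor_central.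
move=> x; exact: etrans (mul0r x) (esym (mulr0 x)).
Qed.

(** The commutator is known for the operator y; its factor is a polynomial in u and
    h, which acts in the same way on both sides. *)
Lemma ad_same_action r x y : same_action x y ->
  ad (hcst (cann an r)) y = uh_factor E 1 0 r.+1 * y ->
  forall m, ad (capp r) (act (x m)) = act ((uh_factor A 1 0 r.+1 * x) m).
Proof.
move=> xy yc m.
apply: etrans _ (esym (same_actionM (same_action_uh 1 0 r.+1) xy m)).
rewrite -yc xy -seapp_ad /ad pserDE pserNE.
by rewrite mul_hcstE mulr_hcstE.
Qed.

Lemma bsh_factor s a r x : bsh s a (factor s 0 r * x) = factor s a r * bsh s a x.
Proof.
rewrite /factor; case: s.
  apply: etrans (congr1 (bsh true a) (mul0r x)) _; apply: etrans (bsh_zero _ _ _) _.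
  exact: esym (mul0r _).
have e1 : 0 + 1 = 1 :> K := add0r 1.
have e0 : 0 + 0 = 0 :> K := add0r 0.
by rewrite e1 e0; apply: bsh_uh_factor.
Qed.

Definition scaled_by s a r x :=
  forall m, ad (capp r) (act (x m)) = act ((factor s a r * x) m).

Lemma scaled_by_pos r x : (forall m, exists2 y, act (x m) = seapp y & GRing.comm (cann an r) y) ->
  scaled_by true 0 r x.
Proof.
move=> xP m; have [y -> cy] := xP m; rewrite -seapp_ad ad_comm // seapp0.
by apply: etrans (esym (act0 rho)) _; apply: congr1; rewrite mul0r.
Qed.

Lemma scaled_by_neg r x y : same_action x y ->
  ad (hcst (cann an r)) y = uh_factor E 1 0 r.+1 * y -> scaled_by false 0 r x.
Proof.
move=> xy yc m; rewrite (ad_same_action xy yc) /factor.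
have e1 : 0 + 1 = 1 :> K := add0r 1.
have e0 : 0 + 0 = 0 :> K := add0r 0.
by rewrite e1 e0.
Qed.

(** Both k_1 and k_2 occur in H at u + h/2; the substitution shifts the factor as
    well. *)
Lemma scaled_by_bsh s a r x : scaled_by s 0 r x -> scaled_by s a r (bsh s a x).
Proof.
move=> xc m.
have c0 : ad (capp r) 0 = 0 by apply: ad_comm; apply: commr0.
have e l : ad (capp r) (act (sdist s x l)) = act (sdist s (factor s 0 r * x) l).
  by rewrite /sdist; case: ifP => _; [apply: xc|rewrite act0].
have sh (z : bser A) : dshiftK a (sdist s z) (sg s m) = bsh s a z m.
  apply: etrans (congr1 (fun d => d (sg s m)) (dshift_sided s a z)) _; exact: sdist_sg.
apply: etrans (congr1 (fun z => ad (capp r) (act z)) (esym (sh x))) _.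
apply: etrans (ad_shift a e (sg s m)) _; apply: (congr1 act).
apply: etrans (sh _) _; apply: (congr1 (fun z : bser A => z m)); exact: bsh_factor.
Qed.

Lemma k1b_scaled s r : scaled_by s 0 r (k1b K s).
Proof.
case: s.
  apply: scaled_by_pos => m; have [t tE tc] := @kpos_modes K i1 (5 / 4).
  exists (t (sg true m)); last exact: tc.
  apply: endoP => v; rewrite actE seappE -(sdist_sg true) -k1_sided (lev1_k1pos lev).
  by rewrite -oapp_oval -tE.
apply: (@scaled_by_neg r _ (bexp (expok1 (cre K)))); last exact: (cann_k1 (@ann_cre K)).
move=> m; apply: endoP => v.
rewrite actE seappE -(sdist_sg false) -k1_sided (lev1_k1neg lev) k1neg_oval.
by rewrite oapp_oval sdist_sg.
Qed.

Lemma k2b_scaled s r : scaled_by s 0 r (k2b K s).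
Proof.
case: s.
  apply: scaled_by_pos => m; have [t tE tc] := @kpos_modes K i2 (- (3 / 4)).
  exists (t (sg true m)); last exact: tc.
  apply: endoP => v; rewrite actE seappE -(sdist_sg true) -k2_sided (lev1_k2pos lev).
  by rewrite -oapp_oval -tE.
apply: (@scaled_by_neg r _ (bexp (expok2 (cre K)))); last exact: (cann_k2 (@ann_cre K)).
move=> m; apply: endoP => v.
rewrite actE seappE -(sdist_sg false) -k2_sided (lev1_k2neg lev) k2neg_oval.
by rewrite oapp_oval sdist_sg.
Qed.

End CurrentsPreserve.

Section SubmoduleTheorem.
Variables (K : numFieldType) (rho : DYgl2_module K) (lev : level_one rho).
Notation A := (freeAlg K).
Notation F := (endo (fock_neq0 K)).
Notation act := (act rho).
Implicit Types (x y : bser A) (v w : fock K).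

Definition pact x : pser F := fun m => act (x m).

Lemma pactM x y : pact (x * y) = pact x * pact y.
Proof.
apply/funext => m; apply: etrans (congr1 act (pserME x y m)) _.
apply: etrans (act_sum _ _ _ _) _; apply: etrans _ (esym (pserME _ _ m)).
by apply: eq_bigr => i _; apply: actM.
Qed.

Lemma pact1 : pact 1 = 1.
Proof.
apply/funext => m; apply: etrans (congr1 act (pser1E _ m)) _.
by rewrite pser1E; case: (m == 0%N); rewrite ?act1 ?act0.
Qed.

Lemma pact_comm x y : GRing.comm x y -> GRing.comm (pact x) (pact y).
Proof. by move=> xy; rewrite /GRing.comm -!pactM xy. Qed.

Lemma pact_scaled s a r x : scaled_by rho s a r x ->
  ad (hcst (capp K r)) (pact x) = pact (@factor K s a r) * pact x.
Proof.
move=> xc; rewrite -pactM; apply/funext => m; apply: etrans _ (xc m).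
by rewrite /ad pserDE pserNE mul_hcstE mulr_hcstE.
Qed.

(** Both k_2 and k_1 commute with c_r up to the same central factor. *)
Lemma capp_Hcur s r m : GRing.comm (capp K r) (act (Hcur K s m)).
Proof.
have H0 := k1h0 K s; set k := k1h K s in H0 *.
have bb' : pact k * pact (binv k) = 1 by rewrite -pactM (mulbV H0) pact1.
have b'b : pact (binv k) * pact k = 1 by rewrite -pactM (mulVb H0) pact1.
have fc x : GRing.comm (pact (@factor K s (1 / 2) r)) (pact x).
  by apply: pact_comm; apply: factor_central.
have := ad_quotient bb' b'b (fc (k2h K s)) (fc (binv k))
  (pact_scaled (scaled_by_bsh (1 / 2) (k2b_scaled lev s r)))
  (pact_scaled (scaled_by_bsh (1 / 2) (k1b_scaled lev s r))).
rewrite -pactM => /comm_ad/comm_hcst c0; rewrite Hcur_sided /sdist.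
by case: ifP => _; [apply: c0|rewrite act0; apply: commr0].
Qed.

(** The case q = 0 of ad_shift. *)
Lemma capp_shift a r (p : fdist int A) : (forall m, GRing.comm (capp K r) (act (p m))) ->
  forall m, GRing.comm (capp K r) (act (dshiftK a p m)).
Proof.
move=> pc m; apply: comm_ad.
have e l : ad (capp K r) (act (p l)) = act ((fun=> 0 : pser A) l).
  by rewrite (ad_comm (pc l)) act0.
apply: etrans (ad_shift a e m) _; apply: etrans _ (act0 rho); apply: (congr1 act).
apply/funext => n; rewrite /dshiftK /dshift big1 // => j _.
by rewrite !scaler0.
Qed.

Lemma capp_Xroot s r m : GRing.comm (capp K r) (act (Xroot K s m)).
Proof.
case: s.
  have [t [tE tc _]] := Xpos_modes K.
  have -> : act (Xroot K true m) = seapp (t m).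
    by apply: endoP => v; rewrite actE seappE (lev1_Xpos lev) tE.
  by rewrite /GRing.comm -!seappM tc.
have [t tE tc] := Xneg_modes K.
have -> : act (Xroot K false m) = seapp (t m).
  by apply: endoP => v; rewrite actE seappE (lev1_Xneg lev) tE.
by rewrite /GRing.comm -!seappM tc.
Qed.

Lemma act_annihilated (x : pser A) v : (forall r, GRing.comm (capp K r) (act x)) ->
  annihilated v -> annihilated (DYact rho (toDY x) v).
Proof.
move=> xc Mv r; have := congr1 (fun e : F => e v) (xc r).
by rewrite !endoME !actE !seappE Mv => ->; apply: (endo0r (act x)).
Qed.

Lemma DYsl2_alg_annihilated (y : DYgl2 K) v : DYsl2_alg y -> annihilated v -> annihilated (DYact rho y v).
Proof.
move=> yA; elim: yA v => {y}.
- by move=> c v Mv; rewrite DYact_scal; apply: annihilated_hscale.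
- by move=> v Mv; rewrite (lev1_C lev).
- by move=> m v; apply: act_annihilated => r; apply: capp_shift => l; apply: capp_Xroot.
- by move=> m v; apply: act_annihilated => r; apply: capp_shift => l; apply: capp_Xroot.
- by move=> s m v; apply: act_annihilated => r; apply: capp_Hcur.
- by move=> x y _ IHx _ IHy v Mv; rewrite DYact_addl; apply: annihilatedD; [apply: IHx|apply: IHy].
- by move=> x y _ IHx _ IHy v Mv; rewrite DYact_mul; apply/IHx/IHy.
Qed.

Lemma DYact_hvar (y : DYgl2 K) v : DYact rho (toDY hvar * y)%R v = hscale hvar (DYact rho y v).
Proof.
rewrite DYact_mul -[LHS]actE act_hvar.
exact: seapp_hvar.
Qed.

(** The action of a convergent series is a convergent series in the kernel. *)
Lemma DYsl2_annihilated (y : DYgl2 K) v : DYsl2 y -> annihilated v -> annihilated (DYact rho y v).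
Proof.
move=> [s sA sy] Mv.
apply: (annihilated_completion (S := @annihilated K)) => //.
exists (fun n => DYact rho (s n) v) => [n|N]; first exact: (DYsl2_alg_annihilated (sA n) Mv).
have itE n z : DYact rho (iter n ( *%R (toDY hvar)) z) v = iter n (hscale hvar) (DYact rho z v).
  elim: n => [|n IH]; first by [].
  by rewrite [RHS]iterS -IH; apply: DYact_hvar.
have [z ->] := sy N; exists (DYact rho z v).
rewrite DYact_addl itE; congr (_ + _).
have d0 : DYact rho 0 v = 0 by apply: (addrI (DYact rho 0 v)); rewrite -DYact_addl !addr0.
have dD : {morph (fun y : DYgl2 K => DYact rho y v) : x y / x + y} by move=> x y'; apply: DYact_addl.
rewrite (big_morph (fun y : DYgl2 K => DYact rho y v) dD d0).
by apply: eq_bigr => n _; apply: itE.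
Qed.

Lemma L0_submodule : is_DYsl2_submodule rho (L0 K).
Proof.
split.
- by apply/L0E; apply: annihilated0.
- by move=> v w /L0E Mv /L0E Mw; apply/L0E/annihilatedD.
- by move=> c v /L0E Mv; apply/L0E/annihilated_hscale.
- by move=> y v yA /L0E Mv; apply/L0E/DYsl2_annihilated.
Qed.

End SubmoduleTheorem.

Theorem theorem3p13 (R : realType) (rho : DYgl2_module R[i])
  (hrho : level_one rho) : is_DYsl2_submodule rho (L0 R[i]).
Proof. exact: L0_submodule. Qed.
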